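(* Let $\Gamma$ be a non-elementary hyperbolic group with boundary $\partial\Gamma$, and let $\nu$ be the $\Gamma$-invariant measure on $\partial\Gamma\times\partial\Gamma$ defined in the context (for a fixed hat metric). Then for all large enough $p$ (that is, there is $p_0\in[1,\infty)$ such that for all $p\in[p_0,\infty)$) the linear isometric action of $\Gamma$ on $L^p(\partial\Gamma\times\partial\Gamma,\nu)$ admits a proper cocycle.
   Context: **Hat metrics.** Let $\Gamma$ be a non-elementary hyperbolic group, $X$ its Cayley graph with respect to a finite generating set, with path metric $d$, and let $\partial X=\partial\Gamma$ be the Gromov boundary and $\overline X=X\cup\partial X$. A hat metric is a metric $\hat d$ on $X$ such that: (i) $\hat d$ is $\Gamma$-invariant, quasi-isometric to $d$ (via the identity map), and roughly geodesic, i.e. there is $C\ge 0$ such that for all $x,y\in X$ there is a (not necessarily continuous) map $\gamma:[a,b]\to X$ with $\gamma(a)=x$, $\gamma(b)=y$ and $|s-t|-C\le \hat d(\gamma(s),\gamma(t))\le |s-t|+C$ for all $s,t\in[a,b]$; (ii) for each $o\in X$, the Gromov product $\langle x,y\rangle_o=\tfrac12(\hat d(o,x)+\hat d(o,y)-\hat d(x,y))$ on $X$ extends to a continuous map $\langle\cdot,\cdot\rangle_o:\overline X\times\overline X\to[0,\infty]$, where $\langle\xi,\omega\rangle_o=\infty$ if and only if $\xi=\omega\in\partial X$; (iii) for each $\varepsilon\in(0,1]$, $\exp(-\varepsilon\langle\cdot,\cdot\rangle_o)$ is a metric on $\partial X$ for all $o\in X$. Hat metrics exist by a theorem of Mineyev.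 Fix a hat metric $\hat d$. The basepoint is the identity $1\in\Gamma$, and $\langle\cdot,\cdot\rangle:=\langle\cdot,\cdot\rangle_1$. Put $\hat l(g)=\hat d(1,g)$ and let $\hat e(\Gamma)=\limsup_{n\to\infty}\frac1n\log\#\{g\in\Gamma:\hat l(g)\le n\}$ be the growth exponent with respect to $\hat l$. **The measure.** For $\varepsilon\in(0,1]$ equip $\partial\Gamma$ with the metric $\hat d_\varepsilon=\exp(-\varepsilon\langle\cdot,\cdot\rangle)$. Its Hausdorff dimension is $\hat D_\varepsilon=\hat e(\Gamma)/\varepsilon$ (a known fact), and the $\hat D_\varepsilon$-dimensional Hausdorff measure $\mu$ on $\partial\Gamma$ is independent of $\varepsilon$. Define $\nu$ on $\partial\Gamma\times\partial\Gamma$ by $\mathrm d\nu(\xi,\omega)=\exp(2\hat e(\Gamma)\langle\xi,\omega\rangle)\,\mathrm d\mu(\xi)\,\mathrm d\mu(\omega)$ (the diagonal is negligible). The measure $\nu$ is invariant under the diagonal action of $\Gamma$. **Actions and cocycles.** $L^p$-spaces are real and $p\in[1,\infty)$. The linear isometric action of $\Gamma$ on $L^p(\partial\Gamma\times\partial\Gamma,\nu)$ is $(g.F)(\xi,\omega)=F(g^{-1}\xi,g^{-1}\omega)$. A cocycle for it is a map $c:\Gamma\to L^p$, $g\mapsto c_g$, with $c_{gh}=g.c_h+c_g$ for all $g,h\in\Gamma$; it is proper if $\|c_g\|\to\infty$ as $g\to\infty$ in $\Gamma$ (i.e. for every $R$ only finitely many $g$ have $\|c_g\|\le R$). *)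

(* Defs.v *)
From HB Require Import structures.
From mathcomp Require Import all_boot all_order all_algebra.
From mathcomp Require Import finmap.
From mathcomp Require Import all_classical all_reals all_analysis.

Set Implicit Arguments.
Unset Strict Implicit.
Unset Printing Implicit Defensive.

Import Order.TTheory GRing.Theory Num.Theory.
Import numFieldNormedType.Exports.

Local Open Scope classical_set_scope.
Local Open Scope ring_scope.

Definition generates (G : groupType) (S : seq G) : Prop :=
  forall g : G, exists2 w : seq G,
    {subset w <= S ++ [seq (s^-1)%g | s <- S]} & g = (\prod_(x <- w) x)%g.

(* [a] generates a subgroup of finite index: finitely many of its left cosets
   cover [G]. Finite groups are included. *)
Definition virtually_cyclic (G : groupType) : Prop :=
  exists (a : G) (T : seq G), forall g : G, exists t n,
    t \in T /\ (g = (t * a ^+ n)%g \/ g = (t * a ^- n)%g).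

Definition is_metric (R : realType) (T : Type) (rho : T -> T -> R) : Prop :=
  [/\ forall x y, 0 <= rho x y,
      forall x y, rho x y = 0 <-> x = y,
      forall x y, rho x y = rho y x &
      forall x y z, rho x z <= rho x y + rho y z].

Definition gromov_product (R : realType) (T : Type) (rho : T -> T -> R)
    (o x y : T) : R :=
  (rho o x + rho o y - rho x y) / 2.

Definition gromov_hyperbolic (R : realType) (T : Type) (rho : T -> T -> R) :
    Prop :=
  exists delta : R, forall o x y z : T,
    Num.min (gromov_product rho o x y) (gromov_product rho o y z) - delta
      <= gromov_product rho o x z.

Section CayleyGraph.
Variables (R : realType) (G : groupType) (S : seq G).

(* Equality is allowed, so that a vertex is a degenerate edge. *)
Definition on_edge (a b : G) : bool :=
  [|| a == b, (a^-1 * b)%g \in S | (b^-1 * a)%g \in S].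

(* The point (1 - t) a + t b of the edge from a to b, in barycentric
   coordinates indexed by the vertices. *)
Definition edge_point (a b : G) (t : R) : G -> R :=
  fun h => (1 - t) * (h == a)%:R + t * (h == b)%:R.

Definition in_cayley (x : G -> R) : Prop :=
  exists a b t, [/\ on_edge a b, 0 <= t <= 1 & x = edge_point a b t].

(* The geometric realization of the Cayley graph with edges {g, g s}. *)
Definition cayley : Type := {x : G -> R | in_cayley x}.

Lemma in_cayley_vertex (g : G) : in_cayley (edge_point g g 0).
Proof. by exists g, g, 0; rewrite /on_edge eqxx lexx ler01. Qed.

Definition vertex (g : G) : cayley := exist _ _ (in_cayley_vertex g).

Lemma on_edge_mul (g a b : G) : on_edge (g * a)%g (g * b)%g = on_edge a b.
Proof.
have H (x y : G) : ((g * x)^-1 * (g * y) = x^-1 * y)%g.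
  by rewrite invgM -mulgA mulKg.
by rewrite /on_edge !H (inj_eq (@mulgI _ g)).
Qed.

Lemma edge_point_mul (g a b : G) (t : R) :
  (fun h => edge_point a b t (g^-1 * h)%g) =
  edge_point (g * a)%g (g * b)%g t.
Proof.
apply/funext => h; rewrite /edge_point.
have H (x : G) : (g^-1 * h == x)%g = (h == g * x)%g.
  by rewrite -(inj_eq (@mulgI _ g)) mulVKg.
by rewrite !H.
Qed.

Lemma in_cayley_act (g : G) (x : cayley) :
  in_cayley (fun h => sval x (g^-1 * h)%g).
Proof.
have [a [b [t [ab t01 ->]]]] := svalP x.
by exists (g * a)%g, (g * b)%g, t; rewrite on_edge_mul edge_point_mul.
Qed.

Definition cayley_act (g : G) (x : cayley) : cayley :=
  exist _ _ (in_cayley_act g x).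

Lemma cayley_eq (x y : cayley) : sval x = sval y -> x = y.
Proof.
case: x y => [x hx] [y hy] /= xy; subst y.
by congr exist; exact: Prop_irrelevance.
Qed.

Lemma cayley_actM (g h : G) (x : cayley) :
  cayley_act (g * h)%g x = cayley_act g (cayley_act h x).
Proof.
by apply: cayley_eq; apply/funext => k /=; rewrite invgM mulgA.
Qed.

Lemma cayley_act1 (x : cayley) : cayley_act 1%g x = x.
Proof.
by apply: cayley_eq; apply/funext => k /=; rewrite invg1 mul1g.
Qed.

(* [path_length x y l]: there is a path of length l from x to y that is a
   concatenation of finitely many segments, each inside a closed edge. *)
Inductive path_length : cayley -> cayley -> R -> Prop :=
| path_nil x : path_length x x 0
| path_cons x y z a b s t l :
    on_edge a b -> 0 <= s <= 1 -> 0 <= t <= 1 ->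
    sval x = edge_point a b s -> sval y = edge_point a b t ->
    path_length y z l -> path_length x z (`|s - t| + l).

Definition cayley_dist (x y : cayley) : R := inf [set l | path_length x y l].

Lemma path_length_act (g : G) (x y : cayley) (l : R) :
  path_length x y l -> path_length (cayley_act g x) (cayley_act g y) l.
Proof.
elim=> [{}x|{}x {}y z a b s t {}l ab s01 t01 xE yE _ IH].
  exact: path_nil.
apply: (@path_cons _ (cayley_act g y) _ (g * a)%g (g * b)%g) => //=.
- by rewrite on_edge_mul.
- by rewrite xE edge_point_mul.
- by rewrite yE edge_point_mul.
Qed.

Lemma cayley_dist_act (g : G) (x y : cayley) :
  cayley_dist (cayley_act g x) (cayley_act g y) = cayley_dist x y.
Proof.
congr inf; apply/seteqP; split=> l /= /path_length_act; last exact.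
by move=> /(_ g^-1%g); rewrite -!cayley_actM mulVg !cayley_act1.
Qed.

End CayleyGraph.

Arguments vertex R {G} S g.

Definition hyperbolic_group (R : realType) (G : groupType) : Prop :=
  exists2 S : seq G,
    generates S & gromov_hyperbolic (@cayley_dist R G S).

Section Boundary.
Variables (R : realType) (G : groupType) (S : seq G).
Local Notation X := (cayley R S).

Local Notation gprod := (gromov_product (@cayley_dist R G S)).

(* lim (u_i | v_j)_o = +oo as i, j -> oo, a condition independent of o. *)
Definition asymptotic (u v : nat -> X) : Prop :=
  forall (o : X) (M : R), exists N : nat, forall i j : nat,
    (N <= i)%N -> (N <= j)%N -> M <= gprod o (u i) (v j).

Definition to_infinity (u : nat -> X) : Prop := asymptotic u u.

(* The second disjunct occurs only when no sequence goes to infinity, that is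
   when G is finite. It is there because a measurable type must be inhabited. *)
Definition is_boundary_point (A : set (nat -> X)) : Prop :=
  (exists2 u, to_infinity u & A = [set v | to_infinity v /\ asymptotic u v])
  \/ ((forall u, ~ to_infinity u) /\ A = set0).

(* The Gromov boundary: asymptoty classes of sequences going to infinity. *)
Definition boundary : Type := {A : set (nat -> X) | is_boundary_point A}.

Lemma boundary_inhabited : exists _ : boundary, True.
Proof.
have [[u Hu]|nu] := pselect (exists u, to_infinity u).
  have H : is_boundary_point [set v | to_infinity v /\ asymptotic u v].
    by left; exists u.
  by exists (exist _ _ H).
have H : is_boundary_point set0.
  by right; split=> // u Hu; apply: nu; exists u.
by exists (exist _ _ H).
Qed.

HB.instance Definition _ := gen_eqMixin boundary.
HB.instance Definition _ := gen_choiceMixin boundary.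
HB.instance Definition _ :=
  isPointed.Build boundary (proj1_sig (cid boundary_inhabited)).

Lemma asymptotic_act (g : G) (u v : nat -> X) :
  asymptotic u v ->
  asymptotic (fun n => cayley_act g (u n)) (fun n => cayley_act g (v n)).
Proof.
move=> uv o M; have [N HN] := uv (cayley_act g^-1%g o) M.
exists N => i j Ni Nj; move: (HN _ _ Ni Nj); rewrite /gromov_product.
rewrite -[cayley_dist (cayley_act _ _) (u i)](cayley_dist_act g).
rewrite -[cayley_dist (cayley_act _ _) (v j)](cayley_dist_act g).
rewrite -[cayley_dist (u i) (v j)](cayley_dist_act g).
by rewrite -cayley_actM mulgV cayley_act1.
Qed.

Lemma is_boundary_point_act (g : G) (xi : boundary) :
  is_boundary_point
    [set (fun n => cayley_act g (u n)) | u in sval xi].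
Proof.
have [[u Hu ->]|[Hn ->]] := svalP xi; last by right; rewrite image_set0.
left; exists (fun n => cayley_act g (u n)); first exact: asymptotic_act.
apply/seteqP; split=> [_ [v [Hv uv] <-]|v [Hv uv]] /=.
  by split; exact: asymptotic_act.
have gK (w : nat -> X) :
    (fun n => cayley_act g (cayley_act g^-1%g (w n))) = w.
  by apply/funext => n; rewrite -cayley_actM mulgV cayley_act1.
have gVK (w : nat -> X) :
    (fun n => cayley_act g^-1%g (cayley_act g (w n))) = w.
  by apply/funext => n; rewrite -cayley_actM mulVg cayley_act1.
exists (fun n => cayley_act g^-1%g (v n)); last exact: gK.
split; first exact: asymptotic_act.
by move: (asymptotic_act g^-1%g uv); rewrite gVK.
Qed.

Definition boundary_act (g : G) (xi : boundary) : boundary :=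
  exist _ _ (is_boundary_point_act g xi).

Variant compactification : Type :=
| Inner of X
| Bd of boundary.

HB.instance Definition _ := gen_eqMixin compactification.
HB.instance Definition _ := gen_choiceMixin compactification.

Definition represents (a : compactification) (v : nat -> X) : Prop :=
  match a with
  | Inner x => v = cst x
  | Bd xi => sval xi v
  end.

(* Points a with (xi | a) > r, up to bounded changes of r. *)
Definition shadow (xi : boundary) (r : R) : set compactification :=
  [set a | exists u v, [/\ sval xi u, represents a v &
    exists N : nat, forall i j : nat, (N <= i)%N -> (N <= j)%N ->
      r < gprod (vertex R S 1%g) (u i) (v j)]].

(* The topology for which the shadows of xi form a neighborhood base at
   xi, and the metric balls of X at the points of X. *)
Definition compactification_open (U : set compactification) : Prop :=
  (forall x : X, U (Inner x) -> exists2 e : R, 0 < e &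
     forall y : X, cayley_dist x y < e -> U (Inner y)) /\
  (forall xi : boundary, U (Bd xi) -> exists r : R, shadow xi r `<=` U).

Lemma compactification_openT : compactification_open setT.
Proof. by split=> [x _|xi _]; [exists 1|exists 0]. Qed.

Lemma compactification_openI : setI_closed compactification_open.
Proof.
move=> U V [U1 U2] [V1 V2]; split=> [x [/U1[e e0 Ue] /V1[f f0 Vf]]|].
  exists (Num.min e f); first by rewrite lt_min e0.
  by move=> y; rewrite lt_min => /andP[/Ue ? /Vf].
move=> xi [/U2[r Ur] /V2[s Vs]]; exists (Num.max r s).
move=> a [u [v [Hu Hv [N HN]]]]; split; [apply: Ur|apply: Vs];
  exists u, v; split=> //; exists N => i j Ni Nj;
  by move: (HN _ _ Ni Nj); rewrite gt_max => /andP[].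
Qed.

Lemma compactification_open_bigU (I : Type)
    (f : I -> set compactification) :
  (forall i, compactification_open (f i)) ->
  compactification_open (\bigcup_i f i).
Proof.
move=> fo; split=> [x [i _ /(fo i).1[e e0 fe]]|xi [i _ /(fo i).2[r fr]]].
  by exists e => // y /fe; exists i.
by exists r => a /fr; exists i.
Qed.

HB.instance Definition _ := isOpenTopological.Build compactification
  compactification_openT compactification_openI compactification_open_bigU.

Definition boundary_borel : Type :=
  g_sigma_algebraType [set Bd @^-1` U | U in @open compactification].

HB.instance Definition _ := Measurable.on boundary_borel.

End Boundary.

Arguments Inner {R G S}.
Arguments Bd {R G S}.

(* exp (- eps <xi, om>), with value 0 where <xi, om> = +oo. *)
Definition visual (R : realType) (B : Type) (gp : B -> B -> \bar R) (eps : R)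
    (xi om : B) : R :=
  fine (expeR (- (eps%:E * gp xi om))%E).

(* The continuous extension [hat_gprod o] of the Gromov product is a field of
   the record, but it is determined by [hat_dist]. *)
Record hat_metric (R : realType) (G : groupType) (S : seq G) := HatMetric {
  hat_dist : cayley R S -> cayley R S -> R ;
  hat_gprod : cayley R S ->
    compactification R S -> compactification R S -> \bar R ;
  hat_distP : is_metric hat_dist ;
  hat_dist_invariant : forall (g : G) (x y : cayley R S),
    hat_dist (cayley_act g x) (cayley_act g y) = hat_dist x y ;
  hat_dist_quasi_isometric : exists L C : R, [/\ 1 <= L, 0 <= C &
    forall x y, L^-1 * cayley_dist x y - C <= hat_dist x y
                /\ hat_dist x y <= L * cayley_dist x y + C] ;
  hat_dist_roughly_geodesic : exists2 C : R, 0 <= C &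
    forall x y, exists (a b : R) (gam : R -> cayley R S),
      [/\ a <= b, gam a = x, gam b = y &
          forall s t, a <= s <= b -> a <= t <= b ->
            `|s - t| - C <= hat_dist (gam s) (gam t)
            /\ hat_dist (gam s) (gam t) <= `|s - t| + C] ;
  hat_gprodE : forall o x y : cayley R S,
    hat_gprod o (Inner x) (Inner y) = (gromov_product hat_dist o x y)%:E ;
  hat_gprod_ge0 : forall o a b, (0 <= hat_gprod o a b)%E ;
  hat_gprod_continuous : forall o,
    continuous (fun ab : compactification R S * compactification R S =>
                  hat_gprod o ab.1 ab.2) ;
  hat_gprod_eqy : forall o a b, hat_gprod o a b = +oo%E <->
    exists2 xi : boundary R S, a = Bd xi & b = Bd xi ;
  hat_visual_metric : forall (eps : R) (o : cayley R S), 0 < eps <= 1 ->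
    is_metric (visual (fun xi om => hat_gprod o (Bd xi) (Bd om)) eps)
}.

Section HausdorffMeasure.
Variables (R : realType) (T : Type) (rho : T -> T -> R).
Local Open Scope ereal_scope.

(* The point 0 is added to the set of distances so that diam set0 = 0. *)
Definition diam (A : set T) : \bar R :=
  ereal_sup ([set 0] `|` [set (rho z.1 z.2)%:E | z in A `*` A]).

Definition hausdorff_premeasure (D : R) (delta : R) (A : set T) : \bar R :=
  ereal_inf [set \sum_(k <oo) diam (U k) `^ D |
    U in [set U : nat -> set T |
      A `<=` \bigcup_k U k /\ forall k, diam (U k) <= delta%:E]].

Definition hausdorff_measure (D : R) (A : set T) : \bar R :=
  ereal_sup [set hausdorff_premeasure D delta A |
    delta in [set delta : R | (0 < delta)%R]].

End HausdorffMeasure.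

Section BoundaryMeasure.
Variables (R : realType) (G : groupType) (S : seq G) (H : hat_metric R S).
Local Notation B := (boundary_borel R S).

Definition hat_length (g : G) : R :=
  hat_dist H (vertex R S 1%g) (vertex R S g).

Definition growth_exponent : R :=
  fine (limn_esup (fun n : nat =>
    (n%:R^-1 * ln (#|` fset_set [set g : G | hat_length g <= n%:R]|%:R))%:E)).

Definition hat_product (xi om : B) : \bar R :=
  hat_gprod H (vertex R S 1%g) (Bd xi) (Bd om).

Definition hat_visual (eps : R) : B -> B -> R := visual hat_product eps.

Definition mu (eps : R) : set B -> \bar R :=
  hausdorff_measure (hat_visual eps) (growth_exponent / eps).

Definition has_nu_density (eps : R) (m : set (B * B) -> \bar R) : Prop :=
  forall A : set (B * B), measurable A ->
    m A = (\int[mu eps \x mu eps]_(z in A)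
             expeR ((2 * growth_exponent)%:E * hat_product z.1 z.2))%E.

(* The measure with density exp (2 e <xi, om>) with respect to mu x mu. It
   exists since mu is a finite Borel measure, a fact that this definition does
   not presuppose; the value mzero would be taken if it did not exist. *)
Definition nu (eps : R) : {measure set (B * B) -> \bar R} :=
  match pselect (exists m : {measure set (B * B) -> \bar R},
                   has_nu_density eps m) with
  | left ex => proj1_sig (cid ex)
  | right _ => mzero
  end.

Definition diag_act (g : G) (z : B * B) : B * B :=
  (boundary_act g z.1, boundary_act g z.2).

Variables (eps p : R) (p1 : (1 <= p%:E)%E).

(* Elements of L^p are evaluated through representatives; the choice does not
   matter up to nu-negligible sets because nu is G-invariant. *)
Definition is_cocycle (c : G -> LspaceType (nu eps) p1) : Prop :=
  forall g h : G,
    (c (g * h)%g : B * B -> R)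
      = (fun z => c h (diag_act g^-1%g z) + c g z) %[ae nu eps].

Definition is_proper (c : G -> LspaceType (nu eps) p1) : Prop :=
  forall M : R,
    finite_set [set g : G | ('N[nu eps]_p%:E[EFin \o c g] <= M%:E)%E].

End BoundaryMeasure.

(* Main.v *)
Require Import Defs.
From HB Require Import structures.
From mathcomp Require Import all_boot all_order all_algebra.
From mathcomp Require Import finmap.
From mathcomp Require Import all_classical all_reals all_analysis.
From mathcomp Require Import measurable_realfun.
From mathcomp Require Import lra ring zify.

(* The cocycle is c_g(xi, om) = <g, xi> - <g, om>, half the difference of two Busemann
   cocycles. Writing |g| for the hat length and e for the growth exponent:

   - The hat metric is hyperbolic: if <x, w>_1 and <w, y>_1 were large and <x, y>_1 bounded,
     then limits of x, w, y in the boundary would coincide, contradicting continuity of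
     the extended product. With rough geodesics this gives the four-point inequality.
   - A boundary point with finite orbit makes the group virtually cyclic, since its Busemann
     function is a homomorphism with finite level sets on the stabilizer. Hence
     finitely many translations separate any two directions, so annuli satisfy
     a(n)^2 <= C sum_(|j| <= c) a(2n + j), and the growth is purely exponential with e > 0.
   - Counting in shadows bounds the Hausdorff measure mu of shadows from above and, through
     finite subcovers, that of the whole boundary from below; so mu is finite,
     nonzero and without atoms, and nu exists.
   - Comparing the visual metrics based at 1 and at g shows that
     |c_g(xi, om)| <= C_g exp(- <xi, om>), so c_g is p-integrable for p >= 2e + 1. Each unit
     of length of a geodesic from 1 to g contributes at least a constant to the p-th power
     of the norm of c_g, hence properness. *)
Set Implicit Arguments.
Unset Strict Implicit.
Unset Printing Implicit Defensive.

Import Order.TTheory GRing.Theory Num.Theory.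
Import numFieldNormedType.Exports.

Local Open Scope classical_set_scope.
Local Open Scope ring_scope.

(** * Word length and the Cayley graph *)

(** The obstacle is exactness. In a general hyperbolic metric, Busemann functions are defined only
    up to bounded error and give quasi-cocycles. The hat product extends continuously, so [gpx g xi]
    is a genuine limit and the cocycle identity holds at every pair of boundary points. Condition
    (iii) enters the decay estimate with parameter 1, whatever [eps] is: it makes [exp <g, .>]
    Lipschitz for the visual metric [exp (- <., .>)]. The decay near the diagonal thus has rate 1,
    and the threshold for [p] does not depend on [eps]. Two descriptions of the boundary have to be
    matched: Borel sets come from shadows in the word metric, the Hausdorff measure from visual
    metrics. Openness is transferred from the former to the latter before [mu] becomes a Borel
    measure, and back, up to the sigma-algebra, by separability. Elements of $L^p$ are classes
    evaluated through representatives, so translating them requires that the action carry [nu]-null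
    sets to [nu]-null sets. *)

Section WordLength.
Variables (G : groupType) (S : seq G).
Hypothesis gen : generates S.

Local Notation alphabet := (S ++ [seq (s^-1)%g | s <- S]).

Definition is_word (n : nat) (g : G) : Prop :=
  exists w : seq G, [/\ {subset w <= alphabet}, g = (\prod_(x <- w) x)%g
    & size w = n].

Lemma exists_word (g : G) : exists n, `[< is_word n g >].
Proof. by have [w Sw gw] := gen g; exists (size w); apply/asboolP; exists w. Qed.

Definition wlen (g : G) : nat := ex_minn (exists_word g).

Lemma wlen_le n g : is_word n g -> (wlen g <= n)%N.
Proof. by move=> ng; rewrite /wlen; case: ex_minnP => m _; apply; apply/asboolP. Qed.

Lemma wlen_word g : is_word (wlen g) g.
Proof. by rewrite /wlen; case: ex_minnP => m /asboolP. Qed.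

Lemma is_wordM m n g h : is_word m g -> is_word n h -> is_word (m + n) (g * h)%g.
Proof.
move=> [v [Sv -> <-]] [w [Sw -> <-]]; exists (v ++ w); rewrite big_cat size_cat.
by split=> // x; rewrite mem_cat => /orP[/Sv|/Sw].
Qed.

Lemma wlenM g h : (wlen (g * h)%g <= wlen g + wlen h)%N.
Proof. by apply/wlen_le/is_wordM; exact: wlen_word. Qed.

Lemma wlen1 : wlen 1%g = 0%N.
Proof. by apply/eqP; rewrite -leqn0; apply: wlen_le; exists [::]; rewrite big_nil. Qed.

Lemma wlen0 g : wlen g = 0%N -> g = 1%g.
Proof.
by move=> g0; have [w [_ gE sw]] := wlen_word g; move: sw gE;
  rewrite g0 => /size0nil ->; rewrite big_nil.
Qed.

Lemma is_word_letter a : a \in alphabet -> is_word 1 a.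
Proof. by move=> Aa; exists [:: a]; split=> //;
  [move=> x; rewrite inE => /eqP->|rewrite big_seq1]. Qed.

Lemma wlen_prefix n g : (n <= wlen g)%N ->
  exists p : G, wlen p = n /\ wlen g = (n + wlen (p^-1 * g)%g)%N.
Proof.
have [w [Sw gw sw]] := wlen_word g => ng.
pose p := (\prod_(x <- take n w) x)%g; exists p.
have gE : g = (p * \prod_(x <- drop n w) x)%g by rewrite gw -big_cat cat_take_drop.
have sn : (size (take n w) = n)%N by rewrite size_takel // sw.
have p1 : (wlen p <= n)%N.
  by apply: wlen_le; exists (take n w); split=> // x /mem_take /Sw.
have p2 : (wlen (p^-1 * g)%g <= wlen g - n)%N.
  apply: wlen_le; exists (drop n w); rewrite gE mulKg -gE size_drop sw.
  by split=> // x /mem_drop /Sw.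
have := wlenM p (p^-1 * g)%g; rewrite mulVKg; lia.
Qed.

Lemma wlen_ball n : exists s : seq G, forall g, (wlen g <= n)%N -> g \in s.
Proof.
elim: n => [|n [s Hs]].
  by exists [:: 1%g] => g; rewrite leqn0 => /eqP/wlen0 ->; rewrite mem_head.
exists ([seq (p * a)%g | p <- s, a <- alphabet] ++ s) => g.
rewrite mem_cat leq_eqVlt => /orP[/eqP gn|/Hs ->]; last by rewrite orbT.
have [p [pn gp]] : exists p : G, wlen p = n /\ wlen g = (n + wlen (p^-1 * g)%g)%N.
  by apply: wlen_prefix; rewrite gn.
have [[|a [|b w]] [Sw pgw sw]] := wlen_word (p^-1 * g)%g; move: sw => /=; [lia| |lia].
rewrite big_seq1 in pgw => _; apply/orP; left; apply/allpairsP; exists (p, a) => /=; split.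
- by apply: Hs; rewrite pn.
- by apply: Sw; rewrite mem_head.
- by rewrite -pgw mulVKg.
Qed.

Lemma wlen_edge a b : on_edge S a b -> (wlen b <= (wlen a).+1)%N /\ (wlen a <= (wlen b).+1)%N.
Proof.
suff H x y : y != 1%g -> y \in alphabet -> (wlen (x * y)%g <= (wlen x).+1)%N.
  have [<-|ab] := eqVneq a b; first by lia.
  have ab1 : (a^-1 * b)%g != 1%g by apply: contra ab => /eqP /mulg1_eq; rewrite invgK => ->.
  have ba1 : (b^-1 * a)%g != 1%g by apply: contra ab => /eqP /mulg1_eq; rewrite invgK => ->.
  have abA : ((a^-1 * b)%g \in S) || ((b^-1 * a)%g \in S) ->
     ((a^-1 * b)%g \in alphabet) /\ ((b^-1 * a)%g \in alphabet).
    have E (x y : G) : (x^-1 * y)%g = ((y^-1 * x)^-1)%g by rewrite invgM invgK.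
    by rewrite !mem_cat => /orP[] h; rewrite h ?orTb; (split=> //; apply/orP; right);
      rewrite E (map_f (fun s => s^-1%g)).
  rewrite /on_edge (negbTE ab) /= => /abA[h1 h2].
  by split; [have := H a _ ab1 h1|have := H b _ ba1 h2]; rewrite mulVKg.
move=> _ yA; apply: (leq_trans (wlenM _ _)).
by rewrite -addn1 leq_add2l; apply/wlen_le/is_word_letter.
Qed.

End WordLength.

(** * The path metric of the Cayley graph *)

Section CayleyDist.
Variables (R : realType) (G : groupType) (S : seq G).
Hypothesis gen : generates S.
Local Notation X := (cayley R S).
Local Notation d := (@cayley_dist R G S).
Local Notation V := (vertex R S).
Local Notation wl := (wlen gen).
Implicit Types (x y z : X) (g h : G).

Lemma path_length_ge0 x y l : path_length x y l -> 0 <= l.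
Proof. by elim=> [x'|x' y' z' a b s t m _ _ _ _ _ _ m0]; [exact: lexx|exact: addr_ge0]. Qed.

Lemma path_length_cat x y z l m :
  path_length x y l -> path_length y z m -> path_length x z (l + m).
Proof.
move=> xy yz; elim: xy yz => [?|x' y' z' a b s t {}l ab s01 t01 xE yE _ IH /IH {}IH].
  by rewrite add0r.
by rewrite -addrA; exact: (path_cons ab s01 t01 xE yE IH).
Qed.

Lemma path_length_seg x y a b s t : on_edge S a b -> 0 <= s <= 1 -> 0 <= t <= 1 ->
  sval x = edge_point a b s -> sval y = edge_point a b t ->
  path_length x y `|s - t|.
Proof.
move=> ab s01 t01 xE yE; rewrite -(addr0 `|_|).
by apply: (path_cons ab s01 t01 xE yE); exact: path_nil.
Qed.

Lemma path_length_sym x y l : path_length x y l -> path_length y x l.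
Proof.
elim=> [?|x' y' z' a b s t {}l ab s01 t01 xE yE _ IH]; first exact: path_nil.
rewrite addrC; apply: path_length_cat IH _.
by rewrite distrC; exact: (path_length_seg ab t01 s01 yE xE).
Qed.

Lemma edge_point0 (a b : G) : edge_point a b 0 = edge_point a a (0 : R).
Proof. by apply/funext => h; rewrite /edge_point !mul0r. Qed.

Lemma edge_point1 (a b : G) : edge_point a b 1 = edge_point b b (0 : R).
Proof. by apply/funext => h; rewrite /edge_point !mul0r subrr subr0 mul0r addr0 add0r. Qed.

Lemma path_length_edge g h : on_edge S g h -> path_length (V g) (V h) 1.
Proof.
move=> gh; have -> : 1 = `|0 - 1| :> R by rewrite sub0r normrN normr1.
by apply: (path_length_seg gh); rewrite ?lexx ?ler01 //= ?edge_point1 // edge_point0.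
Qed.

Lemma on_edge_letter g a : a \in S ++ [seq (s^-1)%g | s <- S] -> on_edge S g (g * a)%g.
Proof.
rewrite mem_cat /on_edge mulKg => /orP[->|/mapP[s sS ->]]; first by rewrite orbT.
by rewrite invgM invgK mulgVK sS !orbT.
Qed.

Lemma path_length_word n g a : is_word S n a -> path_length (V g) (V (g * a)%g) n%:R.
Proof.
move=> [w [Sw -> <-]]; elim: w g Sw => [|b w IH] g Sw.
  by rewrite big_nil mulg1; exact: path_nil.
rewrite big_cons mulgA /= -addn1 natrD addrC.
apply: path_length_cat; last by apply: IH => x xw; apply: Sw; rewrite inE xw orbT.
by apply/path_length_edge/on_edge_letter/Sw; rewrite mem_head.
Qed.

Lemma near_vertex_path x : exists2 g, exists2 l, path_length x (V g) l & l <= 1 & True.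
Proof.
have [a [b [t [ab t01 xE]]]] := svalP x.
exists a => //; exists `|t - 0|.
  by apply: (path_length_seg ab t01 _ xE); rewrite ?lexx ?ler01 //= edge_point0.
by case/andP: t01 => t0 t1; rewrite subr0 ger0_norm.
Qed.

Lemma path_length_vertex g h : path_length (V g) (V h) (wl (g^-1 * h)%g)%:R.
Proof. by rewrite -{1}(mulVKg g h); exact/path_length_word/wlen_word. Qed.

Lemma path_length_ex x y : exists l, path_length x y l.
Proof.
have [g [l xg _] _] := near_vertex_path x; have [h [m yh _] _] := near_vertex_path y.
exists (l + ((wl (g^-1 * h)%g)%:R + m)).
apply: (path_length_cat xg); apply: (path_length_cat (path_length_vertex g h)).
exact: path_length_sym.
Qed.

Lemma path_has_inf x y : has_inf [set l | path_length x y l].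
Proof. by split; [exact: path_length_ex|exists 0 => l /= /path_length_ge0]. Qed.

Lemma cayley_dist_le x y l : path_length x y l -> d x y <= l.
Proof. by move=> xy; apply: ge_inf => //; case: (path_has_inf x y). Qed.

Lemma cayley_dist_ge x y m : (forall l, path_length x y l -> m <= l) -> m <= d x y.
Proof. by move=> H; apply: lb_le_inf; [exact: path_length_ex|move=> l; exact: H]. Qed.

Lemma cayley_dist_sym x y : d x y = d y x.
Proof.
apply/eqP; rewrite eq_le; apply/andP; split; apply: cayley_dist_ge => l /path_length_sym;
  exact: cayley_dist_le.
Qed.

Lemma cayley_dist_triangle y x z : d x z <= d x y + d y z.
Proof.
rewrite -lerBlDr; apply: cayley_dist_ge => l xy; rewrite lerBlDl -lerBlDr.
apply: cayley_dist_ge => m yz; rewrite lerBlDr addrC; apply: cayley_dist_le.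
exact: path_length_cat yz.
Qed.

Lemma near_vertex x : exists g, d x (V g) <= 1.
Proof.
have [g [l xg l1] _] := near_vertex_path x; exists g.
exact: le_trans (cayley_dist_le xg) l1.
Qed.

(** The left side depends only on the function [edge_point a b t], so the affine extension of [f] to
    an edge does not depend on the edge chosen to represent a point. *)
Lemma sum_edge_point (f : G -> R) (s : seq G) a b t : uniq s -> a \in s -> b \in s ->
  \sum_(h <- s) edge_point a b t h * f h = (1 - t) * f a + t * f b.
Proof.
move=> us as_ bs.
have D c : c \in s -> \sum_(h <- s) (h == c)%:R * f h = f c.
  move=> cs; rewrite (bigD1_seq c) //= eqxx mul1r big1 ?addr0 // => i /negbTE ->.
  by rewrite mul0r.
rewrite -(D a) // -(D b) // !mulr_sumr -big_split /=.
by apply: eq_bigr => h _; rewrite /edge_point; ring.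
Qed.

(* The barycentric extension of the word length to the edges is 1-Lipschitz. *)
Lemma path_length_lb x z l : path_length x z l -> forall a b s c e t,
  on_edge S a b -> on_edge S c e ->
  sval x = edge_point a b s -> sval z = edge_point c e t ->
  `|((1 - s) * (wl a)%:R + s * (wl b)%:R)
    - ((1 - t) * (wl c)%:R + t * (wl e)%:R)| <= l.
Proof.
(* A vertex lies on all its incident edges, and consecutive segments of a path may describe their
   common point by different edges. *)
have E x' a b s c e t : sval x' = edge_point a b s -> sval x' = edge_point c e t ->
  (1 - s) * (wl a)%:R + s * (wl b)%:R = (1 - t) * (wl c)%:R + t * (wl e)%:R :> R.
  move=> xE xE'; pose u := undup [:: a; b; c; e].
  have uu : uniq u := undup_uniq _.
  have inu h : h \in [:: a; b; c; e] -> h \in u by rewrite mem_undup.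
  have [ua ub uc ue] : [/\ a \in u, b \in u, c \in u & e \in u].
    by split; apply: inu; rewrite !inE eqxx ?orbT.
  by rewrite -!(@sum_edge_point (fun h => (wl h)%:R) u) // -xE xE'.
elim=> [{}x|{}x y {}z a b s t {}l ab s01 t01 xE yE yz IH] a' b' s' c e t' ab' ce xE' zE.
  by rewrite (E _ _ _ _ _ _ _ xE' zE) subrr normr0.
rewrite (E _ _ _ _ _ _ _ xE' xE).
have := IH _ _ _ _ _ _ ab ce yE zE.
set P := (_ + _) - _ => lP.
have -> : (1 - s) * (wl a)%:R + s * (wl b)%:R - ((1 - t') * (wl c)%:R + t' * (wl e)%:R)
  = (s - t) * ((wl b)%:R - (wl a)%:R) + P by rewrite /P; ring.
apply: (le_trans (ler_normD _ _)); apply: lerD => //.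
rewrite normrM ler_piMr //.
have [h1 h2] := wlen_edge gen ab.
rewrite ler_norml lerBlDr lerBrDr; apply/andP; split.
  by rewrite addrC lerBlDr natr1 ler_nat.
by rewrite addrC natr1 ler_nat.
Qed.

Lemma cayley_dist_vertex g h : d (V g) (V h) = (wl (g^-1 * h)%g)%:R.
Proof.
apply/eqP; rewrite eq_le (cayley_dist_le (path_length_vertex g h)) /=.
have -> : d (V g) (V h) = d (V 1%g) (V (g^-1 * h)%g).
  rewrite -(cayley_dist_act g^-1%g).
  have cV k : cayley_act g^-1%g (V k) = V (g^-1 * k)%g.
    by apply: cayley_eq => /=; rewrite edge_point_mul.
  by rewrite !cV mulVg.
apply: cayley_dist_ge => l /path_length_lb H.
have ee (k : G) : on_edge S k k by rewrite /on_edge eqxx.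
have := H _ _ _ _ _ _ (ee 1%g) (ee (g^-1 * h)%g) erefl erefl.
by rewrite wlen1 mulr0n !mulr0 !mul0r subr0 mul1r !addr0 add0r normrN ger0_norm.
Qed.

End CayleyDist.

(** * Sequences going to infinity *)

Section Diagonal.

Definition unbounded (A : set nat) : Prop := forall N, exists2 n, (N <= n)%N & A n.

Lemma unbounded_pigeonhole (T : eqType) (s : seq T) (Q : T -> nat -> Prop) (A : set nat) :
  unbounded A -> (exists N, forall n, (N <= n)%N -> A n -> exists2 p, p \in s & Q p n) ->
  exists p, unbounded (A `&` Q p).
Proof.
move=> Ainf; elim: s => [|a s IH] [N HN]; first by have [n Nn /(HN _ Nn)[]] := Ainf N.
have [?|nA] := pselect (unbounded (A `&` Q a)); first by exists a.
apply: IH; move/existsNP: nA => [M HM]; exists (maxn N M) => n.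
rewrite geq_max => /andP[Nn Mn] An.
have [p] := HN n Nn An; rewrite inE => /orP[/eqP -> Qn|]; last by exists p.
by exfalso; apply: HM; exists n.
Qed.

(** Nested unbounded sets [A_ k] are chosen so that [E k] holds on [A_ k], and [f n] is taken in
    [A_ n] beyond [n]. The condition [n <= f n] replaces monotonicity: it is all that passing to
    tails requires. *)
Lemma diagonal (E : nat -> nat -> nat -> Prop) :
  (forall k A, unbounded A -> exists2 A', unbounded A' /\ A' `<=` A &
     forall m n, A' m -> A' n -> E k m n) ->
  exists f : nat -> nat, (forall n, n <= f n)%N /\
    forall k i j, (k <= i)%N -> (k <= j)%N -> E k (f i) (f j).
Proof.
move=> H.
have /choice[step stepP] (kA : nat * {A | unbounded A}) : exists A' : {A | unbounded A},
    sval A' `<=` sval kA.2 /\ forall m n, sval A' m -> sval A' n -> E kA.1 m n.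
  by have [A' [iA' A'A] HA'] := H kA.1 _ (svalP kA.2); exists (exist _ _ iA').
have UT : unbounded setT by move=> N; exists N.
pose A_ := fix A_ k := if k is k'.+1 then step (k, A_ k') else step (0%N, exist _ _ UT).
have AS k : sval (A_ k.+1) `<=` sval (A_ k) by have [] := stepP (k.+1, A_ k).
have AE k m n : sval (A_ k) m -> sval (A_ k) n -> E k m n.
  by case: k => [|k]; [have [_] := stepP (0%N, exist _ _ UT)|have [_] := stepP (k.+1, A_ k)]; exact.
have AM k l : (k <= l)%N -> sval (A_ l) `<=` sval (A_ k).
  by move=> /subnK <-; elim: (l - k)%N => // n IH x /AS /IH.
have /choice[f fP] k : exists n, (k <= n)%N /\ sval (A_ k) n.
  by have [n kn An] := svalP (A_ k) k; exists n.
exists f; split=> [n|k i j ki kj]; first by have [] := fP n.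
by apply: AE; [apply: (AM _ _ ki)|apply: (AM _ _ kj)]; have [] := fP i; have [] := fP j.
Qed.

End Diagonal.

Section GromovProduct.
Variables (R : realType) (T : Type) (rho : T -> T -> R).
Hypothesis sym : forall x y, rho x y = rho y x.
Hypothesis tri : forall y x z, rho x z <= rho x y + rho y z.
Local Notation gp := (gromov_product rho).

Lemma gromov_productC o x y : gp o x y = gp o y x.
Proof. by rewrite /gromov_product (sym x y); lra. Qed.

Lemma gromov_product_near o x x' y : gp o x' y - rho x x' <= gp o x y.
Proof.
rewrite /gromov_product; have := tri x o x'; have := tri x' x y; have := sym x x'; lra.
Qed.

Lemma gromov_product_base o o' x y : gp o' x y - rho o o' <= gp o x y.
Proof.
rewrite /gromov_product; have := tri o o' x; have := tri o o' y; have := sym o o'; lra.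
Qed.

Lemma gromov_product_le o x y : gp o x y <= rho o x.
Proof. by rewrite /gromov_product; have := tri x o y; lra. Qed.

Lemma gromov_product_ge0 o x y : 0 <= gp o x y.
Proof. by rewrite /gromov_product; have := tri o x y; have := sym o x; lra. Qed.

End GromovProduct.

(** * Boundary points as limits of group elements *)

Section Boundary.
Variables (R : realType) (G : groupType) (S : seq G).
Hypothesis gen : generates S.
Local Notation X := (cayley R S).
Local Notation d := (@cayley_dist R G S).
Local Notation V := (vertex R S).
Local Notation wl := (wlen gen).
Local Notation gprod := (gromov_product d).
Local Notation o := (V 1%g).
Local Notation dsym := (cayley_dist_sym gen).
Local Notation dtri := (cayley_dist_triangle gen).
Implicit Types (u v : nat -> X) (g h : nat -> G).

Lemma asymptotic_at_base u v : (forall M : R, exists N : nat, forall i j : nat,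
    (N <= i)%N -> (N <= j)%N -> M <= gprod o (u i) (v j)) -> asymptotic u v.
Proof.
move=> H o' M; have [N HN] := H (M + d o' o); exists N => i j Ni Nj.
have := HN i j Ni Nj; have := gromov_product_base dsym dtri o' o (u i) (v j); lra.
Qed.

Lemma asymptotic_sym u v : asymptotic u v -> asymptotic v u.
Proof.
move=> uv p M; have [N HN] := uv p M; exists N => i j Ni Nj.
by rewrite (gromov_productC dsym); apply: HN.
Qed.

Lemma asymptotic_near u v v' (c : R) : (forall n, d (v n) (v' n) <= c) ->
  asymptotic u v -> asymptotic u v'.
Proof.
move=> vv' uv p M; have [N HN] := uv p (M + c); exists N => i j Ni Nj.
rewrite (gromov_productC dsym p (u i) (v' j)).
have := HN i j Ni Nj; rewrite (gromov_productC dsym p (u i) (v j)).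
have := gromov_product_near dsym dtri p (v' j) (v j) (u i).
have := vv' j; rewrite (dsym (v j)); lra.
Qed.

Lemma asymptotic_sub u v (f : nat -> nat) : (forall n, n <= f n)%N ->
  asymptotic u v -> asymptotic u (v \o f).
Proof.
move=> nf uv p M; have [N HN] := uv p M; exists N => i j Ni Nj /=.
by apply: HN => //; exact: leq_trans (nf j).
Qed.

Lemma to_infinity_near v v' (c : R) : (forall n, d (v n) (v' n) <= c) ->
  to_infinity v -> to_infinity v'.
Proof.
move=> vv' /(asymptotic_near vv') /asymptotic_sym /(asymptotic_near vv'); exact.
Qed.

Lemma to_infinity_sub u (f : nat -> nat) : (forall n, n <= f n)%N ->
  to_infinity u -> to_infinity (u \o f).
Proof.
move=> nf /(asymptotic_sub nf) /asymptotic_sym /(asymptotic_sub nf); exact.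
Qed.

Lemma is_boundary_point_class u : to_infinity u ->
  is_boundary_point [set v | to_infinity v /\ asymptotic u v].
Proof. by move=> uu; left; exists u. Qed.

Definition boundary_class u (uu : to_infinity u) : boundary R S :=
  exist _ _ (is_boundary_point_class uu).

Lemma sub_mem_boundary (xi : boundary R S) u (f : nat -> nat) : (forall n, n <= f n)%N ->
  sval xi u -> sval xi (u \o f).
Proof.
move=> nf; have [[v vv ->]|[_ ->]] := svalP xi; last by [].
by move=> [uu vu]; split; [exact: to_infinity_sub|exact: asymptotic_sub].
Qed.

Lemma near_mem_boundary (xi : boundary R S) v v' (c : R) : (forall n, d (v n) (v' n) <= c) ->
  sval xi v -> sval xi v'.
Proof.
move=> vv'; have [[w ww ->]|[_ ->]] := svalP xi; last by [].
by move=> [uu vu]; split; [exact: to_infinity_near vv' _|exact: asymptotic_near vv' _].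
Qed.

Lemma common_prefix (k : nat) (p x y : G) :
  wl x = (k + wl (p^-1 * x)%g)%N -> wl y = (k + wl (p^-1 * y)%g)%N ->
  k%:R <= gprod o (V x) (V y).
Proof.
move=> xE yE; rewrite /gromov_product.
have := dtri (V p) (V x) (V y); rewrite (dsym (V x) (V p)) !(cayley_dist_vertex _ gen).
by rewrite invg1 !mul1g xE yE !natrD; lra.
Qed.

(** Only finitely many elements have length [k], so infinitely many of the [g n] share a prefix of
    length [k], which forces their mutual products to be at least [k]; then diagonalize over [k]. *)
Lemma subseq_to_infinity g :
  (forall k, exists N, forall n, (N <= n)%N -> (k <= wl (g n))%N) ->
  exists2 f : nat -> nat, (forall n, n <= f n)%N & to_infinity (V \o g \o f).
Proof.
move=> gi; have [|f [nf Ef]] := @diagonal (fun k m n => k%:R <= gprod o (V (g m)) (V (g n))).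
  move=> k A Ainf; have [s sP] := wlen_ball gen k.
  pose Q p n := wl (g n) = (k + wl (p^-1 * g n)%g)%N.
  have [|p pA] := @unbounded_pigeonhole _ s Q A Ainf.
    have [N HN] := gi k; exists N => n Nn An.
    have [p [pk pE]] := wlen_prefix (HN n Nn); exists p => //.
    by apply: sP; rewrite pk.
  exists (A `&` Q p); first by split=> // n [].
  by move=> m n [_ Qm] [_ Qn]; exact: common_prefix Qm Qn.
exists f => //; apply: asymptotic_at_base => M.
have [k Mk] : exists k : nat, M <= k%:R.
  by exists (Num.bound `|M|); apply/ltW/(le_lt_trans (ler_norm M)); exact: archi_boundP.
by exists k => i j ki kj; apply: (le_trans Mk); exact: Ef.
Qed.

Lemma mem_boundary_cvg (xi : boundary R S) u : sval xi u ->
  Inner (u n) @[n --> \oo] --> (Bd xi : compactification R S).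
Proof.
move=> xu U; rewrite nbhsE => -[W [Wo Wx] WU].
have [_ /(_ xi Wx)[r rW]] := Wo.
have ru : exists N : nat, forall i j : nat, (N <= i)%N -> (N <= j)%N ->
    r + 1 <= gprod o (u i) (u j).
  by move: xu; have [[v vv ->]|[_ ->]] := svalP xi; [move=> [uu _]|by []]; exact: uu.
have [N HN] := ru; exists N => // n /= Nn; apply/WU/rW.
exists u, (cst (u n)); split=> //; exists N => i j Ni Nj /=.
by apply: lt_le_trans (HN i n Ni Nn); rewrite ltrDl.
Qed.

Hypothesis infG : forall s : seq G, exists a, a \notin s.

Lemma ex_to_infinity : exists u, @to_infinity R G S u.
Proof.
have /choice[g gP] k : exists a, (k <= wl a)%N.
  have [s sP] := wlen_ball gen k; have [a as_] := infG s; exists a.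
  by rewrite leqNgt; apply: contra as_ => /ltnW /sP.
have [|f _ H] := @subseq_to_infinity g; last by exists (V \o g \o f).
by move=> k; exists k => n kn; apply: leq_trans (gP n).
Qed.

(** Members of a boundary point may run through interiors of edges; replacing each term by a vertex
    at distance at most 1 stays in the class. *)
Lemma boundary_seq (xi : boundary R S) : exists g : nat -> G, sval xi (V \o g).
Proof.
have [u xu] : exists u, sval xi u.
  have [[v vv ->]|[H _]] := svalP xi; first by exists v.
  by have [u /H] := ex_to_infinity.
have /choice[g gP] n : exists a, d (u n) (V a) <= 1 by exact: near_vertex.
by exists g; apply: near_mem_boundary xu.
Qed.

End Boundary.

(** * Hyperbolicity of the hat metric *)

Section ThinTriangles.
Variables (R : realType) (T : Type) (D : T -> T -> R) (C : R).
Hypothesis sym : forall x y, D x y = D y x.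
Hypothesis tri : forall y x z, D x z <= D x y + D y z.
Hypothesis rough : forall x y s, 0 <= s <= D x y -> exists z,
  `|D x z - s| <= C /\ `|D z y - (D x y - s)| <= C.
Local Notation gp := (gromov_product D).
Hypothesis thin : forall c, exists c', forall z x y w,
  gp z x y <= c -> gp z x w <= c' \/ gp z w y <= c'.

(** The hypothesis [thin] is the thin triangle condition: a small product of [x] and [y] at [z]
    means that [z] is close to a geodesic from [x] to [y]. The point [z] of the proof is where the
    inscribed circle of the triangle [o], [x], [w] touches the side from [x] to [w]; its distance to
    [o] is the product of [x] and [w] up to a constant. Being close to a geodesic from [x] to [y] or
    from [y] to [w], it bounds one of the two other products. *)
Lemma hyperbolic_of_thin : exists2 delta, 0 <= delta &
  forall o x y z, Num.min (gp o x y) (gp o y z) - delta <= gp o x z.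
Proof.
have [c2 thin2] := thin C.
exists (Num.max 0 (C + 3 * c2)); first by rewrite le_max lexx.
move=> o x y w.
have s01 : 0 <= gp x o w <= D x w.
  rewrite /gromov_product; have := tri x o w; have := tri o x w; have := tri w x o.
  by rewrite (sym w o) (sym o x); lra.
have [z [xz zy]] := rough s01.
have gz : gp z x w <= C.
  move: xz zy; rewrite /gromov_product !ler_norml (sym x z) => /andP[_ h1] /andP[_ h2].
  by lra.
have zo : D z o <= gp o x w + C + 2 * c2.
  move: xz zy; rewrite !ler_norml => /andP[h1 _] /andP[h2 _].
  have [] := thin2 z x w o gz; move: h1 h2;
    rewrite /gromov_product (sym x z) (sym x o) ?(sym z o) ?(sym w o); lra.
have h : Num.min (gp o x y) (gp o y w) <= c2 + D z o.
  rewrite ge_min (sym z o); have [h|h] := thin2 z x w y gz; apply/orP; [left|right];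
    by rewrite -lerBlDr; apply: le_trans h; rewrite (sym o z); exact: gromov_product_base.
have : C + 3 * c2 <= Num.max 0 (C + 3 * c2) by rewrite le_max lexx orbT.
lra.
Qed.

End ThinTriangles.

(** * Lengths and rough geodesics of the hat metric on the group *)

Section Hat.
Variables (R : realType) (G : groupType) (S : seq G) (H : hat_metric R S).
Hypothesis gen : generates S.
Local Notation X := (cayley R S).
Local Notation d := (@cayley_dist R G S).
Local Notation hd := (hat_dist H).
Local Notation V := (vertex R S).
Local Notation wl := (wlen gen).
Local Notation o := (V 1%g).
Local Notation len := (hat_length H).
Implicit Types (g h x y z : G).

Lemma cayley_act_vertex g x : cayley_act g (V x) = V (g * x)%g.
Proof. by apply: cayley_eq => /=; rewrite edge_point_mul. Qed.

Lemma hat_dist_vertex x y : hd (V x) (V y) = len (x^-1 * y)%g.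
Proof.
by rewrite /hat_length -(hat_dist_invariant H x^-1%g) !cayley_act_vertex mulVg.
Qed.

Let hdP := hat_distP H.
Lemma hat_dist_sym (x y : X) : hd x y = hd y x. Proof. by case: hdP. Qed.
Lemma hat_dist_triangle (y x z : X) : hd x z <= hd x y + hd y z. Proof. by case: hdP. Qed.
Lemma hat_dist_ge0 (x y : X) : 0 <= hd x y. Proof. by case: hdP. Qed.

Lemma len_ge0 g : 0 <= len g. Proof. exact: hat_dist_ge0. Qed.

Lemma len1 : len 1%g = 0. Proof. by rewrite /hat_length; have [_ /(_ o o)[_ ->]] := hdP. Qed.

Lemma lenV g : len g^-1%g = len g.
Proof. by rewrite -[g^-1%g]mulg1 -hat_dist_vertex hat_dist_sym. Qed.

Lemma lenM g h : len (g * h)%g <= len g + len h.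
Proof.
by rewrite {1}/hat_length -{2}(mulKg g h) -[len (_ * _)%g]hat_dist_vertex; exact: hat_dist_triangle.
Qed.

Lemma len_bounds : exists L C : R, [/\ 1 <= L, 0 <= C &
  forall g, L^-1 * (wl g)%:R - C <= len g /\ len g <= L * (wl g)%:R + C].
Proof.
have [L [C [L1 C0 LC]]] := hat_dist_quasi_isometric H; exists L, C; split=> // g.
by have := LC o (V g); rewrite (cayley_dist_vertex _ gen) invg1 mul1g.
Qed.

Lemma len_ball r : exists s : seq G, forall g, len g <= r -> g \in s.
Proof.
have [L [C [L1 C0 LC]]] := len_bounds.
have [s sP] := wlen_ball gen (Num.bound `|L * (r + C)|).
exists s => g gr; apply: sP; rewrite -(ler_nat R); have [h _] := LC g.
have L0 : 0 < L by lra.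
apply: le_trans (ltW (archi_boundP (normr_ge0 _))); apply: le_trans (ler_norm _).
by rewrite -ler_pdivrMl //; lra.
Qed.

Lemma hat_near_vertex : exists2 K : R, 0 <= K &
  forall x : X, exists g, d x (V g) <= 1 /\ hd x (V g) <= K.
Proof.
have [L [C [L1 C0 LC]]] := hat_dist_quasi_isometric H; exists (L + C); first lra.
move=> x; have [g xg] := near_vertex gen x; exists g; split=> //.
have [_ h] := LC x (V g); apply: (le_trans h); rewrite lerD2r.
by rewrite ler_piMr //; lra.
Qed.

Lemma len_rough : exists2 C : R, 0 <= C & forall g s, 0 <= s <= len g ->
  exists h, `|len h - s| <= C /\ `|len (h^-1 * g)%g - (len g - s)| <= C.
Proof.
have [K K0 KP] := hat_near_vertex.
have [C C0 CP] := hat_dist_roughly_geodesic H.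
exists (3 * C + K); first lra.
move=> g s /andP[s0 sg]; have [a [b [gam [ab ga gb gamP]]]] := CP o (V g).
have aa : a <= a <= b by rewrite lexx.
have bb : a <= b <= b by rewrite lexx ab.
(* The parameter interval may be shorter than [len g] by up to [C], so [a + s] may lie beyond
   [b]. *)
pose t := Num.min (a + s) b.
have tab : a <= t <= b by rewrite le_min ge_min lexx ab orbT lerDl s0.
have [h [_ hP]] := KP (gam t); exists h.
have [] := gamP a b aa bb; have [] := gamP a t aa tab; have [] := gamP t b tab bb.
rewrite ga gb -/(len g) (ler0_norm (_ : t - b <= 0)); last by case/andP: tab; lra.
rewrite (ler0_norm (_ : a - t <= 0)); last by case/andP: tab; lra.
rewrite (ler0_norm (_ : a - b <= 0)); last by lra.
rewrite -hat_dist_vertex => h1 h2 h3 h4 h5 h6.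
have := hat_dist_triangle (gam t) o (V h).
have := hat_dist_triangle (V h) o (gam t); rewrite (hat_dist_sym (V h) (gam t)).
have := hat_dist_triangle (gam t) (V h) (V g); rewrite (hat_dist_sym (V h) (gam t)).
have := hat_dist_triangle (V h) (gam t) (V g).
rewrite -!/(len _) !ler_norml => k1 k2 k3 k4.
move: h1 h2 h3 h4 h5 h6 k1 k2 k3 k4 hP sg; rewrite -/(len _).
have [|] : t = a + s \/ (t = b /\ b <= a + s).
  by rewrite /t; case: (leP (a + s) b) => h'; [left|right; split=> //; lra].
  move=> ->. lra.
move=> [-> bas]. lra.
Qed.

End Hat.

Lemma cvge_ge (R : realType) (u : nat -> \bar R) (l M : \bar R) N : u @ \oo --> l ->
  (forall n, (N <= n)%N -> (M <= u n)%E) -> (M <= l)%E.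
Proof.
move=> ul Mu; rewrite -(cvg_lim _ ul) //; apply: lime_ge; first by apply/cvg_ex; exists l.
by exists N => // n /= /Mu.
Qed.

Lemma cvge_le (R : realType) (u : nat -> \bar R) (l M : \bar R) N : u @ \oo --> l ->
  (forall n, (N <= n)%N -> (u n <= M)%E) -> (l <= M)%E.
Proof.
move=> ul Mu; rewrite -(cvg_lim _ ul) //; apply: lime_le; first by apply/cvg_ex; exists l.
by exists N => // n /= /Mu.
Qed.

Lemma cvge_eqy (R : realType) (u : nat -> \bar R) (l : \bar R) : u @ \oo --> l ->
  (forall n : nat, (n%:R%:E <= u n)%E) -> l = +oo%E.
Proof.
move=> ul nu; apply/eqP; rewrite -leye_eq leNgt; apply/negP => ly.
have [k lk] : exists k : nat, (l < k%:R%:E)%E.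
  move: ly; case: (l) => [r _||]; [|by []|by exists 0%N; rewrite ltNye].
  exists (Num.bound `|r|); rewrite lte_fin; apply: (le_lt_trans (ler_norm r)).
  exact: archi_boundP.
suff : (k%:R%:E <= l)%E by rewrite leNgt lk.
apply: (cvge_ge (N := k) ul) => n kn; apply: le_trans (nu n).
by rewrite lee_fin ler_nat.
Qed.

(** * Compactness and the extended product *)

Section HatBoundary.
Variables (R : realType) (G : groupType) (S : seq G) (H : hat_metric R S).
Hypothesis gen : generates S.
Local Notation X := (cayley R S).
Local Notation B := (boundary R S).
Local Notation d := (@cayley_dist R G S).
Local Notation hd := (hat_dist H).
Local Notation hg := (hat_gprod H).
Local Notation V := (vertex R S).
Local Notation o := (V 1%g).
Local Notation len := (hat_length H).
Local Notation D := (fun x y : G => len (x^-1 * y)%g).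
Implicit Types (g h x y z : G) (xi om : B).

Definition gp x y : R := gromov_product hd o (V x) (V y).

Lemma gpE x y : gp x y = (len x + len y - len (x^-1 * y)%g) / 2.
Proof. by rewrite /gp /gromov_product !hat_dist_vertex !invg1 !mul1g. Qed.

Lemma gp_gromov g x y : gromov_product D g x y = gp (g^-1 * x)%g (g^-1 * y)%g.
Proof. by rewrite gpE /gromov_product invgM invgK mulgA mulgK. Qed.

Lemma gpC x y : gp x y = gp y x.
Proof. by rewrite /gp gromov_productC //; exact: hat_dist_sym. Qed.

Lemma gp_ge0 x y : 0 <= gp x y.
Proof. by apply: gromov_product_ge0; [exact: hat_dist_sym|exact: hat_dist_triangle]. Qed.

Lemma gp_le x y : gp x y <= len x.
Proof. by apply: gromov_product_le; exact: hat_dist_triangle. Qed.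

Lemma gp_le_right x y : gp x y <= len y. Proof. by rewrite gpC gp_le. Qed.

Lemma hg_cvg (q : X) a b (u v : nat -> compactification R S) :
  u @ \oo --> a -> v @ \oo --> b -> hg q (u n) (v n) @[n --> \oo] --> hg q a b.
Proof.
move=> ua vb; have := @hat_gprod_continuous _ _ _ H q (a, b).
by move=> hc; exact: (cvg_comp _ _ (cvg_pair ua vb) hc).
Qed.

Lemma len_subseq (x : nat -> G) :
  (forall M : R, exists N, forall n, (N <= n)%N -> M <= len (x n)) ->
  exists2 f : nat -> nat, (forall n, n <= f n)%N & exists xi : B, sval xi (V \o x \o f).
Proof.
move=> xi; have [L [C [L1 C0 LC]]] := len_bounds H gen.
have [k|f nf ff] := @subseq_to_infinity R _ _ gen x.
  have [N HN] := xi (L * k%:R + C); exists N => n /HN; have [_ h] := LC (x n) => h'.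
  have := le_trans h' h; rewrite lerD2r ler_pM2l ?ler_nat //; lra.
exists f => //; exists (boundary_class ff).
by split.
Qed.

Lemma boundary_eq xi om u v : sval xi u -> sval om v ->
  (forall n : nat, n%:R <= gromov_product hd o (u n) (v n)) -> xi = om.
Proof.
move=> xu ov uv.
have := hg_cvg (q := o) (mem_boundary_cvg xu) (mem_boundary_cvg ov).
move/cvge_eqy => /(_ _)/(hat_gprod_eqy H _ _ _).1 [|eta [->] [->]] // n.
by rewrite hat_gprodE lee_fin.
Qed.

Lemma gp_large_boundary (x y : nat -> G) :
  (forall n : nat, n%:R <= gp (x n) (y n)) ->
  exists2 f : nat -> nat, (forall n, n <= f n)%N &
    exists xi : B, sval xi (V \o x \o f) /\ sval xi (V \o y \o f).
Proof.
move=> xy.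
have big (z : nat -> G) : (forall n : nat, n%:R <= len (z n)) ->
  forall M : R, exists N, forall n, (N <= n)%N -> M <= len (z n).
  move=> nz M; exists (Num.bound `|M|) => n Nn; apply: le_trans (nz n).
  apply: (le_trans (ler_norm M)); apply: (le_trans (ltW (archi_boundP (normr_ge0 M)))).
  by rewrite ler_nat.
have [f1 nf1 [xi xf]] := len_subseq (big x (fun n => le_trans (xy n) (gp_le _ _))).
have [n|f2 nf2 [om yf]] := len_subseq (big (y \o f1) _).
  by apply: le_trans (gp_le_right (x (f1 n)) _); apply: le_trans (xy _); rewrite ler_nat.
have nf n : (n <= f1 (f2 n))%N by exact: leq_trans (nf1 _).
exists (f1 \o f2) => //; exists xi; have xf' := sub_mem_boundary gen nf2 xf; split=> //.
rewrite (@boundary_eq xi om _ _ xf' yf) // => n; apply: le_trans (xy _).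
by rewrite ler_nat; exact: nf.
Qed.

Lemma hat_thin : forall c, exists c', forall z x y w,
  gromov_product D z x y <= c ->
  gromov_product D z x w <= c' \/ gromov_product D z w y <= c'.
Proof.
move=> c; apply: contrapT => /forallNP nthin.
(* By invariance the triples are translated so that [z] becomes 1, and a single extended product is
   enough. *)
have /choice[xyw xywP] (n : nat) : exists xyw : G * G * G, [/\ gp xyw.1.1 xyw.1.2 <= c,
    n%:R <= gp xyw.1.1 xyw.2 & n%:R <= gp xyw.1.2 xyw.2].
  move/(_ n%:R): nthin => /existsNP[z /existsNP[x /existsNP[y /existsNP[w /not_implyP[h]]]]].
  move=> /not_orP[/negP h1 /negP h2]; exists ((z^-1 * x)%g, (z^-1 * y)%g, (z^-1 * w)%g) => /=.
  move: h h1 h2; rewrite -!ltNge !gp_gromov => h h1 h2; split=> //; first exact: ltW.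
  by rewrite gpC ltW.
pose x n := (xyw n).1.1; pose y n := (xyw n).1.2; pose w n := (xyw n).2.
have xw n : n%:R <= gp (x n) (w n) by case: (xywP n).
have yw n : n%:R <= gp (y n) (w n) by case: (xywP n).
have [f1 nf1 [xi [xx xw']]] := gp_large_boundary xw.
have [n|f2 nf2 [om [xy xw'']]] := @gp_large_boundary (y \o f1) (w \o f1).
  by apply: le_trans (yw _); rewrite ler_nat.
have om_xi : om = xi.
  apply/esym/(@boundary_eq xi om (V \o x \o f1 \o f2) (V \o w \o f1 \o f2)) => //.
    exact: sub_mem_boundary xx.
  move=> n; apply: le_trans (xw _); rewrite ler_nat; exact: leq_trans (nf1 _).
move: xy; rewrite om_xi => xy.
have := hg_cvg (q := o) (mem_boundary_cvg (sub_mem_boundary gen nf2 xx)) (mem_boundary_cvg xy).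
rewrite (hat_gprod_eqy H _ _ _).2; last by exists xi.
move=> /(cvge_le (N := 0) (M := c%:E)) => h; have : (+oo <= c%:E)%E; last by [].
by apply: h => n _; rewrite hat_gprodE lee_fin; case: (xywP (f1 (f2 n))).
Qed.

Lemma hat_hyperbolic : exists2 delta, 0 <= delta &
  forall x y z, Num.min (gp x y) (gp y z) - delta <= gp x z.
Proof.
have [C C0 rough] := len_rough H gen.
have [x y|y x z|x y s|delta delta0 hyp] := @hyperbolic_of_thin R G D C _ _ _ hat_thin.
- by rewrite -lenV invgM invgK.
- by rewrite -[x^-1%g](mulgK y) -mulgA mulgK; exact: lenM.
- move=> /rough[h [h1 h2]]; exists (x * h)%g; rewrite mulKg.
  by rewrite invgM -mulgA.
by exists delta => // x y z; have := hyp 1%g x y z; rewrite !gp_gromov invg1 !mul1g.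
Qed.

(* Compactness takes the place of the Morse lemma: the extended product is infinite
   only on the diagonal of the boundary, and there the word product tends to infinity. *)
Lemma gp_large_word (r : R) : exists M : R, forall x y, M <= gp x y ->
  r <= gromov_product d o (V x) (V y).
Proof.
apply: contrapT => /forallNP nM.
have /choice[xy xyP] (n : nat) : exists xy : G * G, n%:R <= gp xy.1 xy.2 /\
    gromov_product d o (V xy.1) (V xy.2) < r.
  have /existsNP[x /existsNP[y /not_implyP[h /negP h1]]] := nM n%:R.
  by exists (x, y); rewrite ltNge.
have [f1 nf1 [xi [x1 y1]]] := gp_large_boundary (fun n => (xyP n).1).
have xx : to_infinity (V \o (fun n => (xy n).1) \o f1).
  by move: x1; have [[v vv ->]|[_ ->]] := svalP xi => // -[].
have om_xi : boundary_class xx = xi.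
  apply: (boundary_eq _ y1); first by split; exact: xx.
  by move=> n; apply: le_trans (xyP _).1; rewrite ler_nat.
move: y1; rewrite -om_xi => -[_ /(_ o r)[N /(_ N N (leqnn N) (leqnn N))]].
by apply/negP; rewrite -ltNge; exact: (xyP _).2.
Qed.
End HatBoundary.

(** * Gromov products with boundary points *)

Section BoundaryAction.
Variables (R : realType) (G : groupType) (S : seq G).
Local Notation B := (boundary R S).

Lemma boundary_ext (xi om : B) : sval xi = sval om -> xi = om.
Proof.
case: xi om => [A HA] [A' HA'] /= AA'; subst A'.
by congr exist; exact: Prop_irrelevance.
Qed.

Lemma boundary_actM (g h : G) (xi : B) :
  boundary_act (g * h)%g xi = boundary_act g (boundary_act h xi).
Proof.
apply: boundary_ext => /=; rewrite image_comp; congr image; apply/funext => u /=.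
by apply/funext => n; rewrite cayley_actM.
Qed.

Lemma boundary_act1 (xi : B) : boundary_act 1%g xi = xi.
Proof.
apply: boundary_ext => /=; rewrite -[RHS]image_id; congr image; apply/funext => u.
by apply/funext => n; rewrite cayley_act1.
Qed.

Lemma boundary_actK (g : G) : cancel (boundary_act g) (boundary_act g^-1%g : B -> B).
Proof. by move=> xi; rewrite -boundary_actM mulVg boundary_act1. Qed.

Lemma boundary_actVK (g : G) : cancel (boundary_act g^-1%g) (boundary_act g : B -> B).
Proof. by move=> xi; rewrite -boundary_actM mulgV boundary_act1. Qed.

End BoundaryAction.

Lemma cvge_gt (R : realType) (u : nat -> \bar R) (l t : \bar R) : u @ \oo --> l ->
  (t < l)%E -> exists N, forall n, (N <= n)%N -> (t < u n)%E.
Proof.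
move=> ul tl; have [N _ HN] := ul _ (open_nbhs_nbhs (conj (@open_ereal_gt_ereal R t) tl)).
by exists N => n Nn; exact: HN.
Qed.

Lemma threshold_cvg (R : realType) (delta : R) (u v w : nat -> \bar R) (a b c : \bar R) :
  u @ \oo --> a -> v @ \oo --> b -> w @ \oo --> c ->
  (forall n (t : R), t%:E <= u n -> t%:E <= v n -> (t - delta)%:E <= w n)%E ->
  forall t : R, (t%:E <= a -> t%:E <= b -> (t - delta)%:E <= c)%E.
Proof.
(* The sequences may reach the threshold [t] only in the limit, so the inequality is applied at
   [t - e]. *)
move=> ua vb wc uvw t ta tb; apply/lee_subgt0Pr => e e0.
have te : ((t - e)%:E < t%:E)%E by rewrite lte_fin; lra.
have [N1 H1] := cvge_gt ua (lt_le_trans te ta).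
have [N2 H2] := cvge_gt vb (lt_le_trans te tb).
apply: (cvge_ge (N := maxn N1 N2) wc) => n; rewrite geq_max => /andP[/H1/ltW h1 /H2/ltW h2].
by have := uvw n _ h1 h2; congr (_ <= _)%E; rewrite -EFinB; congr EFin; ring.
Qed.

Lemma cvge_uniq (R : realType) (u v : nat -> \bar R) (a b : \bar R) :
  u @ \oo --> a -> v @ \oo --> b -> u =1 v -> a = b.
Proof.
by move=> ua vb /funext uv; rewrite uv in ua; exact: (cvg_unique (@ereal_hausdorff R) ua vb).
Qed.

Lemma cvgr_uniq (R : realType) (u v : nat -> R) (a b : R) :
  u @ \oo --> a -> v @ \oo --> b -> u =1 v -> a = b.
Proof.
by move=> ua vb /funext uv; rewrite uv in ua; exact: (cvg_unique (@Rhausdorff R) ua vb).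
Qed.

Section HatBoundary.
Variables (R : realType) (G : groupType) (S : seq G) (H : hat_metric R S).
Hypothesis gen : generates S.
Hypothesis infG : forall s : seq G, exists a, a \notin s.
Local Notation X := (cayley R S).
Local Notation B := (boundary R S).
Local Notation hg := (hat_gprod H).
Local Notation V := (vertex R S).
Local Notation o := (V 1%g).
Local Notation len := (hat_length H).
Local Notation gp := (gp H).
Implicit Types (g h : G) (xi om : B).

Definition gpx g xi : R := fine (hg o (Inner (V g)) (Bd xi)).
Definition gpb xi om : \bar R := hg o (Bd xi) (Bd om).

Lemma gpxE g xi : hg o (Inner (V g)) (Bd xi) = (gpx g xi)%:E.
Proof.
rewrite /gpx fineK // ge0_fin_numE ?hat_gprod_ge0 // ltey.
by apply/eqP => /(hat_gprod_eqy H _ _ _).1[].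
Qed.

Lemma hg_vertexE x y : hg o (Inner (V x)) (Inner (V y)) = (gp x y)%:E.
Proof. by rewrite hat_gprodE. Qed.

Lemma gpb_ge0 xi om : (0 <= gpb xi om)%E. Proof. exact: hat_gprod_ge0. Qed.
Lemma gpx_ge0 g xi : 0 <= gpx g xi. Proof. by rewrite -lee_fin -gpxE hat_gprod_ge0. Qed.

Lemma gpb_eqy xi om : gpb xi om = +oo%E <-> xi = om.
Proof.
rewrite /gpb; split=> [/(hat_gprod_eqy H _ _ _).1[eta [->] [->]] //|->].
by apply/(hat_gprod_eqy H _ _ _); exists om.
Qed.

(** This covers constant sequences, with limit a vertex, as well as sequences tending to a boundary
    point, so that one limit argument serves for every combination of inner and boundary points. *)
Definition vertex_limit (a : compactification R S) (x : nat -> G) : Prop :=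
  Inner (V (x n)) @[n --> \oo] --> a.

Lemma vertex_limit_cst g : vertex_limit (Inner (V g)) (fun=> g).
Proof. exact: cvg_cst. Qed.

Lemma vertex_limit_mem xi x : sval xi (V \o x) -> vertex_limit (Bd xi) x.
Proof. exact: mem_boundary_cvg. Qed.

Lemma vertex_limit_ex xi : exists2 x, sval xi (V \o x) & vertex_limit (Bd xi) x.
Proof. by have [x xx] := boundary_seq gen infG xi; exists x => //; exact: vertex_limit_mem. Qed.

Lemma gp_cvg a b x y : vertex_limit a x -> vertex_limit b y ->
  (gp (x n) (y n))%:E @[n --> \oo] --> hg o a b.
Proof.
by move=> xa yb; under eq_fun do rewrite -hg_vertexE; exact: hg_cvg.
Qed.

Lemma gpx_cvg xi x g : vertex_limit (Bd xi) x -> gp g (x n) @[n --> \oo] --> gpx g xi.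
Proof.
move=> xx; apply: (fine_cvg (f := fun n => (gp g (x n))%:E)).
by rewrite -gpxE; apply: gp_cvg => //; exact: vertex_limit_cst.
Qed.

Lemma gpb_cvg xi om x y : vertex_limit (Bd xi) x -> vertex_limit (Bd om) y ->
  (gp (x n) (y n))%:E @[n --> \oo] --> gpb xi om.
Proof. exact: gp_cvg. Qed.

Lemma gpbC xi om : gpb xi om = gpb om xi.
Proof.
have [x _ xx] := vertex_limit_ex xi; have [y _ yo] := vertex_limit_ex om.
by apply: (cvge_uniq (gpb_cvg xx yo) (gpb_cvg yo xx)) => n; rewrite gpC.
Qed.

Lemma gpx_le g xi : gpx g xi <= len g.
Proof.
have [x _ xx] := vertex_limit_ex xi; rewrite -lee_fin -gpxE.
apply: (cvge_le (N := 0%N) (gp_cvg (@vertex_limit_cst g) xx)) => n _.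
by rewrite lee_fin gp_le.
Qed.

(* Thresholds avoid case distinctions on infinite values of the product. *)
Lemma boundary_hyperbolic : exists2 delta, 0 <= delta &
  [/\ forall x y z t, t <= gp x y -> t <= gp y z -> t - delta <= gp x z,
      forall x y xi t, t <= gp x y -> t <= gpx y xi -> t - delta <= gpx x xi,
      forall x y xi t, t <= gpx x xi -> t <= gpx y xi -> t - delta <= gp x y,
      forall x xi om t, t <= gpx x xi -> t <= gpx x om -> ((t - delta)%:E <= gpb xi om)%E &
      (forall x xi om t, t <= gpx x xi -> (t%:E <= gpb xi om)%E -> t - delta <= gpx x om) /\
      (forall xi om ze t, (t%:E <= gpb xi om)%E -> (t%:E <= gpb om ze)%E ->
         ((t - delta)%:E <= gpb xi ze)%E)].
Proof.
have [delta delta0 hyp] := hat_hyperbolic H gen; exists delta => //.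
have hypt x y z t : t <= gp x y -> t <= gp y z -> t - delta <= gp x z.
  by move=> xy yz; apply: le_trans (hyp x y z); rewrite lerD2r le_min xy.
have E a b c x y z : vertex_limit a x -> vertex_limit b y -> vertex_limit c z ->
    forall t : R, (t%:E <= hg o a b -> t%:E <= hg o b c -> (t - delta)%:E <= hg o a c)%E.
  move=> xa yb zc; apply: (threshold_cvg (gp_cvg xa yb) (gp_cvg yb zc) (gp_cvg xa zc)).
  by move=> n t; rewrite !lee_fin; exact: hypt.
have cst := @vertex_limit_cst; have sym : forall xi g, hg o (Bd xi) (Inner (V g)) = (gpx g xi)%:E.
  move=> xi g; rewrite -gpxE; have [x _ xx] := vertex_limit_ex xi.
  by apply: (cvge_uniq (gp_cvg xx (cst g)) (gp_cvg (cst g) xx)) => n; rewrite gpC.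
split=> //.
- move=> x y xi t xy yx; have [z _ zx] := vertex_limit_ex xi.
  by have := E _ _ _ _ _ _ (cst x) (cst y) zx t; rewrite hg_vertexE !gpxE !lee_fin; exact.
- move=> x y xi t xy yx; have [z _ zx] := vertex_limit_ex xi.
  have := E _ _ _ _ _ _ (cst x) zx (cst y) t.
  by rewrite hg_vertexE !gpxE sym !lee_fin; apply.
- move=> x xi om t h1 h2; have [y _ yx] := vertex_limit_ex xi.
  have [z _ zo] := vertex_limit_ex om.
  have := E _ _ _ _ _ _ yx (cst x) zo t.
  by rewrite !gpxE sym !lee_fin; apply.
split.
- move=> x xi om t h1 h2; have [y _ yx] := vertex_limit_ex xi.
  have [z _ zo] := vertex_limit_ex om.
  have := E _ _ _ _ _ _ (cst x) yx zo t.
  by rewrite !gpxE !lee_fin; exact.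
- move=> xi om ze t h1 h2; have [x _ xx] := vertex_limit_ex xi.
  have [y _ yo] := vertex_limit_ex om; have [z _ zz] := vertex_limit_ex ze.
  by have := E _ _ _ _ _ _ xx yo zz t; exact.
Qed.

Lemma mem_boundary_act g xi x : sval xi (V \o x) ->
  sval (boundary_act g xi) (V \o (fun n => g * x n)%g).
Proof.
move=> xx; exists (V \o x) => //=.
by apply/funext => n /=; rewrite cayley_act_vertex.
Qed.

Lemma gp_shift g x y : gp (g * x)%g (g * y)%g = gp x y - gp g^-1%g x - gp g^-1%g y + len g.
Proof. by rewrite !gpE !invgK lenV invgM -mulgA mulKg; lra. Qed.

Lemma gpx_act g x xi :
  gpx (g * x)%g (boundary_act g xi) = gpx x xi - gp g^-1%g x - gpx g^-1%g xi + len g.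
Proof.
have [y yx yl] := vertex_limit_ex xi.
have h1 := @gpx_cvg _ _ (g * x)%g (vertex_limit_mem (mem_boundary_act g yx)).
have h2 : gp x (y n) - gp g^-1%g x - gp g^-1%g (y n) + len g @[n --> \oo] -->
    gpx x xi - gp g^-1%g x - gpx g^-1%g xi + len g.
  by apply: cvgD; [apply: cvgB;
    [apply: cvgB; [exact: gpx_cvg|exact: cvg_cst]|exact: gpx_cvg]|exact: cvg_cst].
by apply: (cvgr_uniq h1 h2) => n; rewrite gp_shift.
Qed.

Lemma gpb_act g xi om : (gpb (boundary_act g xi) (boundary_act g om) =
  gpb xi om + (len g - gpx g^-1%g xi - gpx g^-1%g om)%:E)%E.
Proof.
have [x xx xl] := vertex_limit_ex xi; have [y yo yl] := vertex_limit_ex om.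
have h1 := gpb_cvg (vertex_limit_mem (mem_boundary_act g xx))
                   (vertex_limit_mem (mem_boundary_act g yo)).
have h2 : ((gp (x n) (y n))%:E + (len g - gp g^-1%g (x n) - gp g^-1%g (y n))%:E)%E
    @[n --> \oo] --> (gpb xi om + (len g - gpx g^-1%g xi - gpx g^-1%g om)%:E)%E.
  apply: cvgeD; [by rewrite fin_num_adde_defl|exact: gpb_cvg|].
  apply: cvg_EFin; first by apply: nearW.
  by apply: cvgB; [apply: cvgB; [exact: cvg_cst|exact: gpx_cvg]|exact: gpx_cvg].
apply: (cvge_uniq h1 h2) => n; rewrite gp_shift -EFinD; congr EFin; ring.
Qed.

(** The limit of [len x - len (g^-1 * x)] as [x] tends to [xi]: the Busemann function of [xi]
    vanishing at 1, with the sign that makes it increase towards [xi]. *)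
Definition busemann g xi : R := 2 * gpx g xi - len g.

Lemma busemannM g h xi : busemann (g * h)%g xi =
  busemann g xi + busemann h (boundary_act g^-1%g xi).
Proof.
rewrite /busemann -{1}(boundary_actVK g xi) gpx_act.
have := gpx_act g 1%g (boundary_act g^-1%g xi); rewrite mulg1 boundary_actVK.
have -> (ze : B) : gpx 1%g ze = 0.
  by apply/le_anti; rewrite gpx_ge0 -(len1 H) gpx_le.
move=> ->; rewrite !gpE invgK mulg1 lenV len1; lra.
Qed.

End HatBoundary.

(** * Finite orbits on the boundary *)

Lemma uncovered_uniq (T : eqType) (P : T -> Prop) :
  (forall s : seq T, exists2 x, P x & x \notin s) ->
  forall n, exists s : seq T, [/\ uniq s, size s = n & forall x, x \in s -> P x].
Proof.
move=> H; elim=> [|n [s [us <- sP]]]; first by exists [::].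
have [x Px xs] := H s; exists (x :: s); rewrite /= xs us; split=> // y.
by rewrite inE => /predU1P[->|/sP].
Qed.

Lemma seq_bound (R : realType) (T : eqType) (f : T -> R) (s : seq T) :
  exists2 M, 0 <= M & forall x, x \in s -> f x <= M.
Proof.
elim: s => [|a s [M M0 IH]]; first by exists 0.
exists (Num.max M (f a)); first by rewrite le_max M0.
by move=> x; rewrite inE le_max => /predU1P[->|/IH ->]; rewrite ?lexx ?orbT.
Qed.

Section NonElementary.
Variables (R : realType) (G : groupType) (S : seq G) (H : hat_metric R S).
Hypothesis gen : generates S.
Hypothesis infG : forall s : seq G, exists a, a \notin s.
Local Notation B := (boundary R S).
Local Notation V := (vertex R S).
Local Notation o := (V 1%g).
Local Notation len := (hat_length H).
Local Notation gp := (gp H).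
Local Notation gpx := (gpx H).
Local Notation gpb := (gpb H).
Local Notation bus := (busemann H).
Local Notation act := (@boundary_act R G S).
Implicit Types (g h k : G) (xi om : B).

Lemma gpx1 xi : gpx 1%g xi = 0.
Proof. by apply/le_anti; rewrite gpx_ge0 -(len1 H) gpx_le. Qed.

Lemma gpx_act_self g xi : gpx g (act g xi) = len g - gpx g^-1%g xi.
Proof. by rewrite -{1}(mulg1 g) gpx_act // gpx1 gpE mulg1 invgK lenV len1; lra. Qed.

Lemma busemann1 xi : bus 1%g xi = 0.
Proof. by rewrite /busemann gpx1 len1; lra. Qed.

Lemma busemann_ge g xi : - len g <= bus g xi.
Proof. by rewrite /busemann; have := gpx_ge0 H g xi; lra. Qed.

Lemma gpx_mulr_ge g h xi : gpx g xi - len h <= gpx (g * h)%g xi.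
Proof.
have := busemannM H gen infG g h xi; have := busemann_ge h (act g^-1%g xi).
rewrite {2 3}/busemann; have := lenM H (g * h)%g h^-1%g; rewrite mulgK lenV.
lra.
Qed.

Lemma gpx_unbounded xi M : exists x, M <= gpx x xi.
Proof.
have [x _ xx] := vertex_limit_ex gen infG xi.
have c : Bd xi @[_ --> \oo] --> (Bd xi : compactification R S) by exact: cvg_cst.
have h := hg_cvg (H := H) (q := o) xx c.
have [|N HN] := cvge_gt (t := M%:E) h.
  by rewrite (hat_gprod_eqy H _ _ _).2 ?ltry //; exists xi.
by exists (x N); rewrite -lee_fin -gpxE; apply/ltW/HN.
Qed.

(** Replaces the point at distance [s] on a geodesic ray from 1 to [xi]: a rough geodesic towards a
    [y] with [gpx y xi] large is cut at [s], and hyperbolicity passes from [y] to [xi]. *)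
Lemma ray_point : exists2 C : R, 0 <= C & forall xi s, 0 <= s ->
  exists g, `|len g - s| <= C /\ len g - C <= gpx g xi.
Proof.
have [delta d0 [_ hGX _ _ _]] := boundary_hyperbolic H gen infG.
have [C C0 rough] := len_rough H gen.
exists (2 * C + delta); first lra.
move=> xi s s0; have [y sy] := gpx_unbounded xi s.
have ly : 0 <= s <= len y by rewrite s0 (le_trans sy) // gpx_le.
have [h [h1 h2]] := rough y s ly; exists h.
have := hGX h y xi (s - C); rewrite gpE.
move: h1 h2; rewrite !ler_norml => /andP[h1 h1'] /andP[h2 h2'] => /(_ _ _) h3.
split; first by apply/andP; split; lra.
by have := h3 ltac:(lra) ltac:(lra); lra.
Qed.

Lemma length_rough_point : exists2 C : R, 0 <= C & forall x s, 0 <= s <= len x ->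
  exists h, `|len h - s| <= C /\ s - C <= gp h x.
Proof.
have [C C0 rough] := len_rough H gen; exists C => // x s sx.
have [h [h1 h2]] := rough x s sx; exists h; split=> //; rewrite gpE.
by move: h1 h2; rewrite !ler_norml => /andP[h1 h1'] /andP[h2 h2']; lra.
Qed.

Definition finite_orbit xi := exists T : seq G, forall g, exists2 t, t \in T & act g xi = act t xi.

Section FiniteOrbit.
Variables (xi : B) (T : seq G).
Hypothesis orb : forall g, exists2 t, t \in T & act g xi = act t xi.

Let stab g := act g xi = xi.

Let stabV g : stab g -> stab g^-1%g.
Proof. by move=> gs; rewrite /stab -{1}gs boundary_actK. Qed.

Let stabM g h : stab g -> stab h -> stab (g * h)%g.
Proof. by move=> gs hs; rewrite /stab boundary_actM hs gs. Qed.

Let bus_stab g h : stab g -> bus (g * h)%g xi = bus g xi + bus h xi.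
Proof. by move=> gs; rewrite busemannM // (stabV gs). Qed.

Let gpx_stab g : stab g -> gpx g xi = len g - gpx g^-1%g xi.
Proof. by move=> gs; rewrite -{1}gs gpx_act_self. Qed.

(** A ray point [g] is corrected to [g * t], where [t] in [T] satisfies [act g^-1 xi = act t xi];
    this fixes [xi] and moves the point by a bounded amount. *)
Let stab_ray : exists2 C : R, 0 <= C & forall s, 0 <= s ->
  exists k, [/\ stab k, `|len k - s| <= C & len k - C <= gpx k xi].
Proof.
have [C C0 ray] := ray_point; have [M M0 TM] := seq_bound len T.
exists (C + 2 * M); first lra.
move=> s s0; have [g [g1 g2]] := ray xi s s0; have [t tT gt] := orb g^-1%g.
have lt := TM t tT; exists (g * t)%g; split.
- by rewrite /stab boundary_actM -gt boundary_actVK.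
- have := lenM H g t; have := lenM H (g * t)%g t^-1%g; rewrite mulgK lenV.
  by move: g1; rewrite !ler_norml => /andP[? ?] ? ?; apply/andP; split; lra.
- by have := gpx_mulr_ge g t xi; have := lenM H g t; lra.
Qed.

(* Far out on a ray to [xi], an element [h] fixing [xi] moves points by little
   more than its translation [bus h xi] along the ray. *)
Let conj_bounded (C b : R) : 0 <= C -> exists C3 : R, forall h k, stab h -> stab k ->
  `|bus h xi| <= b -> len k - C <= gpx k xi -> len h + C3 <= len k ->
  len (k^-1 * h * k)%g <= C3.
Proof.
have [delta d0 [_ hGX hXG _ _]] := boundary_hyperbolic H gen infG => C0.
exists (b + 4 * C + 6 * delta + 1) => h k hs ks hb kC kbig.
have b0 : 0 <= b := le_trans (normr_ge0 _) hb.
have kV : gpx k^-1%g xi <= C by have := gpx_stab ks; lra.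
have hkV : gpx (k^-1 * h^-1)%g xi <= C + delta.
  have g1 : C + delta < gp k^-1%g (k^-1 * h^-1)%g.
    rewrite gpE invgK mulVKg !lenV.
    by have := lenM H (k^-1 * h^-1)%g h; rewrite mulgVK lenV; lra.
  rewrite leNgt; apply/negP => g2.
  pose t := Num.min (gp k^-1%g (k^-1 * h^-1)%g) (gpx (k^-1 * h^-1)%g xi).
  have t1 : C + delta < t by rewrite lt_min g1 g2.
  have := hGX k^-1%g (k^-1 * h^-1)%g xi t.
  by rewrite /t !ge_min !lexx orbT => /(_ erefl erefl); rewrite -/t; lra.
have hks : stab (h * k)%g by exact: stabM.
have hk : len (h * k)%g - C - delta <= gpx (h * k)%g xi.
  by have := gpx_stab hks; rewrite invgM; lra.
have hbus : bus (h * k)%g xi = bus h xi + bus k xi := bus_stab k hs.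
pose m := Num.min (len k) (len (h * k)%g) - C - delta.
have := hXG k (h * k)%g xi m; rewrite gpE mulgA.
have m1 : m <= gpx k xi.
  by apply: le_trans kC; rewrite /m -addrA lerD ?ge_min ?lexx //; lra.
have m2 : m <= gpx (h * k)%g xi.
  by apply: le_trans hk; rewrite /m !lerD2r ge_min lexx orbT.
move=> /(_ m1 m2); move: hbus hb; rewrite /busemann ler_norml => hbus /andP[hb1 hb2].
have := gpx_le H gen infG (h * k)%g xi; have := gpx_le H gen infG k xi.
by rewrite /m; case: (leP (len k) (len (h * k)%g)) => hh; lra.
Qed.

(** The bound [C3] does not depend on [k]. For any finite list of such elements, [k] can be taken
    far enough out for all of them, and conjugation by [k] injects the list into the ball of radius
    [C3]. *)
Let stab_bounded_finite (b : R) : exists s : seq G, forall h, stab h ->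
  `|bus h xi| <= b -> h \in s.
Proof.
have [C C0 ray] := stab_ray; have [C3 HC3] := conj_bounded b C0.
have [s0 s0P] := len_ball H gen C3.
apply: contrapT => /forallNP ns.
have [|s [us ss sP]] := @uncovered_uniq G (fun h => stab h /\ `|bus h xi| <= b) _ (size s0).+1.
  by move=> s; have /existsNP[h /not_implyP[hs /not_implyP[hb /negP h3]]] := ns s; exists h.
have [M M0 sM] := seq_bound len s.
have [k [ks k1 k2]] := ray _ (le_trans (normr_ge0 (M + C + C3)) (lexx _)).
have inj : injective (fun h => k^-1 * h * k)%g.
  by move=> x y /(can_inj (mulgK k))/(can_inj (mulKg k^-1%g)).
have : (size [seq (k^-1 * h * k)%g | h <- s] <= size s0)%N.
  apply: uniq_leq_size; first by rewrite map_inj_uniq.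
  move=> _ /mapP[h hs ->]; apply: s0P; have [h1 h2] := sP h hs.
  apply: HC3 => //; have := sM h hs; move: k1; rewrite ler_norml => /andP[k1 _].
  by have := ler_norm (M + C + C3); lra.
by rewrite size_map ss ltnn.
Qed.

Lemma virtually_cyclic_of_orbit_seq : virtually_cyclic G.
Proof.
have [C C0 ray] := stab_ray.
(* Then [len a >= 2 * C + 1], hence [bus a xi >= len a - 2 * C > 0]. The powers of [a] take equally
   spaced Busemann values, and division with remainder brings any stabilizing [k] to an element with
   value at most [bus a xi] in absolute value. *)
have [a [as_ a1 a2]] := ray (3 * C + 1) ltac:(lra).
have ba : 0 < bus a xi.
  by rewrite /busemann; move: a1; rewrite ler_norml => /andP[a1 _]; lra.
have [s sP] := stab_bounded_finite (bus a xi).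
have an n : stab (a ^+ n)%g /\ bus (a ^+ n)%g xi = n%:R * bus a xi.
  elim: n => [|n [IH1 IH2]]; first by rewrite expg0 /stab boundary_act1 busemann1 mul0r.
  by rewrite expgS; split; [exact: stabM|rewrite bus_stab // IH2 -nat1r mulrDl mul1r].
exists a, [seq (t * h)%g | t <- T, h <- s] => g.
have [t tT gt] := orb g; pose k := (t^-1 * g)%g.
have ks : stab k by rewrite /stab boundary_actM gt boundary_actK.
have trunc (x : R) : 0 <= x -> exists n : nat, `|x - n%:R * bus a xi| <= bus a xi.
  move=> x0; exists (Num.trunc (x / bus a xi)).
  have /andP[h1 h2] := Num.Theory.trunc_itv (divr_ge0 x0 (ltW ba)).
  move: h1 h2; rewrite ler_pdivlMr // ltr_pdivrMr // => h1; rewrite -natr1 mulrDl mul1r => h2.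
  by rewrite ger0_norm; lra.
have busV h : stab h -> bus h^-1%g xi = - bus h xi.
  by move=> hs; have := bus_stab h^-1%g hs; rewrite mulgV busemann1; lra.
have [k0|k0] := leP 0 (bus k xi).
  have [n nP] := trunc _ k0; have [s1 b1] := an n.
  exists (t * (k * (a ^+ n)^-1))%g, n; split; last by left; rewrite mulgA mulgVK mulVKg.
  apply/allpairsP; exists (t, (k * (a ^+ n)^-1)%g); split=> //=; apply: sP.
    by apply: stabM => //; exact: stabV.
  by rewrite bus_stab // busV // b1.
have [|n nP] := trunc (- bus k xi); first lra.
have [s1 b1] := an n.
exists (t * (k * (a ^+ n)))%g, n; split; last by right; rewrite mulgA mulgK mulVKg.
apply/allpairsP; exists (t, (k * (a ^+ n))%g); split=> //=; apply: sP.
  exact: stabM.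
by rewrite bus_stab // b1 -normrN opprD.
Qed.

End FiniteOrbit.

Lemma finite_orbit_virtually_cyclic xi : finite_orbit xi -> virtually_cyclic G.
Proof. by case=> T; exact: virtually_cyclic_of_orbit_seq. Qed.

End NonElementary.

(** * Separation of directions and nonempty shadows *)

Section NonElementary.
Variables (R : realType) (G : groupType) (S : seq G) (H : hat_metric R S).
Hypothesis gen : generates S.
Hypothesis nvc : ~ virtually_cyclic G.
Local Notation B := (boundary R S).
Local Notation V := (vertex R S).
Local Notation len := (hat_length H).
Local Notation gp := (gp H).
Local Notation gpx := (gpx H).
Local Notation gpb := (gpb H).
Local Notation act := (@boundary_act R G S).
Implicit Types (g h k : G) (xi om : B).

Lemma not_virtually_cyclic_infinite (s : seq G) : exists a, a \notin s.
Proof.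
apply: contrapT => /forallNP ns; apply: nvc; exists 1%g, s => g; exists g, 0%N.
split; last by left; rewrite expg0 mulg1.
by apply: contrapT => /negP; exact: ns.
Qed.
Let infG := not_virtually_cyclic_infinite.

(* Otherwise the limits of [x] and [y] agree after every translation of [y], and
   they form a point fixed by the whole group. *)
Lemma separating_translates : exists (F : seq G) (C : R), forall x y,
  exists2 a, a \in F & gp x (a * y)%g <= C.
Proof.
apply: contrapT => /forallNP nF.
have /choice[xy xyP] (n : nat) : exists xy : G * G,
    forall a, len a <= n%:R -> n%:R <= gp xy.1 (a * xy.2)%g.
  have [s sP] := len_ball H gen n%:R.
  move/(_ s): nF => /forallNP /(_ n%:R) /existsNP[x /existsNP[y nxy]].
  exists (x, y) => a /sP as_; rewrite leNgt; apply/negP => /ltW h; apply: nxy.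
  by exists a.
pose x n := (xy n).1; pose y n := (xy n).2.
have xy1 (n : nat) : n%:R <= gp (x n) (y n).
  by have := xyP n 1%g; rewrite mul1g; apply; rewrite len1.
have [f nf [xi [xx xY]]] := gp_large_boundary gen xy1.
apply: nvc; apply: (@finite_orbit_virtually_cyclic R _ _ H gen infG xi).
exists [:: 1%g] => a; exists 1%g; rewrite ?mem_head // boundary_act1.
pose N := Num.bound (len a); pose e n := (n + N)%N.
have ne n : (n <= e n)%N by exact: leq_addr.
apply/esym/(boundary_eq (H := H) (sub_mem_boundary gen ne xx)
  (sub_mem_boundary gen ne (mem_boundary_act a xY))) => n.
apply: (le_trans _ (xyP (f (e n)) a _)).
  by rewrite ler_nat; apply: leq_trans (nf _).
apply: (le_trans (ltW (archi_boundP (len_ge0 H a)))); rewrite ler_nat.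
by apply: leq_trans (nf _); rewrite /e leq_addl.
Qed.

Lemma boundary_infinite n : exists s : seq B, uniq s /\ size s = n.
Proof.
have xi : B by exact: point.
pose P om := exists g, om = act g xi.
have [s|s [us <- _]] := @uncovered_uniq _ P _ n; last by exists s.
apply: contrapT => ns; apply: nvc.
apply: (@finite_orbit_virtually_cyclic R _ _ H gen infG xi).
have orb g : act g xi \in s.
  by apply/negPn/negP => gs; apply: ns; exists (act g xi) => //; exists g.
have /choice[t tP] (om : B) : exists t, (exists g, act g xi = om) -> act t xi = om.
  have [[g gom]|nom] := pselect (exists g, act g xi = om); first by exists g.
  by exists 1%g => /nom.
exists (map t s) => g; exists (t (act g xi)); first by rewrite map_f.
by apply/esym/tP; exists g.
Qed.

Lemma gpb_neq_fin xi om : xi != om -> exists2 M : R, 0 <= M & gpb xi om = M%:E.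
Proof.
move=> xo; have := gpb_ge0 H xi om; case E : (gpb xi om) => [M||] //; first by exists M.
by move/gpb_eqy: E xo => ->; rewrite eqxx.
Qed.

(** Two distinct boundary points cannot both lie deep in the direction of [g^-1]. The one that does
    not is carried by [g] into the direction of [g], by [gpx_act_self]. *)
Lemma shadow_nonempty : exists2 C : R, 0 <= C & forall g, exists xi, len g - C <= gpx g xi.
Proof.
have [delta d0 [_ _ _ hXB _]] := boundary_hyperbolic H gen infG.
have [s [us ss]] := boundary_infinite 2.
case: s us ss => [|xi [|om []]] // /andP[xo _] _; rewrite inE in xo.
have [M M0 MP] := gpb_neq_fin xo; exists (M + delta); first lra.
move=> g; pose t := Num.min (gpx g^-1%g xi) (gpx g^-1%g om).
have tM : t <= M + delta.
  have t1 : t <= gpx g^-1%g xi by rewrite ge_min lexx.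
  have t2 : t <= gpx g^-1%g om by rewrite ge_min lexx orbT.
  by have := hXB g^-1%g xi om t t1 t2; rewrite MP lee_fin; lra.
have [h|h] := leP (gpx g^-1%g xi) (gpx g^-1%g om); [exists (act g xi)|exists (act g om)];
  rewrite gpx_act_self // lerD2l lerN2; move: tM; rewrite /t.
  by rewrite min_l.
by rewrite min_r // ltW.
Qed.

End NonElementary.

(** * Orbit growth *)

Lemma limn_esup_le (R : realType) (u : nat -> R) (s : R) N :
  (forall n, (N <= n)%N -> u n <= s) -> (limn_esup (EFin \o u) <= s%:E)%E.
Proof.
move=> us; apply: (@le_trans _ _ (ereal_sup [set (EFin \o u) n | n in [set n | (N <= n)%N]])).
  by apply: ereal_inf_lbound; exists [set n | (N <= n)%N] => //; exists N.
by apply: ge_ereal_sup => _ [n /= Nn <-]; rewrite lee_fin us.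
Qed.

Lemma limn_esup_ge (R : realType) (u : nat -> R) (s : R) :
  (forall n, s <= u n) -> (s%:E <= limn_esup (EFin \o u))%E.
Proof.
move=> us; apply: le_ereal_inf_tmp => _ [A [N _ NA] <-].
apply: (@le_trans _ _ (u N)%:E); first by rewrite lee_fin us.
by apply: ereal_sup_ubound; exists N => //; apply: NA => /=.
Qed.

Lemma limn_esup_lt (R : realType) (u : nat -> R) (s : R) :
  (limn_esup (EFin \o u) < s%:E)%E -> exists N, forall n, (N <= n)%N -> u n <= s.
Proof.
move=> /ereal_inf_lt[_ [A [N _ NA] <-] As]; exists N => n Nn.
rewrite -lee_fin; apply: (le_trans _ (ltW As)).
by apply: ereal_sup_ubound; exists n => //; apply: NA.
Qed.

(** * Growth rates of sequences that are submultiplicative up to a shift *)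

Section GrowthRate.
Variables (R : realType) (b : nat -> R) (k : nat).
Hypothesis b1 : forall n, 1 <= b n.
Hypothesis bmono : forall m n, (m <= n)%N -> b m <= b n.
Hypothesis bsub : forall m n, b (m + n + k) <= b (m + k) * b (n + k).

Let u n := n%:R^-1 * ln (b n).
Let e := fine (limn_esup (fun n => (u n)%:E)).
Let v n := b (n + k).

Let b0 n : 0 < b n := lt_le_trans ltr01 (b1 n).

Let vX n q : v (q.+1 * n) <= v n ^+ q.+1.
Proof.
elim: q => [|q IH]; first by rewrite mul1n expr1.
rewrite mulSn exprS; apply: le_trans (bsub _ _) _.
by rewrite (ler_pM2l (b0 _)).
Qed.

Let le_bv n : b n <= v n. Proof. by apply: bmono; rewrite leq_addr. Qed.

Let u_ge0 n : 0 <= u n.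
Proof. by rewrite mulr_ge0 ?invr_ge0 ?ler0n // ln_ge0. Qed.

(** Since [n] is below the multiple [(n %/ n0).+1 * n0] of [n0], repeated submultiplicativity bounds
    [b n] by a power of [v n0]; the leading factor absorbs the remainder. *)
Let b_expR n0 : (0 < n0)%N -> forall n, b n <= v n0 * expR (ln (v n0) / n0%:R * n%:R).
Proof.
move=> n0_gt0 n; set l := ln (v n0).
have l0 : 0 <= l by rewrite ln_ge0 // b1.
have vE : v n0 = expR l by rewrite /l lnK // posrE b0.
have n0R : 0 < n0%:R :> R by rewrite ltr0n.
apply: (@le_trans _ _ (v ((n %/ n0).+1 * n0))).
  apply: le_trans (le_bv n) _; apply: bmono; rewrite leq_add2r.
  by apply/ltnW; rewrite ltn_ceil.
apply: (le_trans (vX _ _)); rewrite exprS (ler_pM2l (b0 _)) vE -expRM_natl ler_expR.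
rewrite [leLHS]mulrC -mulrA ler_wpM2l // mulrC ler_pdivlMr // -natrM ler_nat.
exact: leq_trunc_div.
Qed.

Lemma growth_rate_fin : 0 <= e /\ limn_esup (fun n => (u n)%:E) = e%:E.
Proof.
have h0 : (0%:E <= limn_esup (fun n => (u n)%:E))%E := limn_esup_ge u_ge0.
have h1 : (limn_esup (fun n => (u n)%:E) <= (ln (v 1) + ln (v 1))%:E)%E.
  apply: (limn_esup_le (N := 1%N)) => n n1.
  have n0R : 0 < n%:R :> R by rewrite ltr0n.
  rewrite /u ler_pdivrMl //.
  have := b_expR (ltnSn 0) n; rewrite divr1 -ler_ln ?posrE ?b0 ?mulr_gt0 ?expR_gt0 ?b0 //.
  rewrite lnM ?posrE ?expR_gt0 ?b0 // expRK => /le_trans; apply.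
  rewrite mulrDr lerD //; last by rewrite mulrC.
  by rewrite ler_peMl ?ler1n // ln_ge0 // b1.
have fin : limn_esup (fun n => (u n)%:E) \is a fin_num.
  by rewrite ge0_fin_numE //; apply: le_lt_trans h1 _; rewrite ltry.
by split; [exact: fine_ge0|rewrite fineK].
Qed.

Lemma growth_rate_upper s : e < s -> exists2 K, 0 < K & forall n, b n <= K * expR (s * n%:R).
Proof.
move=> es; have [e0 eE] := growth_rate_fin.
have [|N HN] := @limn_esup_lt R u s; first by rewrite eE lte_fin.
exists (b N) => // n; have [nN|Nn] := leqP n N.
  apply: (le_trans (bmono nN)); rewrite ler_peMr ?(ltW (b0 _)) //.
  by rewrite -expR0 ler_expR mulr_ge0 ?ler0n // (le_trans e0) // ltW.
apply: (@le_trans _ _ (expR (s * n%:R))); last by rewrite ler_peMl // ?expR_ge0.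
rewrite -[leLHS]lnK ?posrE // ler_expR mulrC -ler_pdivrMl ?ltr0n ?(leq_ltn_trans _ Nn) //.
exact/HN/ltnW.
Qed.

(** As in Fekete's lemma: a single [n] with [b (n + k)] below [expR (e * n)] would, through
    [b_expR], force the limsup strictly below [e]. *)
Lemma growth_rate_lower n : expR (e * n%:R) <= b (n + k).
Proof.
have [e0 eE] := growth_rate_fin.
case: n => [|n0]; first by rewrite mulr0 expR0.
set n := n0.+1; have n0R : 0 < n%:R :> R by rewrite ltr0n.
rewrite leNgt; apply/negP => vn.
set l := ln (v n); have l0 : 0 <= l by rewrite ln_ge0 // b1.
have le' : l / n%:R < e.
  by rewrite ltr_pdivrMr // /l -ltr_expR lnK ?posrE ?b0 //; exact: vn.
pose s := (l / n%:R + e) / 2.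
have [h1 h2] : l / n%:R < s /\ s < e by rewrite /s; split; lra.
suff : (e%:E <= s%:E)%E by rewrite lee_fin leNgt h2.
rewrite -eE; pose N := Num.bound (l / (s - l / n%:R)).
apply: (limn_esup_le (N := N.+1)) => m Nm.
have m0R : 0 < m%:R :> R by rewrite ltr0n; exact: leq_ltn_trans Nm.
have sl : 0 < s - l / n%:R by rewrite subr_gt0.
rewrite /u ler_pdivrMl //.
have := b_expR (ltn0Sn n0) m; rewrite -ler_ln ?posrE ?b0 ?mulr_gt0 ?expR_gt0 ?b0 //.
rewrite lnM ?posrE ?expR_gt0 ?b0 // expRK -/n -/l => /le_trans; apply.
rewrite -lerBrDr (mulrC m%:R) -mulrBl -ler_pdivrMl // mulrC.
apply: (le_trans (ltW (archi_boundP _))); first by rewrite divr_ge0 // ltW.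
by rewrite ler_nat ltnW.
Qed.

End GrowthRate.

Lemma archi_bound_ex (R : realType) (x : R) : exists k : nat, x <= k%:R.
Proof.
by exists (Num.bound `|x|); apply: (le_trans (ler_norm x)); apply/ltW/archi_boundP.
Qed.

Lemma archi_ceil_ex (R : realType) (x : R) : 0 <= x -> exists k : nat, k%:R - 1 < x <= k%:R.
Proof.
move=> x0; have [m xm] := archi_bound_ex x.
elim: m xm => [|m IH] xm; first by exists 0%N; rewrite xm; lra.
have [/IH //|mx] := leP x m%:R.
by exists m.+1; rewrite xm andbT -natr1; lra.
Qed.

(** * Counting elements of balls and annuli *)

Section Counting.
Variables (R : realType) (G : groupType) (S : seq G) (H : hat_metric R S).
Hypothesis gen : generates S.
Local Notation len := (hat_length H).
Implicit Types (g h : G) (r : R).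

Definition ball_seq r : seq G := fset_set [set g | len g <= r].
Definition annulus (n : nat) : seq G := [seq g <- ball_seq n%:R | n%:R - 1 < len g].
(** The subtraction is truncated: for [n < c] the window starts at 0 and still has [c + c] annuli,
    which is why [size_window] allows indices up to [n + (c + c)]. *)
Definition window (n c : nat) : seq G := flatten [seq annulus k | k <- iota (n - c) (c + c)].

Lemma mem_ball_seq r g : (g \in ball_seq r) = (len g <= r).
Proof.
have fin : finite_set [set g | len g <= r].
  have [s sP] := len_ball H gen r.
  by apply: (sub_finite_set _ (finite_seq s)) => h /= /sP.
by rewrite /ball_seq in_fset_set //; apply/idP/idP; rewrite inE.
Qed.

Lemma uniq_ball_seq r : uniq (ball_seq r). Proof. exact: fset_uniq. Qed.

Lemma mem_annulus n g : (g \in annulus n) = (n%:R - 1 < len g <= n%:R).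
Proof. by rewrite mem_filter mem_ball_seq. Qed.

Lemma mem_window n c g : `|len g - n%:R| + 1 < c%:R -> g \in window n c.
Proof.
have [k kg] := archi_ceil_ex (len_ge0 H g); rewrite -ltrBrDr ltr_norml => /andP[h1 h2].
apply/flatten_mapP; exists k; last by rewrite mem_annulus.
have h3 : (n < k + c)%N by rewrite -(ltr_nat R) natrD; move/andP: kg => [? ?]; lra.
have h4 : (k < n + c)%N by rewrite -(ltr_nat R) natrD; move/andP: kg => [? ?]; lra.
by rewrite mem_iota; lia.
Qed.

Lemma size_window n c (K : R) : (forall k, (k < n + (c + c))%N -> (size (annulus k))%:R <= K) ->
  (size (window n c))%:R <= (c + c)%:R * K.
Proof.
move=> aK; have : forall k, k \in iota (n - c) (c + c) -> (size (annulus k))%:R <= K.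
  by move=> k; rewrite mem_iota => kn; apply: aK; lia.
rewrite /window -{3}(size_iota (n - c) (c + c)); elim: (iota _ _) => [|k s IH] sK.
  by rewrite /= mul0r.
rewrite /= size_cat natrD -[(size s).+1]addn1 natrD mulrDl mul1r addrC lerD //.
  by apply: IH => j js; apply: sK; rewrite inE js orbT.
by apply: sK; rewrite mem_head.
Qed.

Lemma size_ball_seqS n :
  (size (ball_seq n.+1%:R) <= size (ball_seq n%:R) + size (annulus n.+1))%N.
Proof.
rewrite -size_cat; apply: uniq_leq_size (uniq_ball_seq _) _ => g.
rewrite mem_cat !mem_ball_seq mem_annulus -natr1 => ->; rewrite andbT.
by case: leP => //= h; lra.
Qed.

Lemma size_ball_seq_le r r' : r <= r' -> (size (ball_seq r) <= size (ball_seq r'))%N.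
Proof.
move=> rr'; apply: uniq_leq_size (uniq_ball_seq _) _ => g.
by rewrite !mem_ball_seq => /le_trans; apply.
Qed.

Lemma size_ball_seq_gt0 r : 0 <= r -> (0 < size (ball_seq r))%N.
Proof.
move=> r0; have : 1%g \in ball_seq r by rewrite mem_ball_seq len1.
by case: (ball_seq r).
Qed.

Lemma ball_submultiplicative : exists k : nat, forall m n,
  (size (ball_seq (m + n + k)%:R) <= size (ball_seq (m + k)%:R) * size (ball_seq (n + k)%:R))%N.
Proof.
have [C C0 rough] := len_rough H gen.
have [k Ck] := archi_bound_ex (2 * C); exists k => m n.
have /choice[h hP] (g : G) : exists h, g \in ball_seq (m + n + k)%:R ->
    h \in ball_seq (m + k)%:R /\ (h^-1 * g)%g \in ball_seq (n + k)%:R.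
  (* Cutting here gives [len h <= m + k], while the second piece has length at most
     [n + 2 * C <= n + k]. The pair of pieces determines [g]. *)
  pose s := Num.min (len g) (m%:R + k%:R - C).
  have m0 := ler0n R m; have lg := len_ge0 H g.
  have s01 : 0 <= s <= len g by rewrite ge_min lexx le_min lg andbT /=; lra.
  have [h [h1 h2]] := rough g s s01; exists h; rewrite !mem_ball_seq !natrD => gk.
  move: h1 h2; rewrite !ler_norml /s => /andP[_ h1] /andP[_ h2].
  have n0 := ler0n R n.
  by move: h1 h2; case: (leP (len g)) => ? ? ?; split; lra.
rewrite -(size_allpairs pair) -(size_map (fun g => (h g, (h g)^-1 * g)%g)).
apply: uniq_leq_size.
  rewrite map_inj_uniq ?uniq_ball_seq // => x y [hxy].
  by rewrite hxy => /mulgI.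
move=> _ /mapP[g /hP[h1 h2] ->].
by apply/allpairsP; exists (h g, (h g)^-1 * g)%g.
Qed.

Local Notation e := (growth_exponent H).
Let b n : R := (size (ball_seq n%:R))%:R.

Let b1 n : 1 <= b n.
Proof. by rewrite /b ler1n size_ball_seq_gt0. Qed.

Let bmono m n : (m <= n)%N -> b m <= b n.
Proof. by move=> mn; rewrite ler_nat size_ball_seq_le // ler_nat. Qed.

Lemma growth_exponent_facts : exists k : nat, [/\ 0 <= e,
  forall s, e < s -> exists2 K, 0 < K & forall n, b n <= K * expR (s * n%:R) &
  forall n, expR (e * n%:R) <= b (n + k)].
Proof.
have [k kP] := ball_submultiplicative; exists k.
have bsub m n : b (m + n + k) <= b (m + k) * b (n + k) by rewrite -natrM ler_nat.
split.
- by have [] := growth_rate_fin b1 bmono bsub.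
- exact: (growth_rate_upper b1 bmono bsub).
- exact: (growth_rate_lower b1 bmono bsub).
Qed.

Hypothesis nvc : ~ virtually_cyclic G.

(** For [g], [h] in the annulus, a separating [a] makes [g * a * h] have length about [2 * n] with
    [g] near a rough geodesic to it. The product therefore determines [g] up to a ball of fixed
    radius [W], and [g] and [a] then determine [h]. The map [psi] records these data, with [g0] a
    reference first factor for each product. *)
Lemma annulus_pairs : exists (c M : nat), forall n,
  (size (annulus n) * size (annulus n) <= size (window (n + n) c) * M)%N.
Proof.
have [delta d0 [hG _ _ _ _]] := boundary_hyperbolic H gen (not_virtually_cyclic_infinite nvc).
have [F [C FC]] := separating_translates H gen nvc.
have [A A0 FA] := seq_bound len F.
have C0 : 0 <= C.
  by have [a _] := FC 1%g 1%g; apply: le_trans; exact: gp_ge0.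
have [c cP] := archi_bound_ex (2 * C + A + 4).
pose W := 2 * (1 + A + C + delta).
exists c, (size (ball_seq W) * size F)%N => n.
have /choice[al alP] (gh : G * G) : exists a, a \in F /\ gp H gh.1^-1%g (a * gh.2)%g <= C.
  by have [a aF aC] := FC gh.1^-1%g gh.2; exists a.
pose phi gh := (gh.1 * (al gh * gh.2))%g.
have phi_len gh : gh.1 \in annulus n -> gh.2 \in annulus n ->
    [/\ phi gh \in window (n + n) c & n%:R - 1 - A - C <= gp H gh.1 (phi gh)].
  rewrite !mem_annulus => /andP[g1 g2] /andP[h1 h2]; have [aF] := alP gh.
  rewrite gpE invgK lenV /phi -/(phi gh) => aC; have aA := FA _ aF.
  have l1 := lenM H (al gh) gh.2.
  have l2 := lenM H (al gh)^-1%g (al gh * gh.2)%g; rewrite mulKg lenV in l2.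
  have l3 := lenM H gh.1 (al gh * gh.2)%g; rewrite -/(phi gh) in l3 aC.
  split; last by rewrite gpE mulKg; lra.
  by apply: mem_window; rewrite natrD -ltrBrDr ltr_norml; apply/andP; split; lra.
pose L := [seq (g, h) | g <- annulus n, h <- annulus n].
have /choice[g0 g0P] (k : G) : exists g0, (exists2 gh, gh \in L & phi gh = k) ->
    exists2 gh, gh \in L & phi gh = k /\ gh.1 = g0.
  have [[gh ghL ghk]|ng] := pselect (exists2 gh, gh \in L & phi gh = k).
    by exists gh.1 => _; exists gh.
  by exists 1%g => /ng.
pose psi gh := (phi gh, ((g0 (phi gh))^-1 * gh.1)%g, al gh).
have uL : uniq L.
  by apply: allpairs_uniq; rewrite ?filter_uniq ?uniq_ball_seq // => -[? ?] [? ?] _ _ [-> ->].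
have psi_inj : injective psi.
  move=> [g h] [g' h'] [pp]; rewrite /= pp => /mulgI gg' aa; move: pp.
  by rewrite /phi /= aa gg' => /mulgI /mulgI ->.
rewrite -(size_allpairs pair (annulus n) (annulus n)) -/L -(size_map psi) mulnA.
rewrite -(size_allpairs pair (window _ _)) -(size_allpairs pair _ F).
apply: uniq_leq_size; first by rewrite map_inj_uniq.
move=> _ /mapP[gh ghL ->].
have memL (gh' : G * G) : gh' \in L -> gh'.1 \in annulus n /\ gh'.2 \in annulus n.
  by move=> /allpairsP[[x y] /= [? ? ->]].
have [g1 h1] := memL _ ghL; have [ph pp] := phi_len _ g1 h1.
have [gh' gh'L [phi' g0E]] := g0P (phi gh) (ex_intro2 _ _ gh ghL erefl).
have [g1' h1'] := memL _ gh'L; have [_ pp'] := phi_len _ g1' h1'.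
apply/allpairsP; exists ((phi gh, (g0 (phi gh))^-1 * gh.1)%g, al gh); split=> //=;
  last by case: (alP gh).
apply/allpairsP; exists (phi gh, (g0 (phi gh))^-1 * gh.1)%g; split=> //=.
rewrite mem_ball_seq -g0E.
rewrite phi' in pp'; rewrite gpC in pp.
have := hG _ _ _ _ pp' pp; rewrite gpE.
by move: g1 g1'; rewrite !mem_annulus => /andP[_ g1] /andP[_ g1']; rewrite /W; lra.
Qed.

End Counting.

(** * Purely exponential growth *)

Section Growth.
Variables (R : realType) (G : groupType) (S : seq G) (H : hat_metric R S).
Hypothesis gen : generates S.
Hypothesis nvc : ~ virtually_cyclic G.
Let infG := not_virtually_cyclic_infinite nvc.
Local Notation len := (hat_length H).
Local Notation e := (growth_exponent H).
Local Notation a n := ((size (annulus H n))%:R : R).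
Local Notation b r := ((size (ball_seq H r))%:R : R).

Lemma annulus_le_ball n : a n <= b n%:R.
Proof. by rewrite ler_nat size_filter count_size. Qed.

(* With Q the supremum of a(n) exp(-sn), squaring gives Q^2 <= K exp(sc) Q, a bound
   on Q that is uniform in s > e. *)
Lemma annulus_upper : exists2 K : R, 0 < K & forall n, a n <= K * expR (e * n%:R).
Proof.
have [k [e0 up _]] := growth_exponent_facts H gen.
have [c [M pairs]] := annulus_pairs H gen nvc.
pose K : R := (c + c)%:R * M%:R + 1.
have K0 : 0 < K by rewrite /K ltr_wpDl // mulr_ge0 ?ler0n.
have main s n : e < s -> a n <= K * expR (s * (n + (c + c))%:R).
  move=> es; have s0 : 0 < s := le_lt_trans e0 es.
  have [K1 K1_gt0 bK1] := up s es.
  pose A := [set a m * expR (- (s * m%:R)) | m in [set: nat]].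
  have Aub : has_ubound A.
    exists K1 => _ [m _ <-]; rewrite expRN ler_pdivrMr ?expR_gt0 //.
    exact: le_trans (annulus_le_ball m) (bK1 m).
  have A0 : A !=set0 by exists (a 0 * expR (- (s * 0%:R))), 0%N.
  pose Q := sup A.
  have aQ m : a m <= Q * expR (s * m%:R).
    rewrite -ler_pdivrMr ?expR_gt0 // -expRN; apply: ub_le_sup => //; by exists m.
  have Q0 : 0 <= Q.
    apply: le_trans (_ : a 0 * expR (- (s * 0%:R)) <= Q).
      by rewrite mulr_ge0 ?expR_ge0.
    by apply: ub_le_sup => //; exists 0%N.
  suff QK : Q <= K * expR (s * (c + c)%:R).
    apply: le_trans (aQ n) _; rewrite natrD mulrDr (addrC (s * n%:R)) expRD mulrA.
    by rewrite ler_wpM2r ?expR_ge0.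
  have sq m : (a m * expR (- (s * m%:R))) ^+ 2 <= K * expR (s * (c + c)%:R) * Q.
    have h1 : a m * a m <= (c + c)%:R * (Q * expR (s * (m + m + (c + c))%:R)) * M%:R.
      rewrite -natrM; apply: (le_trans (y := (size (window H (m + m) c) * M)%:R)).
        by rewrite ler_nat.
      rewrite natrM ler_wpM2r ?ler0n //; apply: size_window => j jm.
      apply: le_trans (aQ j) _; rewrite ler_wpM2l // ler_expR ler_wpM2l ?(ltW s0) //.
      by rewrite ler_nat ltnW.
    rewrite expr2 mulrACA -expRD.
rewrite -opprD expRN ler_pdivrMr ?expR_gt0 //; apply: le_trans h1 _.
    rewrite !natrD (_ : s * (m%:R + m%:R + (c%:R + c%:R))
      = s * (c%:R + c%:R) + (s * m%:R + s * m%:R));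
      last by ring.
    rewrite expRD /K -natrD.
    set E1 := expR _; set E2 := expR _; have E10 : 0 <= E1 := expR_ge0 _.
    have E20 : 0 <= E2 := expR_ge0 _.
    rewrite (_ : _ * (Q * _) * _ = (c + c)%:R * M%:R * E1 * Q * E2); last by ring.
    rewrite ler_wpM2r // ler_wpM2r // ler_wpM2r //; lra.
  have Q2 : Q ^+ 2 <= K * expR (s * (c + c)%:R) * Q.
    set Z := K * _ * Q; have Z0 : 0 <= Z.
      by rewrite /Z !mulr_ge0 ?expR_ge0 // ltW.
    rewrite -(sqr_sqrtr Z0) ler_sqr ?nnegrE ?sqrtr_ge0 //.
    apply: ge_sup => // _ [m _ <-].
    rewrite -ler_sqr ?nnegrE ?sqrtr_ge0 ?mulr_ge0 ?expR_ge0 //.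
    by rewrite sqr_sqrtr //; exact: sq.
  move: Q2; have [->|Qn0] := eqVneq Q 0.
    by move=> _; rewrite mulr_ge0 ?expR_ge0 // ltW.
  by rewrite expr2 ler_pM2r // lt_neqAle eq_sym Qn0.
exists (K * expR (e * (c + c)%:R)); first by rewrite mulr_gt0 ?expR_gt0.
move=> n; clear pairs; clearbody K; rewrite -mulrA -expRD -mulrDr -natrD addnC; set m := (n + _)%N.
rewrite leNgt; apply/negP => X.
have X0 : 0 < K * expR (e * m%:R) by rewrite mulr_gt0 ?expR_gt0.
have an : 0 < a n := lt_trans X0 X.
pose q := a n / (K * expR (e * m%:R)).
have q1 : 1 < q by rewrite /q ltr_pdivlMr // mul1r.
have l0 : 0 < ln q by rewrite ln_gt0.
have m0 : 0 < m%:R + 1 :> R by rewrite ltr_wpDl.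
(* Passage to the limit [s = e]: with this [s], an excess factor [q > 1] over the bound at [e] would
   satisfy [ln q <= ln q * m / (m + 1)]. *)
have := main (e + ln q / (m%:R + 1)) n; rewrite ltrDl divr_gt0 // => /(_ isT).
rewrite -/m mulrDl expRD mulrA mulrC -ler_pdivrMr // -/q -[leLHS]lnK ?posrE ?(lt_trans ltr01) //.
rewrite ler_expR -mulrA ler_pMr // mulrC leNgt; move/negP; apply.
by rewrite ltr_pdivrMr // mul1r ltrDl.
Qed.

(** If [e = 0], annuli have bounded size. But [p] distinct boundary points have rays that are
    pairwise disjoint at distance [n] once [n] exceeds their mutual products, giving [p] elements of
    one window, with [p] arbitrarily large. *)
Lemma growth_exponent_gt0 : 0 < e.
Proof.
have [k [e0 _ _]] := growth_exponent_facts H gen.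
rewrite lt_neqAle e0 andbT; apply/eqP => eq0.
have [K K0 aK] := annulus_upper.
have [delta d0 [_ _ _ hXB _]] := boundary_hyperbolic H gen infG.
have [C C0 ray] := ray_point H gen infG.
have [c cC] := archi_bound_ex (C + 2).
have [p pK] := archi_bound_ex ((c + c)%:R * K + 1).
have [s [us sp]] := boundary_infinite H gen nvc p.
have [m mP] : exists m : R, forall xi om, xi \in s -> om \in s -> xi != om ->
    (gpb H xi om <= m%:E)%E.
  have [m m0 mP] := @seq_bound R _ (fun z => fine (gpb H z.1 z.2))
    [seq (xi, om) | xi <- s, om <- s].
  exists m => xi om xs os xo; have [M M0 E] := gpb_neq_fin H xo.
  have := mP (xi, om); rewrite /= E /= lee_fin; apply.
  by apply/allpairsP; exists (xi, om).
have [n nP] := archi_bound_ex (Num.max 0 (m + 2 * C + delta + 1)).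
have /choice[g gP] xi := ray xi n%:R (ler0n _ _).
have inj : {in s &, injective g}.
  move=> xi om xs os gxo; apply/eqP/negPn/negP => xo.
  have [h1 h2] := gP xi; have [_ h3] := gP om; rewrite -gxo in h3.
  have := le_trans (hXB _ _ _ _ h2 h3) (mP _ _ xs os xo); rewrite lee_fin.
  move: h1; rewrite ler_norml => /andP[h1 _].
  by move: nP; rewrite ge_max => /andP[_]; lra.
have : (size [seq g xi | xi <- s] <= size (window H n c))%N.
  apply: uniq_leq_size; first by rewrite map_inj_in_uniq.
  move=> _ /mapP[xi xs ->]; apply: mem_window => //.
  by have [h _] := gP xi; lra.
rewrite size_map sp -(ler_nat R) => h; have := le_trans h (@size_window _ _ _ H n c K _).
have h' : forall j : nat, (j < n + (c + c))%N -> (size (annulus H j))%:R <= K.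
  by move=> j _; have := aK j; rewrite -eq0 mul0r expR0 mulr1.
by move=> /(_ h'); lra.
Qed.

Lemma ball_upper : exists2 K : R, 0 < K & forall r, b r <= K * expR (e * r).
Proof.
have [K K0 aK] := annulus_upper; have e0 := growth_exponent_gt0.
have q1 : expR (- e) < 1 by rewrite -expR0 ltr_expR oppr_lt0.
(* Chosen so that [K1 * expR (- e) + K <= K1], which closes the induction when an annulus is added
   to a ball. *)
pose K1 : R := Num.max 1 (K / (1 - expR (- e))).
have K1K : K <= K1 * (1 - expR (- e)).
  by rewrite -ler_pdivrMr ?subr_gt0 // le_max lexx orbT.
have bn n : b n%:R <= Num.max (b 0%:R) K1 * expR (e * n%:R).
  elim: n => [|n IH]; first by rewrite mulr0 expR0 mulr1 le_max lexx.
  set K2 := Num.max _ _ in IH *.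
  have K12 : K1 <= K2 by rewrite le_max lexx orbT.
  apply: (le_trans (y := b n%:R + a n.+1)); first by rewrite -natrD ler_nat size_ball_seqS.
  have KK : K <= K2 * (1 - expR (- e)).
    by apply: le_trans K1K _; rewrite ler_wpM2r // subr_ge0 ltW.
  apply: (le_trans (lerD IH (aK n.+1))).
  rewrite (_ : e * n%:R = - e + e * n.+1%:R); last by rewrite -natr1; ring.
  rewrite expRD mulrA -mulrDl ler_wpM2r ?expR_ge0 //; lra.
set K2 := Num.max _ _ in bn; have K20 : 0 < K2 by rewrite !lt_max ltr01 orbT.
exists (K2 * expR e); first by rewrite mulr_gt0 ?expR_gt0.
move=> r; have [r0|r0] := ltP r 0.
  have -> : ball_seq H r = [::].
    case E : (ball_seq H r) => [//|g s]; have : g \in ball_seq H r by rewrite E mem_head.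
    by rewrite mem_ball_seq // => h; exfalso; have := len_ge0 H g; lra.
  by rewrite !mulr_ge0 ?expR_ge0 // ltW.
have [n /andP[n1 n2]] := archi_ceil_ex r0.
apply: (le_trans (y := b n%:R)); first by rewrite ler_nat size_ball_seq_le.
apply: le_trans (bn n) _; rewrite -mulrA ler_wpM2l ?(ltW K20) // -expRD ler_expR.
by rewrite -{2}(mulr1 e) -mulrDr ler_wpM2l ?(ltW e0) //; lra.
Qed.

Lemma ball_lower : exists2 K : R, 0 < K & forall n : nat, K * expR (e * n%:R) <= b n%:R.
Proof.
have [k [e0 _ low]] := growth_exponent_facts H gen.
exists (expR (- (e * k%:R))); first exact: expR_gt0.
move=> n; rewrite -expRD; have [kn|nk] := leqP k n.
  by rewrite -{2}(subnK kn); apply: le_trans (low (n - k)%N); rewrite natrB // ler_expR; lra.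
apply: (le_trans (y := 1)); last by rewrite ler1n size_ball_seq_gt0.
rewrite -[leRHS]expR0 ler_expR -mulrN -mulrDr mulr_ge0_le0 //.
by rewrite addrC subr_le0 ler_nat ltnW.
Qed.

Lemma thick_annulus_lower : exists (T K : R), 0 < T /\ 0 < K /\ forall n : nat,
  K * expR (e * n%:R) <= (size [seq g <- ball_seq H n%:R | n%:R - T < len g])%:R.
Proof.
have e0 := growth_exponent_gt0; have [K1 K10 up] := ball_upper; have [K2 K20 low] := ball_lower.
(* With this width, the ball of radius [n - T] has at most half of the number of elements guaranteed
   by [ball_lower] in the ball of radius [n]. *)
pose T := Num.max 1 (- ln (K2 / (2 * K1)) / e).
exists T, (K2 / 2); split; first by rewrite lt_max ltr01.
split=> [|n]; first by rewrite divr_gt0.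
have Tq : K1 * expR (- (e * T)) <= K2 / 2.
  rewrite mulrC -ler_pdivlMr // -[leRHS]lnK ?posrE ?divr_gt0 //.
  rewrite ler_expR lerNl (mulrC e) -ler_pdivrMr // /T le_max; apply/orP; right.
  by rewrite invfM mulrA.
have : b n%:R <= (size [seq g <- ball_seq H n%:R | n%:R - T < len g])%:R + b (n%:R - T).
  rewrite -natrD ler_nat -size_cat; apply: uniq_leq_size (uniq_ball_seq _ _) _ => g gn.
  rewrite mem_cat mem_filter gn andbT mem_ball_seq //; case: leP => //=; rewrite ?orbT //.
have := up (n%:R - T); rewrite mulrBr expRD mulrCA => h.
have := ler_wpM2l (expR_ge0 (e * n%:R)) Tq; have := low n.
by move: h; set E := expR _; lra.
Qed.

End Growth.

(** * Hausdorff measure *)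

(** A copy of [T] in which every set is measurable, so that [mu_ext], whose covers consist of
    measurable sets, ranges over the arbitrary covers of the Hausdorff premeasure. *)
Definition discrete (T : Type) : Type := T.
HB.instance Definition _ (T : pointedType) := Pointed.on (discrete T).
HB.instance Definition _ (T : pointedType) :=
  @isMeasurable.Build default_measure_display (discrete T) (@discrete_measurable T)
    (@discrete_measurable0 T) (@discrete_measurableC T) (@discrete_measurableU T).

Section Hausdorff.
Variables (R : realType) (T : pointedType) (rho : T -> T -> R) (D : R).
Hypothesis D0 : 0 < D.
Local Open Scope ereal_scope.
Local Notation diam := (diam rho).
Local Notation pre := (hausdorff_premeasure rho D).
Local Notation mu := (hausdorff_measure rho D).
Implicit Types (A X : set T).

Lemma diam_ge0 A : 0 <= diam A.
Proof. by apply: ereal_sup_ubound; left. Qed.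

Lemma diam_le A (r : R) : (0 <= r)%R -> (forall x y, A x -> A y -> (rho x y <= r)%R) ->
  diam A <= r%:E.
Proof.
move=> r0 Ar; apply: ge_ereal_sup => _ [->|[[x y] /= [Ax Ay] <-]]; first by rewrite lee_fin.
by rewrite lee_fin Ar.
Qed.

Lemma le_diam A x y : A x -> A y -> (rho x y)%:E <= diam A.
Proof. by move=> Ax Ay; apply: ereal_sup_ubound; right; exists (x, y). Qed.

Lemma diam0 : diam set0 = 0.
Proof.
by apply/eqP; rewrite eq_le diam_ge0 andbT; apply: diam_le.
Qed.

Lemma diam_set0_powR : diam set0 `^ D = 0.
Proof. by rewrite diam0 poweR0r // gt_eqF. Qed.

(** The constraint on diameters becomes an infinite cost, which turns the premeasure into an outer
    measure of the form [mu_ext]. *)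
Let gauge (delta : R) (A : set (discrete T)) : \bar R :=
  if diam A <= delta%:E then diam A `^ D else +oo.

Let gauge_ge0 delta A : 0 <= gauge delta A.
Proof. by rewrite /gauge; case: ifP => _; rewrite ?poweR_ge0 ?leey. Qed.

Let pre_ext delta A : pre delta A = mu_ext (gauge delta) (A : set (discrete T)).
Proof.
apply/eqP; rewrite eq_le; apply/andP; split.
  apply: le_ereal_inf_tmp => _ [U [mU AU] <-].
  have [Ud|] := pselect (forall k, diam (U k) <= delta%:E).
    apply: ereal_inf_lbound; exists U => //.
    by apply: eq_eseriesr => k _; rewrite /gauge Ud.
  move=> /existsNP[k /negP Uk]; rewrite (@eseries_pinfty _ _ _ k) ?leey //.
    by move=> n _; rewrite -ltNye (lt_le_trans _ (gauge_ge0 _ _)).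
  by rewrite /gauge (negbTE Uk).
apply: le_ereal_inf_tmp => _ [U [AU Ud] <-]; apply: ereal_inf_lbound.
by exists U; [|apply: eq_eseriesr => k _; rewrite /gauge Ud].
Qed.

Lemma hausdorff_premeasure_le delta A : pre delta A <= mu A \/ (delta <= 0)%R.
Proof.
have [d0|] := ltP 0%R delta; last by right.
by left; apply: ereal_sup_ubound; exists delta.
Qed.

Lemma hausdorff_measure_ge0 A : 0 <= mu A.
Proof.
apply: (@le_trans _ _ (pre 1 A)); first by rewrite pre_ext mu_ext_ge0.
by apply: ereal_sup_ubound; exists 1%R => /=.
Qed.

Lemma le_hausdorff_measure : {homo mu : A B / A `<=` B >-> A <= B}.
Proof.
move=> A B AB; apply: ge_ereal_sup => _ [delta d0 <-].
apply: (@le_trans _ _ (pre delta B)); first by rewrite !pre_ext; exact: le_mu_ext.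
by apply: ereal_sup_ubound; exists delta.
Qed.

Lemma hausdorff_measure_le_cover A (K : R) : (forall delta : R, (0 < delta)%R ->
    exists (I : Type) (s : seq I) (F : I -> set T),
    [/\ A `<=` [set x | exists2 i, List.In i s & F i x],
        forall i, diam (F i) <= delta%:E &
        \sum_(i <- s) diam (F i) `^ D <= K%:E]) ->
  mu A <= K%:E.
Proof.
move=> H; apply: ge_ereal_sup => _ [delta /= d0 <-].
have [I [s [F [AF Fd sK]]]] := H delta d0.
(* The finite cover is padded with empty sets, which contribute 0 because [D > 0]. *)
apply: le_trans sK; pose U k := nth set0 (map F s) k.
have Us : \sum_(k <oo) diam (U k) `^ D = \sum_(i <- s) diam (F i) `^ D.
  rewrite (nneseries_split _ (size s)) => [|k _]; last exact: poweR_ge0.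
  rewrite add0n [X in _ + X]eseries0 ?adde0 => [|k sk _]; last first.
    by rewrite /U nth_default ?size_map // diam_set0_powR.
  rewrite -(big_map F xpredT (fun A => diam A `^ D)) (big_nth set0) size_map.
  by [].
rewrite -Us; apply: ereal_inf_lbound; exists U => //; split.
  move=> x /AF[i si Fx]; move: si; rewrite /U; elim: (s) => // j s' IH /= [->|/IH[k _ Uk]].
    by exists 0%N.
  by exists k.+1.
move=> k; rewrite /U; have [sk|sk] := leqP (size (map F s)) k.
  by rewrite nth_default // diam0 lee_fin ltW.
move: sk; rewrite size_map => sk.
case: (s) sk => // i0 s' sk.
by rewrite (nth_map i0).
Qed.

Lemma hausdorff_measure0 : mu set0 = 0.
Proof.
apply/eqP; rewrite eq_le hausdorff_measure_ge0 andbT.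
apply: (@hausdorff_measure_le_cover _ 0%R) => delta d0.
exists unit, [::], (fun=> set0); split=> //; last by rewrite big_nil.
by move=> _; rewrite diam0 lee_fin ltW.
Qed.

Lemma hausdorff_measure_sigma_subadditive : sigma_subadditive mu.
Proof.
move=> F; apply: ge_ereal_sup => _ [delta /= d0 <-].
rewrite pre_ext; have := @mu_ext_sigma_subadditive _ (discrete T) R _ (gauge_ge0 delta) F.
move=> /le_trans; apply.
apply: lee_nneseries => [i _ _|i _]; first exact: mu_ext_ge0.
by rewrite -pre_ext; apply: ereal_sup_ubound; exists delta.
Qed.

HB.instance Definition _ := isOuterMeasure.Build R T mu hausdorff_measure0
  hausdorff_measure_ge0 le_hausdorff_measure hausdorff_measure_sigma_subadditive.

Lemma hausdorff_premeasure_mono (delta delta' : R) A : (delta <= delta')%R ->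
  pre delta' A <= pre delta A.
Proof.
move=> dd; apply: le_ereal_inf => _ [U [AU Ud] <-]; exists U => //; split=> // k.
by apply: le_trans (Ud k) _; rewrite lee_fin.
Qed.

Lemma hausdorff_measure_lipschitz (f : T -> T) (L : R) A : (0 < L)%R ->
  (forall x y, A x -> A y -> (rho (f x) (f y) <= L * rho x y)%R) ->
  mu (f @` A) <= (L `^ D)%:E * mu A.
Proof.
move=> L0 fL; apply: ge_ereal_sup => _ [delta /= d0 <-].
apply: (@le_trans _ _ ((L `^ D)%:E * pre (delta / L) A)); last first.
  rewrite lee_wpmul2l ?lee_fin ?powR_ge0 //; apply: ereal_sup_ubound.
  by exists (delta / L)%R => //=; rewrite divr_gt0.
have LD : (0 < L `^ D)%R by rewrite powR_gt0.
rewrite -lee_pdivrMl //; apply: le_ereal_inf_tmp => _ [U [AU Ud] <-].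
rewrite lee_pdivrMl // -nneseriesZl => [|k _]; last exact: poweR_ge0.
pose W k := f @` (A `&` U k).
have WU k : diam (W k) <= L%:E * diam (U k).
  apply: ge_ereal_sup => z [->|]; first by rewrite mule_ge0 ?diam_ge0 ?lee_fin ?ltW.
  move=> [[a b] /= [[x [Ax Ux] <-] [y [Ay Uy] <-]] <-].
  apply: (@le_trans _ _ (L%:E * (rho x y)%:E)); first by rewrite -EFinM lee_fin fL.
  by apply: lee_wpmul2l; [rewrite lee_fin ltW|exact: le_diam].
apply: (@le_trans _ _ (\sum_(k <oo) diam (W k) `^ D)).
  apply: ereal_inf_lbound; exists W => //; split.
    by move=> _ [x Ax <-]; have [k _ Ukx] := AU x Ax; exists k => //; exists x.
  move=> k; apply: le_trans (WU k) _.
  apply: (@le_trans _ _ (L%:E * (delta / L)%:E)).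
    by apply: lee_wpmul2l; [rewrite lee_fin ltW|exact: Ud].
  by rewrite -EFinM lee_fin mulrCA divff ?mulr1 // gt_eqF.
apply: lee_nneseries => [i _ _|i _]; first exact: poweR_ge0.
have L0' : 0 <= L%:E by rewrite lee_fin ltW.
rewrite -poweR_EFin -poweRM ?diam_ge0 //.
by apply: (gt0_ler_poweR (ltW D0) _ _ (WU i));
  rewrite in_itv /= leey andbT ?diam_ge0 // mule_ge0 ?diam_ge0.
Qed.

(** A set of diameter at most [delta < r] cannot meet both [A] and [B], so a cover of the union
    splits into a cover of each. *)
Lemma hausdorff_premeasure_sep (delta r : R) A B : (delta < r)%R ->
  (forall x y, A x -> B y -> (r <= rho x y)%R) ->
  pre delta A + pre delta B <= pre delta (A `|` B).
Proof.
move=> dr AB; apply: le_ereal_inf_tmp => z [U [ABU Ud] <-].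
pose V (C : set T) k := if pselect (U k `&` C !=set0) then U k else set0.
have VU C : C `<=` A `|` B -> C `<=` \bigcup_k V C k.
  move=> CAB x Cx; have [k _ Ux] := ABU x (CAB x Cx); exists k => //.
  by rewrite /V; case: pselect => // nUC; case: nUC; exists x.
have Vd C k : diam (V C k) <= delta%:E.
  rewrite /V; case: pselect => [?|?]; first exact: Ud.
  by rewrite diam0; exact: le_trans (diam_ge0 (U k)) (Ud k).
apply: (@le_trans _ _ (\sum_(k <oo) diam (V A k) `^ D + \sum_(k <oo) diam (V B k) `^ D)).
  by apply: leeD; apply: ereal_inf_lbound; [exists (V A)|exists (V B)] => //; split=> //;
    apply: VU; [exact: subsetUl|exact: subsetUr].
rewrite -nneseriesD => [|i _ _|i _ _]; try exact: poweR_ge0.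
apply: lee_nneseries => [i _ _|k _]; first by rewrite adde_ge0 ?poweR_ge0.
rewrite /V; case: pselect => [[x [Ux Ax]]|?]; last first.
  by rewrite diam_set0_powR add0e; case: pselect => [?|?] //; rewrite diam_set0_powR poweR_ge0.
case: pselect => [[y [Uy By]]|?]; last by rewrite diam_set0_powR adde0.
exfalso; have := le_trans (le_diam Ux Uy) (Ud k); rewrite lee_fin.
by have := AB x y Ax By; lra.
Qed.

Lemma hausdorff_measure_sep (r : R) A B : (0 < r)%R ->
  (forall x y, A x -> B y -> (r <= rho x y)%R) -> mu A + mu B <= mu (A `|` B).
Proof.
move=> r0 AB; have [muy|muy] := eqVneq (mu (A `|` B)) +oo; first by rewrite muy leey.
have fin C : C `<=` A `|` B -> mu C \is a fin_num.
  move=> CAB; rewrite ge0_fin_numE ?hausdorff_measure_ge0 //.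
  by apply: le_lt_trans (le_hausdorff_measure CAB) _; rewrite ltey.
have finA := fin A (@subsetUl _ _ _); have finB := fin B (@subsetUr _ _ _).
have finp C (delta : R) : mu C \is a fin_num -> (0 < delta)%R -> pre delta C \is a fin_num.
  move=> Cf d0; rewrite ge0_fin_numE; last by rewrite pre_ext mu_ext_ge0.
  have [h|h] := hausdorff_premeasure_le delta C; last by move: d0; rewrite ltNge h.
  by apply: le_lt_trans h _; rewrite -ge0_fin_numE ?hausdorff_measure_ge0.
rewrite -leeBrDr //; apply: ge_ereal_sup => z [d1 /= d10 <-].
rewrite leeBrDr // -leeBrDl ?finp //; apply: ge_ereal_sup => z' [d2 /= d20 <-].
rewrite leeBrDl ?finp //.
pose delta : R := Num.min d1 (Num.min d2 (r / 2)%R).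
have h1 : (delta <= d1)%R by rewrite ge_min lexx.
have h2 : (delta <= d2)%R by rewrite !ge_min lexx orbT.
have h3 : (delta <= r / 2)%R by rewrite !ge_min lexx !orbT.
have delta0 : (0 < delta)%R by rewrite !lt_min d10 d20 divr_gt0.
have h4 : (delta < r)%R by lra.
apply: (le_trans (leeD (hausdorff_premeasure_mono A h1) (hausdorff_premeasure_mono B h2))).
apply: (le_trans (hausdorff_premeasure_sep h4 AB)).
by apply: ereal_sup_ubound; exists delta.
Qed.

Hypothesis tri : forall y x z, (rho x z <= rho x y + rho y z)%R.

(** Caratheodory's argument for metric outer measures. The sets [A n] exhaust the part of [X] in [U]
    and stay away from the complement of [U]. The shell [E n] has positive distance to [A n], so the
    sum of all shells is at most twice [mu X]; its tails tend to 0, and [A N] misses arbitrarily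
    little. *)
Lemma hausdorff_measure_open_caratheodory (U : set T) :
  (forall x, U x -> exists2 r, (0 < r)%R & forall y, (rho x y < r)%R -> U y) ->
  caratheodory_measurable mu U.
Proof.
move=> Uo; apply: (@le_caratheodory_measurable R T mu) => X.
change (mu (X `&` U) + mu (X `&` ~` U) <= mu X).
have [muy|muy] := eqVneq (mu X) +oo; first by rewrite muy leey.
have finX : mu X \is a fin_num by rewrite ge0_fin_numE ?hausdorff_measure_ge0 // ltey.
pose A n := [set x | X x /\ U x /\ forall y, ~ U y -> (n.+1%:R^-1 <= rho x y)%R].
pose E n := A n.+2 `\` A n.+1.
have AX n : A n `<=` X by move=> x [].
have Amono n : A n `<=` A n.+1.
  move=> x [Xx [Ux Ax]]; split=> //; split=> // y /Ax; apply: le_trans.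
  by rewrite lef_pV2 ?posrE ?ltr0n // ler_nat.
have AE n : mu (A n) + mu (E n) <= mu (A n.+2).
  have : (0 < n.+1%:R^-1 - n.+2%:R^-1 :> R)%R.
    by rewrite subr_gt0 ltf_pV2 ?posrE ?ltr0n // ltr_nat.
  move=> /hausdorff_measure_sep sep.
  apply: le_trans (sep (A n) (E n) _) _; last first.
    by apply: le_hausdorff_measure => x [/Amono/Amono//|[]].
  move=> x z [_ [_ Ax]] [[Xz [Uz Az]]] nAz.
  have [y nUy zy] : exists2 y, ~ U y & (rho z y < n.+2%:R^-1)%R.
    apply: contrapT => ny; apply: nAz; split=> //; split=> // y nUy.
    by rewrite leNgt; apply/negP => zy; apply: ny; exists y.
  move: zy (Ax y nUy) (tri z x y); set a := _.+2%:R^-1%R; set b := _.+1%:R^-1%R; lra.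
have partial n : \sum_(0 <= j < n) mu (E j) <= mu (A n) + mu (A n.+1).
  elim: n => [|n IH]; first by rewrite big_geq // adde_ge0 ?hausdorff_measure_ge0.
  rewrite big_nat_recr //=; apply: le_trans (leeD2r _ IH) _.
  rewrite addeAC [leLHS]addeC; apply: leeD2l; exact: AE.
have E0 j : 0 <= mu (E j) := hausdorff_measure_ge0 _.
have Efin : \sum_(0 <= j <oo) mu (E j) < +oo.
  apply: (@le_lt_trans _ _ (mu X + mu X)); last first.
    by rewrite -ge0_fin_numE ?adde_ge0 ?hausdorff_measure_ge0 // fin_numD finX.
  apply: lime_le; first by apply: is_cvg_nneseries.
  apply: nearW => n; apply: le_trans (partial n) _.
  by apply: leeD; apply: le_hausdorff_measure; exact: AX.
have tail0 := nneseries_tail_cvg Efin (fun k _ => E0 k).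
have lim : (mu X + \sum_(N <= j <oo) mu (E j)) @[N --> \oo] --> mu X + 0.
  by apply: cvgeD => //; [rewrite fin_num_adde_defl|exact: cvg_cst].
rewrite adde0 in lim; apply: (cvge_ge (N := 0%N) lim) => N _.
have XU : X `&` U `<=` A N.+1 `|` \bigcup_j E (j + N)%N.
  move=> x [Xx Ux]; have [r r0 rU] := Uo x Ux.
  have [n An] : exists n, A (n + N.+1)%N x.
    exists (Num.bound r^-1); split=> //; split=> // y nUy.
    apply: (@le_trans _ _ r); last by rewrite leNgt; apply/negP => /rU.
    rewrite -[leRHS]invrK lef_pV2 ?posrE ?ltr0n ?invr_gt0 //.
    apply: (le_trans (ltW (archi_boundP _))); first by rewrite invr_ge0 ltW.
    by rewrite ler_nat -addnS leq_addr.
  elim: n An => [|n IH] An; first by left.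
  have [/IH //|nAn] := pselect (A (n + N.+1)%N x).
  by right; exists n => //; split; move: An nAn; rewrite addnS -?addSn ?addnS.
apply: (@le_trans _ _ (mu (A N.+1) + \sum_(N <= j <oo) mu (E j) + mu (X `&` ~` U))).
  apply: leeD2r; apply: le_trans (le_hausdorff_measure XU) _.
  apply: le_trans (outer_measureU2 _ _ _) _; apply: leeD2l.
  apply: le_trans (outer_measure_sigma_subadditive mu _) _.
  by rewrite (nneseries_addn (f := mu \o E)) // => j; exact: E0.
rewrite addeAC; apply: leeD2r.
have N0 : (0 < N.+2%:R^-1 :> R)%R by rewrite invr_gt0 ltr0n.
apply: le_trans (hausdorff_measure_sep N0 _) _.
  by move=> x y [_ [_ Ax]] [_ nUy]; exact: Ax.
by apply: le_hausdorff_measure => x [/AX//|[]].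
Qed.

Definition hausdorff_outer : {outer_measure set T -> \bar R} := mu.

End Hausdorff.

(** * The measure on the boundary *)

Section Visual.
Variables (R : realType) (G : groupType) (S : seq G) (H : hat_metric R S).
Hypothesis gen : generates S.
Hypothesis nvc : ~ virtually_cyclic G.
Let infG := not_virtually_cyclic_infinite nvc.
Variable eps : R.
Hypothesis eps01 : 0 < eps <= 1.
Local Notation B := (boundary_borel R S).
Local Notation len := (hat_length H).
Local Notation e := (growth_exponent H).
Local Notation b r := ((size (ball_seq H r))%:R : R).
Local Notation gp := (gp H).
Local Notation gpx := (gpx H).
Local Notation gpb := (gpb H).
Local Notation act := (@boundary_act R G S).
Local Notation rho := (hat_visual H eps).
Local Notation mu := (mu H eps).
Implicit Types (g h x : G) (xi om ze : B).

Let eps0 : 0 < eps. Proof. by case/andP: eps01. Qed.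
Let e0 : 0 < e := growth_exponent_gt0 H gen nvc.
Let D0 : 0 < e / eps. Proof. by rewrite divr_gt0. Qed.

Lemma visual_metric : is_metric rho.
Proof. exact: (hat_visual_metric H _ eps01). Qed.

Lemma visual_ge0 xi om : 0 <= rho xi om. Proof. by case: visual_metric. Qed.
Lemma visual_sym xi om : rho xi om = rho om xi. Proof. by case: visual_metric. Qed.
Lemma visual_tri ze xi om : rho xi om <= rho xi ze + rho ze om.
Proof. by case: visual_metric. Qed.

Lemma visualE xi om :
  (exists2 M, gpb xi om = M%:E & rho xi om = expR (- (eps * M))) \/ (xi = om /\ rho xi om = 0).
Proof.
rewrite /hat_visual /visual /hat_product -/(gpb xi om).
have := gpb_ge0 H xi om; case E : (gpb xi om) => [M||] // _.
  by left; exists M.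
right; split; first exact/(gpb_eqy H).
by rewrite gt0_muley ?lte_fin.
Qed.

Lemma visual_le t xi om : (rho xi om <= expR (- (eps * t))) = (t%:E <= gpb xi om)%E.
Proof.
have [[M -> ->]|[-> ->]] := visualE xi om.
  by rewrite ler_expR lerN2 ler_pM2l.
by rewrite expR_ge0 ((gpb_eqy H _ _).2 erefl) leey.
Qed.

Lemma visual_le1 xi om : rho xi om <= 1.
Proof. by have := visual_le 0 xi om; rewrite mulr0 oppr0 expR0 gpb_ge0. Qed.

Lemma visual_act g xi om : rho (act g xi) (act g om) <= expR (eps * len g) * rho xi om.
Proof.
have [[M E ->]|[-> ->]] := visualE xi om; last first.
  suff -> : rho (act g om) (act g om) = 0 by rewrite mulr0.
  by have [_ h _ _] := visual_metric; apply/h.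
rewrite -expRD (_ : _ + _ = - (eps * (M - len g))); last by ring.
rewrite visual_le gpb_act // E -EFinD lee_fin.
have := gpx_le H gen infG g^-1%g xi; have := gpx_le H gen infG g^-1%g om.
by rewrite lenV; lra.
Qed.

(** The Lipschitz constant [expR (eps * len g)] raised to the dimension [e / eps] no longer involves
    [eps]. *)
Lemma mu_act g (A : set B) : (mu (act g @` A) <= (expR (e * len g))%:E * mu A)%E.
Proof.
have h := @hausdorff_measure_lipschitz R B rho _ D0 (act g) _ A (expR_gt0 (eps * len g))
  (fun xi om _ _ => visual_act g xi om).
rewrite (_ : expR (e * len g) = expR (eps * len g) `^ (e / eps)) //.
by rewrite -expRM; congr expR; field; rewrite gt_eqF.
Qed.

(** Rough geodesics from 1 to such [g] pass near the point [h] at distance [t] on the way to [x];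
    translation by [h^-1] sends these [g] into a ball of radius about [r - t]. *)
Lemma cone_count : exists2 c : R, 0 <= c & forall x t r,
  (size [seq g <- ball_seq H r | t <= gp x g])%:R <= b (r - t + c).
Proof.
have [delta d0 [hG _ _ _ _]] := boundary_hyperbolic H gen infG.
have [C C0 pt] := length_rough_point H gen.
exists (3 * C + 2 * delta); first lra.
move=> x t r; rewrite ler_nat.
have [t0|t0] := ltP t 0.
  have h : r <= r - t + (3 * C + 2 * delta) by lra.
  apply: leq_trans (size_ball_seq_le H gen h).
  by rewrite size_filter count_size.
have [tx|xt] := leP t (len x); last first.
  rewrite (@eq_filter _ _ pred0) ?filter_pred0 // => g /=; apply/negbTE.
  by rewrite -ltNge; apply: le_lt_trans xt; exact: gp_le.
have [h [h1 h2]] := pt x t ltac:(by rewrite t0 tx).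
rewrite -(size_map (fun g => h^-1 * g)%g); apply: uniq_leq_size.
  rewrite map_inj_uniq ?filter_uniq ?uniq_ball_seq //; exact: mulgI.
move=> z /mapP[g]; rewrite mem_filter !mem_ball_seq // => /andP[tg gr] ->.
have := hG h x g (t - C) h2 ltac:(lra); rewrite gpE.
by move: h1; rewrite ler_norml => /andP[_ h1]; lra.
Qed.

(** At scale [s] the cone is covered by about [expR (e * (s - r))] shadows, each contributing about
    [expR (- (e * s))] to the Hausdorff sum. *)
Lemma mu_cone_upper : exists2 K : R, 0 < K & forall x r,
  (mu [set xi | (r <= gpx x xi)%R] <= (K * expR (- (e * r)))%:E)%E.
Proof.
have [delta d0 [_ _ hXG hXB _]] := boundary_hyperbolic H gen infG.
have [C C0 ray] := ray_point H gen infG.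
have [K1 K10 up] := ball_upper H gen nvc.
have [c c0 cone] := cone_count.
pose w := C + delta + c + (2 * C + delta).
exists (K1 * expR (e * w)); first by rewrite mulr_gt0 ?expR_gt0.
move=> x r; apply: (hausdorff_measure_le_cover D0) => eta eta0.
(* The second bound makes the ray points see [xi] at least up to depth [r]; the third makes the
   shadows have diameter at most [eta]. *)
pose s := Num.max 0 (Num.max (r + 2 * C) (2 * C + delta - ln eta / eps)).
have s0 : 0 <= s by rewrite le_max lexx.
have sr : r + 2 * C <= s by rewrite !le_max lexx !orbT.
have seta : 2 * C + delta - ln eta / eps <= s by rewrite !le_max lexx !orbT.
pose L := [seq g <- ball_seq H (s + C) | r - delta <= gp x g].
pose F g : set B := [set xi | s - 2 * C <= gpx g xi].
have Fd g : (diam rho (F g) <= (expR (- (eps * (s - 2 * C - delta))))%:E)%E.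
  apply: diam_le; first exact: expR_ge0.
  by move=> xi om xF oF; rewrite visual_le; exact: hXB xF oF.
exists G, L, F; split.
- move=> xi /= rxi; have [g [g1 g2]] := ray xi s s0.
  move: g1; rewrite ler_norml => /andP[g1 g1'].
  exists g; last by rewrite /F /=; lra.
  have gL : g \in L.
    rewrite mem_filter mem_ball_seq //; apply/andP; split; last lra.
    by apply: (hXG x g xi r) => //; lra.
  elim: (L) gL => // a l IH; rewrite inE => /predU1P[->|/IH]; first by left.
  by right.
- move=> g; apply: le_trans (Fd g) _; rewrite lee_fin -[leRHS]lnK ?posrE // ler_expR.
  rewrite lerNl mulrC -ler_pdivrMr // mulNr; lra.
have Fp g : ((diam rho (F g) `^ (e / eps))%E <= (expR (- (e * (s - 2 * C - delta))))%:E)%E.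
  apply: le_trans (gt0_ler_poweR (ltW D0) _ _ (Fd g)) _.
  - by rewrite in_itv /= leey diam_ge0.
  - by rewrite in_itv /= leey lee_fin expR_ge0.
  rewrite poweR_EFin -expRM lee_fin ler_expR.
  rewrite (_ : _ * (e / eps) = - (e * (s - 2 * C - delta))) //.
  by field; rewrite gt_eqF.
apply: (@le_trans _ _ (\sum_(g <- L) (expR (- (e * (s - 2 * C - delta))))%:E)).
  by apply: lee_sum => g _; exact: Fp.
rewrite sumEFin lee_fin big_const_seq count_predT iter_addr_0 -[leLHS]mulr_natl.
have := cone x (r - delta) (s + C) => /le_trans/(_ (up _)).
rewrite -/L => hL.
apply: (le_trans (ler_wpM2r (expR_ge0 _) hL)).
rewrite -!(mulrA K1) -!expRD (ler_pM2l K10) ler_expR.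
rewrite -!mulrBr (ler_pM2l e0) /w; lra.
Qed.

End Visual.

Lemma size_fibers (T : eqType) (f : T -> nat) (N : nat) (A : seq T) :
  (forall x, x \in A -> (f x < N)%N) -> size A = (\sum_(0 <= k < N) count (fun x => f x == k) A)%N.
Proof.
elim: A => [|a A IH] fN; first by rewrite big1.
rewrite /= big_split /= -IH => [|x xA]; last by apply: fN; rewrite inE xA orbT.
rewrite -add1n; congr addn; have faN := fN a (mem_head _ _).
rewrite (bigD1_seq (f a)) ?mem_index_iota ?iota_uniq //= eqxx big1 // => k.
by rewrite eq_sym => /negbTE ->.
Qed.

Lemma sum_half_powers (R : realFieldType) (N : nat) : \sum_(0 <= k < N) (2 ^- k.+1 : R) <= 1.
Proof.
suff -> : \sum_(0 <= k < N) (2 ^- k.+1 : R) = 1 - 2 ^- N.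
  by rewrite gerBl invr_ge0 exprn_ge0.
elim: N => [|N IH]; first by rewrite big_geq // expr0 invr1 subrr.
rewrite big_nat_recr //= IH exprS invfM; lra.
Qed.

(** * Lower bounds for the Hausdorff measure *)

Section Positivity.
Variables (R : realType) (G : groupType) (S : seq G) (H : hat_metric R S).
Hypothesis gen : generates S.
Hypothesis nvc : ~ virtually_cyclic G.
Let infG := not_virtually_cyclic_infinite nvc.
Variable eps : R.
Hypothesis eps01 : 0 < eps <= 1.
Local Notation B := (boundary_borel R S).
Local Notation len := (hat_length H).
Local Notation e := (growth_exponent H).
Local Notation b r := ((size (ball_seq H r))%:R : R).
Local Notation gp := (gp H).
Local Notation gpx := (gpx H).
Local Notation gpb := (gpb H).
Local Notation rho := (hat_visual H eps).
Local Notation mu := (mu H eps).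
Implicit Types (g h x : G) (xi om ze : B).

Let eps0 : 0 < eps. Proof. by case/andP: eps01. Qed.
Let e0 : 0 < e := growth_exponent_gt0 H gen nvc.
Let D0 : 0 < e / eps. Proof. by rewrite divr_gt0. Qed.

(** Compactness of the boundary through the group: points [ze n] outside the first [n] sets are
    approximated by elements [x n]. A subsequence of these tends to some [xi], hence so do the
    corresponding [ze n], which thus enter the set containing a neighborhood of [xi]. *)
Lemma boundary_finite_subcover (U : nat -> set B) :
  (forall xi, exists k (M : R), forall ze, (M%:E <= gpb xi ze)%E -> U k ze) ->
  exists N, forall ze, exists2 k, (k < N)%N & U k ze.
Proof.
move=> Uo; apply: contrapT => /forallNP nN.
have /choice[ze zeP] (n : nat) : exists ze, forall k, (k < n)%N -> ~ U k ze.
  by have /existsNP[ze h] := nN n; exists ze => k kn Uk; apply: h; exists k.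
have /choice[x xP] (n : nat) : exists x, n%:R <= gpx x (ze n) by exact: gpx_unbounded.
have [delta d0 [_ _ _ hXB _]] := boundary_hyperbolic H gen infG.
have [|f nf [xi xx]] := @len_subseq _ _ _ H gen x.
  move=> M; have [N MN] := archi_bound_ex M; exists N => n Nn.
  apply: (le_trans MN); apply: le_trans (le_trans (xP n) (gpx_le H gen infG _ _)).
  by rewrite ler_nat.
have [k [M UM]] := Uo xi.
have c : Bd xi @[_ --> \oo] --> (Bd xi : compactification R S) by exact: cvg_cst.
have h := hg_cvg (H := H) (q := vertex R S 1%g) (vertex_limit_mem xx) c.
have [|N HN] := cvge_gt (t := (M + delta)%:E) h.
  by rewrite (hat_gprod_eqy H _ _ _).2 ?ltry //; exists xi.
have [N' MN'] := archi_bound_ex (M + delta).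
pose n := maxn N (maxn N' k.+1).
have /ltW := HN n (leq_maxl _ _); rewrite gpxE lee_fin /= => h1.
have h2 : M + delta <= gpx (x (f n)) (ze (f n)).
  apply: le_trans (le_trans MN' _) (xP (f n)); rewrite ler_nat; apply: leq_trans (nf n).
  by rewrite /n !leq_max leqnn orbT.
apply: (zeP (f n) k).
  by apply: leq_trans (nf n); rewrite /n !leq_max leqnn !orbT.
by apply: UM; have := hXB _ _ _ _ h1 h2; rewrite addrK.
Qed.

(** A mass distribution argument with counting in place of a measure. Each element of a thick
    annulus of large radius [n] is assigned to a neighborhood of a [U k] containing a point of its
    shadow. The elements assigned to [k] lie in one cone and number at most
    [K3 * expR (e * n) * y k]; all together they number at least [K2 * expR (e * n)]. *)
Lemma cover_sum_lower : exists2 c : R, 0 < c & forall U : nat -> set B,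
  setT `<=` \bigcup_k U k -> (c%:E <= \sum_(k <oo) diam rho (U k) `^ (e / eps))%E.
Proof.
have [delta d0 [_ _ hXG _ [hBX hBB]]] := boundary_hyperbolic H gen infG.
have [C C0 shadow] := shadow_nonempty H gen nvc.
have [K1 K10 up] := ball_upper H gen nvc.
have [T [K2 [T0 [K20 low]]]] := thick_annulus_lower H gen nvc.
have [c c0 cone] := cone_count H gen nvc.
pose w := C + 4 * delta + c.
pose K3 := K1 * expR (e * w); have K30 : 0 < K3 by rewrite mulr_gt0 ?expR_gt0.
pose eta := K2 / K3 / 2; have eta0 : 0 < eta by rewrite !divr_gt0.
exists eta => // U TU.
have dfin k : diam rho (U k) = (fine (diam rho (U k)))%:E.
  rewrite fineK // ge0_fin_numE ?diam_ge0 //; apply: (@le_lt_trans _ _ 1%:E); last by rewrite ltry.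
  by apply: diam_le => // xi om _ _; exact: visual_le1.
pose d k := fine (diam rho (U k)); have dk0 k : 0 <= d k by rewrite fine_ge0 ?diam_ge0.
(* The summable excess makes the scale [s k] finite even when the diameter is 0, and costs at most
   [eta] of the bound [2 * eta] obtained for the sum of the [y k]. *)
pose y k := d k `^ (e / eps) + eta * 2 ^- k.+1.
have y0 k : 0 < y k by rewrite ltr_wpDl ?powR_ge0 // mulr_gt0 ?invr_gt0 ?exprn_gt0.
pose s k := - ln (y k) / e.
have ys k : expR (- (e * s k)) = y k.
  by rewrite /s (_ : - (e * _) = ln (y k)) ?lnK ?posrE //; field; rewrite gt_eqF.
have sep k xi om : U k xi -> U k om -> ((s k)%:E <= gpb xi om)%E.
  move=> xU oU; rewrite -(visual_le H eps01).
  apply: (@le_trans _ _ (d k)).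
    by rewrite -lee_fin -dfin; exact: le_diam.
  have -> : expR (- (eps * s k)) = y k `^ (eps / e).
    by rewrite -ys -expRM; congr expR; field; rewrite gt_eqF.
  rewrite -{1}(powRr1 (dk0 k)) -(_ : e / eps * (eps / e) = 1); last by field; rewrite !gt_eqF.
  rewrite powRrM ge0_ler_powR ?nnegrE ?powR_ge0 ?divr_ge0 ?(ltW eps0) ?(ltW e0) ?(ltW (y0 k)) //.
  by rewrite lerDl mulr_ge0 ?(ltW eta0) // invr_ge0 exprn_ge0.
pose U' k := [set ze | exists2 om, U k om & ((s k)%:E <= gpb om ze)%E].
have [|N UN] := @boundary_finite_subcover U'.
  by move=> xi; have [k _ Uk] := TU xi I; exists k, (s k) => ze h; exists xi.
have [M M0 sM] := seq_bound s (iota 0 N).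
have [n nM] := archi_bound_ex (M + T).
have sn k : (k < N)%N -> s k + T <= n%:R.
  by move=> kN; apply: le_trans nM; rewrite lerD2r; apply: sM; rewrite mem_iota.
have /choice[xi xiP] g := shadow g.
have /choice[kk kkP] g : exists k, (k < N)%N /\ U' k (xi g).
  by have [k kN Uk] := UN (xi g); exists k.
pose A := [seq g <- ball_seq H n%:R | n%:R - T < len g].
have cnt k : (k < N)%N -> (count (fun g => kk g == k) A)%:R <= K3 * expR (e * n%:R) * y k.
  move=> kN; have [/hasP[g0 g0A /eqP g0k]|/negPf ng] :=
    boolP (has (fun g => kk g == k) A); last first.
    move: ng; rewrite has_count lt0n => /negbFE/eqP ->.
    by rewrite mulr0n; apply: mulr_ge0; [apply: mulr_ge0; [exact: ltW|exact: expR_ge0]|exact: ltW].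
  have inA g : g \in A -> kk g == k -> s k - C <= gpx g (xi g) /\
    (exists2 om, U k om & ((s k)%:E <= gpb om (xi g))%E).
    rewrite mem_filter => /andP[gn _] /eqP gk; split; last by have [_] := kkP g; rewrite gk.
    by have := sn k kN; have := xiP g; lra.
  have [h1 [om0 om0U h2]] := inA g0 g0A (introT eqP g0k).
  have h1' : s k - C - 3 * delta <= gpx g0 (xi g0) by lra.
  have sub : (count (fun g => kk g == k) A <=
      size [seq g <- ball_seq H n%:R | (s k - (C + 4 * delta) <= gp g0 g)%R])%N.
    rewrite -size_filter; apply: uniq_leq_size; first by rewrite !filter_uniq ?uniq_ball_seq.
    move=> g; rewrite mem_filter => /andP[gk gA]; have [h3 [om omU h4]] := inA g gA gk.
    rewrite mem_filter; move: (gA); rewrite mem_filter => /andP[_ ->]; rewrite andbT.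
    have h5 : ((s k - delta)%:E <= gpb (xi g0) om)%E.
      apply: hBB (sep k om0 om om0U omU); by rewrite gpbC.
    have h6 : ((s k - delta - delta)%:E <= gpb (xi g0) (xi g))%E.
      by apply: hBB h5 _; apply: le_trans h4; rewrite lee_fin; lra.
    have h7 : s k - C - 2 * delta - delta <= gpx g0 (xi g).
      apply: (hBX g0 (xi g0)); first by lra.
      by apply: le_trans h6; rewrite lee_fin; lra.
    have := hXG g0 g (xi g) (s k - C - 3 * delta).
    by move=> /(_ ltac:(lra) ltac:(lra)); lra.
  apply: (@le_trans _ _ (size [seq g <- ball_seq H n%:R | s k - (C + 4 * delta) <= gp g0 g])%:R).
    by rewrite ler_nat.
  apply: le_trans (cone _ _ _) _; apply: le_trans (up _) _.
  rewrite /K3 -ys -!(mulrA K1) -!expRD (ler_pM2l K10) ler_expR /w.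
  rewrite -mulrN -!mulrDr (ler_pM2l e0); lra.
have big : K2 <= K3 * \sum_(0 <= k < N) y k.
  rewrite -(ler_pM2r (expR_gt0 (e * n%:R))); apply: le_trans (low n) _.
  rewrite -/A (@size_fibers _ kk N) => [|g _]; last by have [] := kkP g.
  rewrite natr_sum mulrAC mulr_sumr; apply: ler_sum_nat => k /andP[_ kN]; exact: cnt.
have big2 : eta <= \sum_(0 <= k < N) d k `^ (e / eps).
  have : K2 / K3 <= \sum_(0 <= k < N) y k by rewrite ler_pdivrMr // mulrC.
  rewrite /y big_split /= -mulr_sumr.
  have := ler_wpM2l (ltW eta0) (sum_half_powers R N); rewrite mulr1.
  have -> : K2 / K3 = 2 * eta by rewrite /eta; lra.
  lra.
apply: (@le_trans _ _ (\sum_(0 <= k < N) diam rho (U k) `^ (e / eps))%E).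
  under eq_bigr do rewrite dfin poweR_EFin.
  by rewrite sumEFin lee_fin.
by apply: nneseries_lim_ge => k _ _; exact: poweR_ge0.
Qed.

Lemma mu_setT_gt0 : exists2 c : R, 0 < c & (c%:E <= mu setT)%E.
Proof.
have [c c0 cP] := cover_sum_lower; exists c => //.
apply: (@le_trans _ _ (hausdorff_premeasure rho (e / eps) 1 setT)).
  by apply: le_ereal_inf_tmp => _ [U [TU _] <-]; exact: cP.
by apply: ereal_sup_ubound; exists 1 => /=.
Qed.

Lemma mu_setT_fin : exists2 K : R, 0 < K & (mu setT <= K%:E)%E.
Proof.
have [K K0 KP] := mu_cone_upper H gen nvc eps01; exists K => //.
have := KP 1%g 0; rewrite mulr0 oppr0 expR0 mulr1; congr (_ <= _)%E; congr Defs.mu.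
by apply/seteqP; split=> // xi _; exact: gpx_ge0.
Qed.

Lemma mu_avoid_two : exists (C c : R), 0 <= C /\ 0 < c /\ forall x y : G,
  (c%:E <= mu [set xi | (gpx x xi <= C)%R /\ (gpx y xi <= C)%R])%E.
Proof.
have [K K0 KP] := mu_cone_upper H gen nvc eps01; have [c c0 cP] := mu_setT_gt0.
(* At this depth each of the two cones has mass at most [c / 4]. *)
pose C := Num.max 0 (- ln (c / (4 * K)) / e).
exists C, (c / 2); split; first by rewrite le_max lexx.
split; first by rewrite divr_gt0.
move=> x y; set A := [set _ | _].
have Ke : K * expR (- (e * C)) <= c / 4.
  rewrite mulrC -ler_pdivlMr // -[leRHS]lnK ?posrE ?divr_gt0 //.
  rewrite ler_expR lerNl (mulrC e) -ler_pdivrMr // /C le_max; apply/orP; right.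
  by rewrite invfM mulrA.
have cone z : (mu [set xi | (C <= gpx z xi)%R] <= (c / 4)%:E)%E.
  by apply: le_trans (KP z C) _; rewrite lee_fin.
pose Bx : set B := [set xi | (C <= gpx x xi)%R]; pose By : set B := [set xi | (C <= gpx y xi)%R].
have TA : setT `<=` A `|` (Bx `|` By).
  move=> xi _; have [h1|h1] := leP (gpx x xi) C; last by right; left; exact: ltW.
  by have [h2|h2] := leP (gpx y xi) C; [left|right; right; exact: ltW].
have outer := @outer_measureU2 _ _ (hausdorff_outer rho D0).
have := le_trans cP (le_trans (@le_hausdorff_measure _ _ rho (e / eps) _ _ TA) (outer _ _)).
move=> /le_trans/(_ (leeD2l _ (outer _ _))).
move=> /le_trans/(_ (leeD2l _ (leeD (cone x) (cone y)))).
rewrite -EFinD -leeBlDr // -EFinB; congr (_ <= _)%E; congr EFin; lra.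
Qed.

End Positivity.

(** * Borel sets of the boundary and measurability *)

Section Borel.
Variables (R : realType) (G : groupType) (S : seq G) (H : hat_metric R S).
Hypothesis gen : generates S.
Hypothesis nvc : ~ virtually_cyclic G.
Let infG := not_virtually_cyclic_infinite nvc.
Variable eps : R.
Hypothesis eps01 : 0 < eps <= 1.
Local Notation B := (boundary_borel R S).
Local Notation len := (hat_length H).
Local Notation e := (growth_exponent H).
Local Notation gp := (gp H).
Local Notation gpx := (gpx H).
Local Notation gpb := (gpb H).
Local Notation act := (@boundary_act R G S).
Local Notation rho := (hat_visual H eps).
Local Notation mu := (mu H eps).
Implicit Types (g h x : G) (xi om ze : B).

Let eps0 : 0 < eps. Proof. by case/andP: eps01. Qed.
Let e0 : 0 < e := growth_exponent_gt0 H gen nvc.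
Let D0 : 0 < e / eps. Proof. by rewrite divr_gt0. Qed.

Definition visual_open (U : set B) : Prop :=
  forall xi, U xi -> exists2 r, 0 < r & forall om, rho xi om < r -> U om.

Lemma visual_lt t xi om : (rho xi om < expR (- (eps * t))) = (t%:E < gpb xi om)%E.
Proof.
have [[M -> ->]|[-> ->]] := visualE H eps01 xi om.
  by rewrite ltr_expR ltrN2 ltr_pM2l.
by rewrite expR_gt0 ((gpb_eqy H _ _).2 erefl) ltry.
Qed.

(** Shadows are defined by word products and visual balls by hat products; [gp_large_word]
    translates large values of the latter into large values of the former. *)
Lemma open_visual_open (W : set (compactification R S)) : open W -> visual_open (Bd @^-1` W).
Proof.
move=> [_ Wo] xi /Wo[r rW]; have [M MP] := gp_large_word H gen (r + 1).
have [delta d0 [_ _ hXG _ [hBX _]]] := boundary_hyperbolic H gen infG.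
(* The chain from [x i] through [xi] and [om] to [y j] uses the four-point inequality twice. *)
pose t := M + 2 * delta; exists (expR (- (eps * t))); first exact: expR_gt0.
move=> om; rewrite visual_lt => /ltW xo; apply: rW.
have [x xx xl] := vertex_limit_ex gen infG xi; have [y yo yl] := vertex_limit_ex gen infG om.
have far (ze : B) (z : nat -> G) : vertex_limit (Bd ze) z ->
    exists N, forall n, (N <= n)%N -> t <= gpx (z n) ze.
  move=> zl; have c : Bd ze @[_ --> \oo] --> (Bd ze : compactification R S) by exact: cvg_cst.
  have h := hg_cvg (H := H) (q := vertex R S 1%g) zl c.
  have [|N HN] := cvge_gt (t := t%:E) h.
    by rewrite (hat_gprod_eqy H _ _ _).2 ?ltry //; exists ze.
  by exists N => n /HN /ltW; rewrite gpxE lee_fin.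
have [N1 H1] := far xi x xl; have [N2 H2] := far om y yl.
exists (vertex R S \o x), (vertex R S \o y); split=> //.
exists (maxn N1 N2) => i j; rewrite !geq_max => /andP[Ni _] /andP[_ Nj].
suff : r + 1 <= gromov_product (@cayley_dist R G S)
  (vertex R S 1%g) (vertex R S (x i)) (vertex R S (y j)).
  by apply: lt_le_trans; rewrite ltrDl.
apply: MP; have h1 := hBX (x i) xi om t (H1 i Ni) xo.
have := hXG (x i) (y j) om (t - delta) h1; have := H2 j Nj; rewrite /t => h2.
by move=> /(_ ltac:(lra)); lra.
Qed.

Lemma mu_caratheodory (A : set B) : measurable A -> caratheodory_measurable mu A.
Proof.
move: A; apply: smallest_sub.
  split.
  - exact: (caratheodory_measurable_set0 (hausdorff_outer rho D0)).
  - move=> A mA; rewrite setTD.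
    exact: (@caratheodory_measurable_setC _ _ (hausdorff_outer rho D0)).
  - move=> F mF; exact: (@caratheodory_measurable_bigcup _ _ (hausdorff_outer rho D0)).
move=> _ [W Wo <-]; apply: hausdorff_measure_open_caratheodory => //.
- by move=> xi om ze; exact: visual_tri.
- exact: open_visual_open.
Qed.

Definition mu_borel : set B -> \bar R := mu.

Let mu_borel0 : mu_borel set0 = 0%E. Proof. exact: (hausdorff_measure0 rho D0). Qed.
Let mu_borel_ge0 A : (0 <= mu_borel A)%E. Proof. exact: hausdorff_measure_ge0. Qed.
Let mu_borel_sigma_additive : semi_sigma_additive mu_borel.
Proof.
move=> F mF tF mUF.
apply: (@caratheodory_measure_sigma_additive _ _ (hausdorff_outer rho D0)) => // [i|].
  exact: mu_caratheodory.
exact: mu_caratheodory.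
Qed.

HB.instance Definition _ := isMeasure.Build _ _ _ mu_borel
  mu_borel0 mu_borel_ge0 mu_borel_sigma_additive.

Let mu_borel_fin : fin_num_fun mu_borel.
Proof.
move=> A mA; rewrite ge0_fin_numE //; have [K K0 KP] := mu_setT_fin H gen nvc eps01.
apply: (@le_lt_trans _ _ K%:E); last by rewrite ltry.
by apply: le_trans KP; exact: le_hausdorff_measure.
Qed.

HB.instance Definition _ := Measure_isFinite.Build _ _ _ mu_borel mu_borel_fin.

Definition mu_finite : {finite_measure set B -> \bar R} := mu_borel.

Lemma measurable_open_preimage (W : set (compactification R S)) :
  open W -> measurable (Bd @^-1` W : set B).
Proof. by move=> Wo; apply: sub_sigma_algebra; exists W. Qed.

Lemma measurable_continuous_Bd (F : compactification R S -> \bar R) : continuous F ->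
  measurable_fun [set: B] (fun xi : B => F (Bd xi)).
Proof.
move=> cF; apply: (measurability _ (ErealGenOInfty.measurableE R)) => // _ [_ [x ->] <-].
rewrite setTI; apply: (measurable_open_preimage (W := F @^-1` `]x%:E, +oo[)).
by move/continuousP: cF; apply; rewrite set_itvoy; exact: open_ereal_gt_ereal.
Qed.

Lemma measurable_hg (q : cayley R S) (b : compactification R S) :
  measurable_fun [set: B] (fun xi : B => hat_gprod H q b (Bd xi)).
Proof.
apply: (measurable_continuous_Bd (F := hat_gprod H q b)) => a.
have hc := @hat_gprod_continuous _ _ _ H q (b, a).
exact: (cvg_comp _ _ (cvg_pair (cvg_cst b) (@cvg_id _ (nbhs a))) hc).
Qed.

Lemma measurable_gpx g : measurable_fun [set: B] (gpx g : B -> R).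
Proof.
apply/measurable_EFinP; have := measurable_hg (vertex R S 1%g) (Inner (vertex R S g)).
by congr measurable_fun; apply/funext => xi /=; rewrite gpxE.
Qed.

Lemma measurable_gpb om : measurable_fun [set: B] (gpb om : B -> \bar R).
Proof. exact: measurable_hg. Qed.

Lemma measurable_visual om : measurable_fun [set: B] (rho om).
Proof.
apply: (measurability _ (RGenInftyO.measurableE R)) => // _ [_ [x ->] <-]; rewrite setTI.
have [x0|x0] := leP x 0.
  rewrite (_ : _ @^-1` _ = set0) //; apply/seteqP; split=> // xi /=; rewrite in_itv /=.
  by move=> /lt_le_trans /(_ x0); rewrite ltNge visual_ge0.
have xE : expR (- (eps * (- ln x / eps))) = x.
  by rewrite (_ : - _ = ln x) ?lnK ?posrE //; field; rewrite gt_eqF.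
rewrite (_ : _ @^-1` _ = gpb om @^-1` `](- ln x / eps)%:E, +oo[); last first.
  by apply/seteqP; split=> xi /=; rewrite !in_itv /= andbT -visual_lt xE.
rewrite -[X in measurable X]setTI; apply: (measurable_gpb om) => //; exact: emeasurable_itv.
Qed.

(* The limit points of one ray per group element form a countable dense set. *)
Lemma dense_boundary : exists q : G -> B, forall xi (r : R), 0 < r -> exists g, rho xi (q g) < r.
Proof.
have [delta d0 [_ _ _ hXB _]] := boundary_hyperbolic H gen infG.
have [C C0 ray] := ray_point H gen infG; have [C' C'0 sh] := shadow_nonempty H gen nvc.
have /choice[q qP] g := sh g; exists q => xi r r0.
pose t := - ln r / eps + 1.
have [g [g1 g2]] := ray xi (Num.max 0 (t + 2 * C + C' + delta)) ltac:(by rewrite le_max lexx).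
exists g; move: g1; rewrite ler_norml => /andP[g1 _].
have g3 : t + 2 * C + C' + delta <= Num.max 0 (t + 2 * C + C' + delta) by rewrite le_max lexx orbT.
have := hXB g xi (q g) (t + delta) ltac:(lra) ltac:(have := qP g; lra).
rewrite addrK -(visual_le H eps01) => /le_lt_trans; apply.
rewrite -[ltRHS]lnK ?posrE // ltr_expR ltrNl -ltr_pdivrMl // [ltLHS]mulrC /t ltrDl ltr01 //.
Qed.

Lemma group_bigcup_measurable d (T : measurableType d) (F : G -> set T) :
  (forall g, measurable (F g)) -> measurable (\bigcup_g F g).
Proof.
move=> mF; rewrite (_ : \bigcup_g F g = \bigcup_n \bigcup_(g in [set` ball_seq H n%:R]) F g).
  by apply: bigcupT_measurable => n; apply: fin_bigcup_measurable.
apply/seteqP; split=> [x [g _ Fx]|x [n _ [g _ Fx]]]; last by exists g.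
by have [n gn] := archi_bound_ex (len g); exists n => //; exists g => //=; rewrite mem_ball_seq.
Qed.

(** By separability [U] is a countable union of balls with centers [q g]. This gives measurability
    of the action, which is Lipschitz for the visual metric. *)
Lemma visual_open_measurable (U : set B) : visual_open U -> measurable U.
Proof.
move=> Uo; have [q qP] := dense_boundary.
pose F g n := [set xi | rho (q g) xi < n.+1%:R^-1 /\
  forall om, rho (q g) om < n.+1%:R^-1 -> U om].
rewrite (_ : U = \bigcup_g \bigcup_n F g n).
  apply: group_bigcup_measurable => g; apply: bigcupT_measurable => n.
  have [h|h] := pselect (forall om, rho (q g) om < n.+1%:R^-1 -> U om); last first.
    by rewrite (_ : F g n = set0) //; apply/seteqP; split=> // xi [].
  rewrite (_ : F g n = [set: B] `&` rho (q g) @^-1` `]-oo, n.+1%:R^-1[).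
    exact: measurable_visual.
  by apply/seteqP; split=> xi /=; rewrite in_itv /=; [case|move=> [_ ?]].
apply/seteqP; split=> [xi Ux|xi [g _ [n _ [h1 h2]]]]; last exact: h2.
have [r r0 rU] := Uo xi Ux.
have [n nr] := archi_bound_ex (2 / r).
have nr' : n.+1%:R^-1 <= r / 2.
  rewrite -[leRHS]invf_div lef_pV2 ?posrE ?ltr0n ?divr_gt0 //.
  by apply: le_trans nr _; rewrite ler_nat.
have [g gP] := qP xi n.+1%:R^-1 ltac:(by rewrite invr_gt0 ltr0n).
exists g => //; exists n => //; split; first by rewrite visual_sym.
move=> om omP; apply: rU; apply: le_lt_trans (visual_tri H eps01 (q g) xi om) _;
  move: gP omP nr'; set a := _.+1%:R^-1; lra.
Qed.

Lemma measurable_act g : measurable_fun [set: B] (act g : B -> B).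
Proof.
pose gen_open : set (set B) := [set Bd @^-1` U | U in @open (compactification R S)].
have genE : (measurable : set (set B)) = <<s gen_open >> by [].
apply: (measurability _ genE).
move=> _ [_ [W Wo <-] <-]; rewrite setTI; apply: visual_open_measurable => xi /= Wxi.
have [r r0 rW] := open_visual_open Wo Wxi.
exists (r / expR (eps * len g)); first by rewrite divr_gt0 ?expR_gt0.
move=> om; rewrite ltr_pdivlMr ?expR_gt0 // mulrC => h; apply: rW.
exact: le_lt_trans (visual_act H gen nvc eps01 g xi om) h.
Qed.

(** Measurability is with respect to the product sigma-algebra, so superlevel sets are written as
    countable unions: [rho xi om < r] holds exactly when some [q g] has distances to [xi] and [om]
    with sum below [r]. *)
Lemma measurable_gpb2 : measurable_fun [set: B * B] (fun z : B * B => gpb z.1 z.2).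
Proof.
have [q qP] := dense_boundary.
apply: (measurability _ (ErealGenOInfty.measurableE R)) => // _ [_ [x ->] <-]; rewrite setTI.
set r := expR (- (eps * x)).
rewrite (_ : _ @^-1` _ = \bigcup_g ([set: B * B] `&`
    (fun z : B * B => rho (q g) z.1 + rho (q g) z.2) @^-1` `]-oo, r[)).
  apply: group_bigcup_measurable => g.
  have m : measurable_fun [set: B * B] (fun z : B * B => rho (q g) z.1 + rho (q g) z.2).
    apply: measurable_funD; apply: measurableT_comp => //; exact: measurable_visual.
  exact: m.
apply/seteqP; split=> [[xi om] /=|[xi om] [g _ [_ /=]]]; rewrite !in_itv /= ?andbT -visual_lt.
  move=> h; have [g gP] := qP xi ((r - rho xi om) / 2) ltac:(rewrite divr_gt0 ?subr_gt0 //).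
  exists g => //; split=> //=; rewrite in_itv /=.
  have := visual_tri H eps01 xi (q g) om; rewrite (visual_sym H eps01 (q g) xi); lra.
move=> h; apply: le_lt_trans (visual_tri H eps01 (q g) xi om) _.
by rewrite (visual_sym H eps01 xi).
Qed.

End Borel.

(** * The invariant measure on pairs *)

Section Nu.
Variables (R : realType) (G : groupType) (S : seq G) (H : hat_metric R S).
Hypothesis gen : generates S.
Hypothesis nvc : ~ virtually_cyclic G.
Variable eps : R.
Hypothesis eps01 : 0 < eps <= 1.
Local Notation B := (boundary_borel R S).
Local Notation e := (growth_exponent H).
Local Notation gpx := (gpx H).
Local Notation gpb := (gpb H).
Local Notation act := (@boundary_act R G S).
Local Notation mu := (mu H eps).
Local Notation m := (mu_finite H gen nvc eps01).
Local Notation nu := (nu H eps).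
Implicit Types (g h x : G) (xi om ze : B) (A : set (B * B)).
Local Open Scope ereal_scope.

Let e0 : (0 < e)%R := growth_exponent_gt0 H gen nvc.

Definition nu_density (z : B * B) : \bar R := expeR ((2 * e)%:E * hat_product H z.1 z.2).

Lemma nu_density_ge (t : R) z : t%:E <= gpb z.1 z.2 -> (expR (2 * e * t))%:E <= nu_density z.
Proof.
move=> tz; rewrite -[leLHS]/(expeR (2 * e * t)%:E) lee_expeR (EFinM (2 * e)%R).
by apply: lee_wpmul2l => //; rewrite lee_fin mulr_ge0 // ltW.
Qed.

Lemma nu_density_le (t : R) z : gpb z.1 z.2 <= t%:E -> nu_density z <= (expR (2 * e * t))%:E.
Proof.
move=> tz; rewrite -[leRHS]/(expeR (2 * e * t)%:E) lee_expeR (EFinM (2 * e)%R).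
by apply: lee_wpmul2l => //; rewrite lee_fin mulr_ge0 // ltW.
Qed.

Lemma nu_density_ge1 z : 1 <= nu_density z.
Proof. by have := nu_density_ge (gpb_ge0 H z.1 z.2); rewrite mulr0 expR0. Qed.

Lemma nu_density_ge0 z : 0 <= nu_density z. Proof. exact: expeR_ge0. Qed.

Lemma measurable_nu_density : measurable_fun [set: B * B] nu_density.
Proof.
apply: (measurability _ (ErealGenOInfty.measurableE R)) => // _ [_ [x ->] <-]; rewrite setTI.
have [x0|x0] := leP x 0%R.
  rewrite (_ : _ @^-1` _ = setT) //; apply/seteqP; split=> // z _ /=; rewrite in_itv /= andbT.
  by apply: lt_le_trans (nu_density_ge1 z); rewrite lte_fin (le_lt_trans x0).
rewrite (_ : _ @^-1` _ = [set: B * B] `&`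
    (fun z : B * B => gpb z.1 z.2) @^-1` `](ln x / (2 * e))%:E, +oo[).
  by apply: (measurable_gpb2 H gen nvc eps01) => //; exact: emeasurable_itv.
have ee : (0 < 2 * e)%R by rewrite mulr_gt0.
suff E z : (x%:E < nu_density z) = ((ln x / (2 * e))%:E < gpb z.1 z.2).
  by apply/seteqP; split=> [z|z [_]] /=; rewrite !in_itv /= !andbT E.
rewrite -{1}(lnK (_ : x \is Num.pos)) ?posrE // -[(expR _)%:E]/(expeR (ln x)%:E) lte_expeR.
rewrite /hat_product -/(gpb z.1 z.2); case: (gpb z.1 z.2) (gpb_ge0 H z.1 z.2) => [t||] // _.
  by rewrite -EFinM !lte_fin mulrC ltr_pdivrMr // mulrC.
by rewrite gt0_muley ?lte_fin // !ltry.
Qed.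

Let nu0 A := \int[m \x m]_(z in A) nu_density z.

Let nu00 : nu0 set0 = 0. Proof. exact: integral_set0. Qed.
Let nu0_ge0 A : 0 <= nu0 A. Proof. by apply: integral_ge0 => z _; exact: nu_density_ge0. Qed.
Let nu0_sigma_additive : semi_sigma_additive nu0.
Proof.
move=> F mF tF mUF; rewrite /nu0 ge0_integral_bigcup //.
- by apply: is_cvg_nneseries => n _ _; exact: nu0_ge0.
- exact: measurable_funS measurable_nu_density.
- by move=> z _; exact: nu_density_ge0.
Qed.

HB.instance Definition _ := isMeasure.Build _ _ _ nu0 nu00 nu0_ge0 nu0_sigma_additive.

(** The measure [nu0] witnesses the existence required in the definition of [nu], which excludes the
    default value [mzero]. *)
Lemma nuE A : measurable A -> nu A = \int[m \x m]_(z in A) nu_density z.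
Proof.
rewrite /Defs.nu; case: pselect => [ex|nex]; first by move=> mA; case: cid => /= n; apply.
by case: nex; exists nu0.
Qed.

Lemma nu_rect_ge (C E : set B) (t : R) : measurable C -> measurable E ->
  (forall z, (C `*` E) z -> t%:E <= gpb z.1 z.2) ->
  (expR (2 * e * t))%:E * (mu C * mu E) <= nu (C `*` E).
Proof.
move=> mC mE tCE; have mCE := measurableX mC mE.
rewrite nuE // -[mu C * mu E](product_measure1E m m mC mE) -integral_cst //.
apply: ge0_le_integral => //.
- by move=> z _; rewrite lee_fin expR_ge0.
- exact: measurable_funTS measurable_nu_density.
- by move=> z /tCE; exact: nu_density_ge.
Qed.

Lemma nu_le A (t : R) : measurable A -> (forall z, A z -> gpb z.1 z.2 <= t%:E) ->
  nu A <= (expR (2 * e * t))%:E * (mu setT * mu setT).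
Proof.
move=> mA tA; rewrite nuE //.
apply: (@le_trans _ _ (\int[m \x m]_(z in A) (cst (expR (2 * e * t))%:E z))).
  apply: ge0_le_integral => //.
  - by move=> z _; exact: nu_density_ge0.
  - exact: measurable_funTS measurable_nu_density.
  - by move=> z /tA; exact: nu_density_le.
rewrite integral_cst // lee_wpmul2l ?lee_fin ?expR_ge0 //.
rewrite -[leRHS](product_measure1E m m measurableT measurableT).
by apply: le_measure => //; rewrite ?inE //; exact: measurableX.
Qed.

(** The density is at least 1, so null sets can be tested on the product measure, where sections are
    available. *)
Lemma nu_eq0 A : measurable A -> nu A = 0 <-> (m \x m) A = 0.
Proof.
move=> mA; rewrite nuE //; split=> [A0|A0].
  apply/eqP; rewrite eq_le measure_ge0 andbT -A0 -[leLHS]mul1e -integral_cst //.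
  apply: ge0_le_integral => //.
  - exact: measurable_funTS measurable_nu_density.
  - by move=> z _; exact: nu_density_ge1.
by apply: null_set_integral => //; exact: measurable_funTS measurable_nu_density.
Qed.

Lemma mu_act_null g (A : set B) : mu A = 0 -> mu (act g @^-1` A) = 0.
Proof.
move=> A0; apply/eqP; rewrite eq_le hausdorff_measure_ge0 andbT.
have := mu_act H gen nvc eps01 g^-1%g A; rewrite A0 mule0; congr (mu _ <= _).
apply/seteqP; split=> [_ [xi Axi <-] /=|xi /= Axi]; first by rewrite boundary_actVK.
by exists (act g xi) => //; exact: boundary_actK.
Qed.

Lemma measurable_diag_act g : measurable_fun [set: B * B] (diag_act (R := R) (S := S) g).
Proof.
by apply: measurable_fun_pair; apply: measurableT_comp => //;
  exact: (measurable_act H gen nvc eps01).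
Qed.

Lemma measurable_diag_act_preimage g A : measurable A ->
  measurable (diag_act (R := R) (S := S) g @^-1` A).
Proof. by move=> mA; rewrite -[X in measurable X]setTI; exact: measurable_diag_act. Qed.

(** Almost every section of [A] is [mu]-null, and the action preserves [mu]-null sets both on the
    sections and on the exceptional set of first coordinates. *)
Lemma nu_act_null g A : measurable A -> nu A = 0 -> nu (diag_act g @^-1` A) = 0.
Proof.
move=> mA /(nu_eq0 mA) A0; have mgA := measurable_diag_act_preimage g mA.
apply/(nu_eq0 mgA).
have mx (C : set (B * B)) : measurable C -> measurable_fun [set: B] (m \o xsection C).
  exact: measurable_fun_xsection.
have : ae_eq m [set: B] (m \o xsection A) (cst 0).
  apply/ae_eq_integral_abs => //; first exact: mx.
  by rewrite -{}A0; apply: eq_integral => xi _; rewrite gee0_abs.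
move=> [N [mN N0 NA]].
rewrite /product_measure1; rewrite -(integral0 m setT).
apply: ae_eq_integral => //; first exact: mx.
exists (act g @^-1` N); split.
- by rewrite -[X in measurable X]setTI; apply: (measurable_act H gen nvc eps01).
- exact: mu_act_null.
move=> xi /= nxi; apply: NA => /= h; apply: nxi => _.
rewrite /= (_ : xsection _ xi = act g @^-1` xsection A (act g xi)).
  by apply: mu_act_null; exact: h.
by apply/seteqP; split=> om; rewrite /xsection /= !inE.
Qed.

End Nu.

(** * The cocycle *)

Section Cocycle.
Variables (R : realType) (G : groupType) (S : seq G) (H : hat_metric R S).
Hypothesis gen : generates S.
Hypothesis nvc : ~ virtually_cyclic G.
Let infG := not_virtually_cyclic_infinite nvc.
Local Notation B := (boundary_borel R S).
Local Notation len := (hat_length H).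
Local Notation e := (growth_exponent H).
Local Notation gp := (gp H).
Local Notation gpx := (gpx H).
Local Notation gpb := (gpb H).
Local Notation act := (@boundary_act R G S).
Local Notation rho := (hat_visual H 1).
Implicit Types (g h x : G) (xi om ze : B).

Let e0 : 0 < e := growth_exponent_gt0 H gen nvc.

Definition busemann_diff g (z : B * B) : R := gpx g z.1 - gpx g z.2.

Lemma busemann_diffM g h z :
  busemann_diff (g * h)%g z = busemann_diff h (diag_act g^-1%g z) + busemann_diff g z.
Proof.
have := busemannM H gen infG g h z.1; have := busemannM H gen infG g h z.2.
rewrite /busemann_diff /busemann /=; lra.
Qed.

Let one01 : 0 < (1 : R) <= 1. Proof. by rewrite ltr01 lexx. Qed.

Lemma visual_act_conformal g xi om :
  rho (act g^-1%g xi) (act g^-1%g om)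
    = rho xi om * expR (- len g) * (expR (gpx g xi) * expR (gpx g om)).
Proof.
have [[M E ->]|[-> ->]] := visualE H one01 xi om; last first.
  by rewrite !mul0r; have [_ h _ _] := visual_metric H one01; apply/h.
have [[M' E' ->]|[xo _]] := visualE H one01 (act g^-1%g xi) (act g^-1%g om).
  rewrite -!expRD; congr expR; have := gpb_act H gen infG g^-1%g xi om.
  rewrite E E' invgK lenV -EFinD => -[->]; ring.
have xo' : xi = om by rewrite -(boundary_actVK g xi) xo boundary_actVK.
by move: E; rewrite xo' ((gpb_eqy H _ _).2 erefl).
Qed.

(* Comparing the triangle inequalities of the visual metrics based at 1 and at [g]
   through a third point [ze] far from [xi]. *)
Lemma expR_gpx_lipschitz g xi om ze :
  (expR (gpx g xi) - expR (gpx g om)) * rho xi ze <= 2 * expR (2 * len g) * rho xi om.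
Proof.
have := visual_tri H one01 (act g^-1%g om) (act g^-1%g xi) (act g^-1%g ze).
rewrite !visual_act_conformal.
have tri := visual_tri H one01 xi om ze; rewrite (visual_sym H one01 om xi) in tri.
have F1 ta : 1 <= expR (gpx g ta) by rewrite -[leLHS]expR0 ler_expR gpx_ge0.
have FE ta : expR (gpx g ta) <= expR (len g) by rewrite ler_expR gpx_le.
rewrite -!mulrA ![_ * (expR (- len g) * _)]mulrCA -mulrDr ler_pM2l ?expR_gt0 //.
have -> : expR (2 * len g) = expR (len g) * expR (len g) by rewrite -expRD; congr expR; ring.
move: tri (F1 xi) (F1 om) (F1 ze) (FE xi) (FE om) (FE ze).
have := visual_ge0 H one01 xi om; have := visual_ge0 H one01 xi ze;
  have := visual_ge0 H one01 om ze.
set a := rho om ze; set b := rho xi ze; set c := rho xi om.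
set x := expR (gpx g xi); set y := expR (gpx g om); set z := expR (gpx g ze).
set E := expR (len g) => a0 b0 c0 tri x1 y1 z1 xE yE zE h.
have h1 : z * (x * b) <= z * (y * b) + c * (x * y) + z * (y * c).
  have := ler_wpM2l (_ : 0 <= y * z) tri; rewrite mulr_ge0 ?(le_trans ler01) // => /(_ isT).
  by move: h; lra.
have xy : x * y <= E * E by apply: ler_pM => //; lra.
have zy : z * y <= E * E by apply: ler_pM => //; lra.
have h2 : z * ((x - y) * b) <= 2 * (E * E) * c.
  by have := ler_wpM2r c0 xy; have := ler_wpM2r c0 zy; lra.
have [xy0|xy0] := leP y x.
  have h3 : (x - y) * b <= z * ((x - y) * b) by rewrite ler_peMl // mulr_ge0 // subr_ge0.
  by move: h2 h3; lra.
apply: (@le_trans _ _ 0).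
  by rewrite mulr_le0_ge0 // subr_le0 ltW.
by rewrite !mulr_ge0 ?expR_ge0.
Qed.

(** Of two fixed distinct points [a] and [b], one lies at distance at least [r] from any given [xi]
    and serves as [ze] in [expR_gpx_lipschitz]. Since [gpx] is nonnegative, differences of [gpx] are
    bounded by differences of its exponential. *)
Lemma busemann_diff_lipschitz g : exists2 C : R, 0 < C &
  forall z, `|busemann_diff g z| <= C * rho z.1 z.2.
Proof.
have [s [us ss]] := boundary_infinite H gen nvc 2.
case: s us ss => [|a [|b []]] // /andP[ab _] _; rewrite inE in ab.
pose r := rho a b / 2.
have r0 : 0 < r.
  rewrite divr_gt0 // lt_neqAle (visual_ge0 H one01) andbT; apply/eqP => /esym.
  have [_ h _ _] := visual_metric H one01; move=> /h ab'.
  by move: ab; rewrite ab' eqxx.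
exists (2 * expR (2 * len g) / r);
  first by apply: divr_gt0 => //; apply: mulr_gt0; [by []|exact: expR_gt0].
have half xi om : gpx g xi - gpx g om <= 2 * expR (2 * len g) / r * rho xi om.
  have [ze zer] : exists ze, r <= rho xi ze.
    have := visual_tri H one01 xi a b; rewrite (visual_sym H one01 a xi) => t.
    have [h|h] := leP r (rho xi a); first by exists a.
    by exists b; move: t h; rewrite /r; lra.
  have [h|h] := leP (gpx g xi) (gpx g om).
    apply: (@le_trans _ _ 0); first by rewrite subr_le0.
    by rewrite !mulr_ge0 ?expR_ge0 ?invr_ge0 ?(ltW r0) ?visual_ge0.
  have h1 : gpx g xi - gpx g om <= expR (gpx g xi) - expR (gpx g om).
    have -> : expR (gpx g xi) = expR (gpx g om) * expR (gpx g xi - gpx g om).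
      by rewrite -expRD; congr expR; ring.
    have F1 : 1 <= expR (gpx g om) by rewrite -[leLHS]expR0 ler_expR gpx_ge0.
    have := expR_ge1Dx (gpx g xi - gpx g om); set u := gpx g xi - gpx g om.
    have u0 : 0 <= u by rewrite subr_ge0 ltW.
    set v := expR u; set y := expR _ in F1 *; nra.
  rewrite mulrAC ler_pdivlMr //; apply: le_trans (expR_gpx_lipschitz g xi om ze).
  apply: ler_pM => //; [by rewrite subr_ge0 ltW|exact: ltW].
move=> [xi om] /=; rewrite /busemann_diff /= ler_norml half andbT.
by have := half om xi; rewrite (visual_sym H one01 om xi); lra.
Qed.

Variable eps : R.
Hypothesis eps01 : 0 < eps <= 1.
Local Notation mu := (mu H eps).
Local Notation nu := (nu H eps).
Variable p : R.
Hypothesis pe : 2 * e + 1 <= p.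

Let p0 : 0 < p. Proof. by apply: lt_le_trans pe; rewrite addr_gt0 // mulr_gt0. Qed.

Definition busemann_energy g : \bar R := (\int[nu]_z (`|(busemann_diff g z)%:E| `^ p))%E.

Lemma measurable_busemann_diff g : measurable_fun [set: B * B] (busemann_diff g).
Proof.
by apply: measurable_funB; apply: measurableT_comp => //; exact: measurable_gpx.
Qed.

Lemma measurable_energy_density g :
  measurable_fun [set: B * B] (fun z => (`|(busemann_diff g z)%:E| `^ p)%E).
Proof.
apply: (@measurableT_comp _ _ _ _ _ _ (fun x : \bar R => (x `^ p)%E)) => //.
  exact: measurable_poweR.
by apply: measurableT_comp => //; apply/measurable_EFinP; exact: measurable_busemann_diff.
Qed.

(** Index 0 is the diagonal, where the density is infinite but the integrand vanishes; index [k.+1]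
    is the slice with product in [[k, k + 1)]. *)
Let J k : set (\bar R) := if k is k'.+1 then `[k'%:R%:E, k'.+1%:R%:E[ else [set +oo%E].
Let F k : set (B * B) := (fun z => gpb z.1 z.2) @^-1` J k.

Let mF k : measurable (F k).
Proof.
have mJ : measurable (J k) by case: k => [|k]; [exact: emeasurable_set1|exact: emeasurable_itv].
by rewrite -[F k]setTI; exact: (measurable_gpb2 H gen nvc eps01).
Qed.

Let tF : trivIset setT F.
Proof.
have main i j z : (i < j)%N -> F i z -> F j z -> False.
  case: j => // j; rewrite /F /= in_itv /=; case: i => [|i] ij /=.
    by move=> -> /andP[_].
  rewrite in_itv /= => /andP[_ h1] /andP[h2 _].
  by have := le_lt_trans h2 h1; rewrite lte_fin ltr_nat ltnNge => /negP; apply.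
apply/trivIsetP => i j _ _ ij; apply/seteqP; split=> // z [Fi Fj].
by case: (ltngtP i j) => h; [apply: (main i j z)|apply: (main j i z)|rewrite h eqxx in ij].
Qed.

Let FT : \bigcup_k F k = setT.
Proof.
apply/seteqP; split=> // z _; have := gpb_ge0 H z.1 z.2.
case E : (gpb z.1 z.2) => [t||] // t0; last by exists 0%N; rewrite // /F /= E.
exists (Num.trunc t).+1 => //; rewrite /F /= E in_itv /= lee_fin lte_fin.
exact: Num.Theory.trunc_itv.
Qed.

(** Origin of [2 * e + 1]: on the slice [k.+1] the integrand is at most a multiple of
    [expR (- (p * k))], while the density and the total mass of [mu] bound [nu] by a multiple of
    [expR (2 * e * (k + 1))]. The extra 1 leaves [expR (- k) <= 2 ^- k]. *)
Lemma busemann_energy_fin g : (busemann_energy g < +oo)%E.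
Proof.
have [C C0 CP] := busemann_diff_lipschitz g; have [K K0 KP] := mu_setT_fin H gen nvc eps01.
have [A A0 AE] : exists2 A, 0 <= A & A = C `^ p * expR (2 * e) * (K * K).
  by exists (C `^ p * expR (2 * e) * (K * K)); rewrite // !mulr_ge0 ?powR_ge0 ?expR_ge0 // ltW.
have dens0 z : (0 <= `|(busemann_diff g z)%:E| `^ p)%E by exact: poweR_ge0.
rewrite /busemann_energy -FT ge0_integral_bigcup //; last first.
  by rewrite FT; exact: measurable_energy_density.
have term k : (\int[nu]_(z in F k) (`|(busemann_diff g z)%:E| `^ p) <= (2 * A * 2 ^- k)%:E)%E.
  case: k => [|k].
    rewrite integral0_eq => [|z /= /gpb_eqy zz]; first by rewrite lee_fin !mulr_ge0 ?expr0 ?invr1.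
    by rewrite /busemann_diff zz subrr normr0 powR0 // gt_eqF.
  apply: (@le_trans _ _ (\int[nu]_(z in F k.+1) (cst (C `^ p * expR (- (p * k%:R)))%:E z))%E).
    apply: ge0_le_integral => //.
    - exact: measurable_funTS (measurable_energy_density g).
    - move=> z /=; rewrite /F /= in_itv /= => /andP[kz _].
      rewrite lee_fin.
      have h : `|busemann_diff g z| <= C * expR (- k%:R).
        apply: le_trans (CP z) _; rewrite ler_wpM2l ?(ltW C0) //.
        by rewrite -[k%:R]mul1r visual_le.
      have h' : 0 <= C * expR (- k%:R) by rewrite mulr_ge0 ?expR_ge0 // ltW.
      apply: le_trans (ge0_ler_powR (ltW p0) _ _ h) _; rewrite ?nnegrE //.
      by rewrite powRM ?expR_ge0 ?(ltW C0) // -expRM mulNr (mulrC p).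
  rewrite integral_cst //.
  have nuF : (nu (F k.+1) <= (expR (2 * e * k.+1%:R) * (K * K))%:E)%E.
    apply: le_trans (nu_le gen nvc eps01 (t := k.+1%:R) (mF _) _) _.
      by move=> z; rewrite /F /= in_itv /= => /andP[_ /ltW].
    rewrite EFinM; apply: lee_wpmul2l; first by rewrite lee_fin expR_ge0.
    by rewrite EFinM; apply: lee_pmul => //; exact: hausdorff_measure_ge0.
  apply: le_trans (lee_wpmul2l _ nuF) _.
    by rewrite lee_fin mulr_ge0 ?powR_ge0 ?expR_ge0.
  rewrite -EFinM lee_fin.
  have ek : expR (- k%:R) <= 2 ^- k :> R.
    rewrite -[k%:R]mulr1 -mulrN expRM_natl -exprVn lerXn2r ?nnegrE ?expR_ge0 ?invr_ge0 //.
    by rewrite expRN lef_pV2 ?posrE ?expR_gt0 //; have := expR_ge1Dx (1 : R); lra.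
  have -> : 2 * A * 2 ^- k.+1 = A * 2 ^- k by rewrite exprS invfM; field; rewrite expf_neq0.
  apply: le_trans (ler_wpM2l A0 ek).
  have -> : C `^ p * expR (- (p * k%:R)) * (expR (2 * e * k.+1%:R) * (K * K)) =
    C `^ p * (expR (- (p * k%:R)) * expR (2 * e * k.+1%:R)) * (K * K) by ring.
  have -> : A * expR (- k%:R) = C `^ p * (expR (2 * e) * expR (- k%:R)) * (K * K)
    by rewrite AE; ring.
  rewrite -!expRD ler_wpM2r ?mulr_ge0 ?(ltW K0) // ler_wpM2l ?powR_ge0 // ler_expR -natr1.
  by have := ler_wpM2r (ler0n R k) pe; lra.
apply: (@le_lt_trans _ _ (4 * A)%:E); last by rewrite ltry.
apply: lime_le.
  by apply: is_cvg_nneseries => n _ _; apply: integral_ge0.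
apply: nearW => n.
apply: (@le_trans _ _ (\sum_(0 <= k < n) (2 * A * 2 ^- k)%:E)%E); first by apply: lee_sum => k _.
rewrite sumEFin lee_fin (eq_bigr (fun k => 4 * A * 2 ^- k.+1)) => [|k _]; last first.
  by rewrite exprS invfM; field; rewrite expf_neq0.
rewrite -mulr_sumr -[leRHS]mulr1 ler_wpM2l ?mulr_ge0 //.
exact: sum_half_powers.
Qed.

End Cocycle.

(** * Lower bounds for the norm of the cocycle *)

Section Properness.
Variables (R : realType) (G : groupType) (S : seq G) (H : hat_metric R S).
Hypothesis gen : generates S.
Hypothesis nvc : ~ virtually_cyclic G.
Let infG := not_virtually_cyclic_infinite nvc.
Local Notation B := (boundary_borel R S).
Local Notation len := (hat_length H).
Local Notation e := (growth_exponent H).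
Local Notation gp := (gp H).
Local Notation gpx := (gpx H).
Local Notation gpb := (gpb H).
Local Notation act := (@boundary_act R G S).
Implicit Types (g h x : G) (xi om ze : B).

Let e0 : 0 < e := growth_exponent_gt0 H gen nvc.

Variable eps : R.
Hypothesis eps01 : 0 < eps <= 1.
Local Notation mu := (mu H eps).
Local Notation nu := (nu H eps).
Variable p : R.
Hypothesis p0 : 0 < p.

(* The boundary points whose rays to 1 and to [g] branch off near [h]. *)
Let branch (C : R) g h : set B :=
  act h^-1%g @^-1` [set xi | (gpx h^-1%g xi <= C)%R /\ (gpx (h^-1 * g)%g xi <= C)%R].

Let measurable_branch C g h : measurable (branch C g h).
Proof.
have mle x : measurable ([set xi | gpx x xi <= C] : set B).
  rewrite (_ : [set _ | _] = setT `&` gpx x @^-1` `]-oo, C]).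
    by apply: measurable_gpx => //; exact: measurable_itv.
  by apply/seteqP; split=> xi /=; rewrite in_itv /=; [split|case].
rewrite /branch -[X in measurable X]setTI; apply: (measurable_act H gen nvc eps01) => //.
by apply: measurableI; exact: mle.
Qed.

(** The set [branch C g h] is the translate by [h] of a set of mass at least [c], and [mu_act] for
    [h^-1] limits the loss to [expR (e * len h)]. *)
Let mu_branch C c g h :
  (c%:E <= mu [set xi | (gpx h^-1%g xi <= C)%R /\ (gpx (h^-1 * g)%g xi <= C)%R])%E ->
  ((c * expR (- (e * len h)))%:E <= mu (branch C g h))%E.
Proof.
move=> cA; rewrite expRN EFinM muleC.
have e1 : 0 < expR (e * len h) by exact: expR_gt0.
rewrite lee_pdivrMl //; apply: (le_trans cA).
rewrite -(lenV H h); apply: le_trans (mu_act H gen nvc eps01 h^-1%g (branch C g h)).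
apply: le_hausdorff_measure => xi Axi; exists (act h xi); last exact: boundary_actK.
by rewrite /branch /= boundary_actK.
Qed.

Let branch_gpx C C1 g h s xi : `|len h - s| <= C1 ->
  `|len (h^-1 * g)%g - (len g - s)| <= C1 -> branch C g h xi ->
  `|gpx g xi - s| <= C + 2 * C1.
Proof.
move=> h1 h2 [/= b1 b2].
have := gpx_act H gen infG h (h^-1 * g)%g (act h^-1%g xi); rewrite mulVKg boundary_actVK => ->.
have := gpx_ge0 H h^-1%g (act h^-1%g xi); have := gpx_ge0 H (h^-1 * g)%g (act h^-1%g xi).
have := gp_ge0 H h^-1%g (h^-1 * g)%g.
move: h1 h2; rewrite gpE invgK mulVKg lenV !ler_norml => /andP[? ?] /andP[? ?] ? ? ?.
by apply/andP; split; lra.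
Qed.

(* Points [h_j] at distance about [j L] along a rough geodesic from 1 to [g] yield
   disjoint rectangles of [nu]-measure at least [c] on which the function is at least 1. *)
Lemma busemann_energy_lower : exists (L c : R), 0 < L /\ 0 < c /\ forall (n : nat) g,
  n%:R * L <= len g -> ((n%:R * c)%:E <= busemann_energy H eps p g)%E.
Proof.
have [C [c [C0 [c0 avoid]]]] := mu_avoid_two H gen nvc eps01.
have [C1 C10 rough] := len_rough H gen.
have [delta d0 [_ _ _ hXB _]] := boundary_hyperbolic H gen infG.
(* On [E j] the product with [g] is within [w] of [j * L], so this spacing separates consecutive
   values by at least 1. *)
pose w := C + 2 * C1; pose L := 2 * w + 1.
have w0 : 0 <= w by rewrite /w; lra.
(* The density on the [j]-th rectangle is at least [expR (2 * e * (j * L - w - delta))], and the two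
   sides have masses of order [expR (- (e * j * L))] and [expR (- (e * (j + 1) * L))]. The
   dependence on [j] cancels and leaves this constant. *)
pose c' := c * c * expR (- (e * (L + 2 * w + 2 * delta + 2 * C1))).
exists L, c'; split; first by rewrite /L; lra.
split; first by rewrite !mulr_gt0 ?expR_gt0.
move=> n g ng.
have Lpos : 0 < L by rewrite /L; lra.
have /choice[h hP] (j : nat) : exists h, (j <= n)%N ->
    `|len h - j%:R * L| <= C1 /\ `|len (h^-1 * g)%g - (len g - j%:R * L)| <= C1.
  have [jn|nj] := leqP j n; last by exists 1%g.
  have s01 : 0 <= j%:R * L <= len g.
    rewrite mulr_ge0 ?ler0n ?(ltW Lpos) //=; apply: le_trans ng.
    by rewrite ler_pM2r // ler_nat.
  by have [h [h1 h2]] := rough g _ s01; exists h.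
pose E j := branch C g (h j).
pose F j := E j `*` E j.+1.
have Egp j xi : (j <= n)%N -> E j xi -> `|gpx g xi - j%:R * L| <= w.
  by move=> jn Ej; have [h1 h2] := hP j jn; exact: branch_gpx Ej.
have mF j : measurable (F j) by apply: measurableX; exact: measurable_branch.
have Fbd j z : (j < n)%N -> F j z ->
    1 <= `|busemann_diff H g z| /\ ((j%:R * L - w - delta)%:E <= gpb z.1 z.2)%E.
  move=> jn [/= z1 z2]; have := Egp j z.1 (ltnW jn) z1; have := Egp j.+1 z.2 jn z2.
  rewrite /busemann_diff !ler_norml -natr1 mulrDl mul1r /L => /andP[h1 h2] /andP[h3 h4].
  split; first by rewrite ler0_norm; lra.
  by apply: (hXB g); lra.
have nuF j : (j < n)%N -> (c'%:E <= nu (F j))%E.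
  move=> jn; have [h1 _] := hP j (ltnW jn); have [h2 _] := hP j.+1 jn.
  apply: le_trans (nu_rect_ge gen nvc eps01 (t := j%:R * L - w - delta) _ _ _); last first.
  - by move=> z /(Fbd j z jn)[].
  - exact: measurable_branch.
  - exact: measurable_branch.
  have m1 := mu_branch (avoid (h j)^-1%g ((h j)^-1 * g)%g).
  have m2 := mu_branch (avoid (h j.+1)^-1%g ((h j.+1)^-1 * g)%g).
  apply: le_trans (lee_wpmul2l _ (lee_pmul _ _ m1 m2)); rewrite ?lee_fin ?expR_ge0 //.
  - rewrite /c'.
    have -> : expR (2 * e * (j%:R * L - w - delta)) *
       (c * expR (- (e * len (h j))) * (c * expR (- (e * len (h j.+1))))) =
      c * c * (expR (2 * e * (j%:R * L - w - delta)) *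
        (expR (- (e * len (h j))) * expR (- (e * len (h j.+1))))).
      by ring.
    rewrite ler_pM2l ?mulr_gt0 // -!expRD ler_expR.
    have -> : 2 * e * (j%:R * L - w - delta) + (- (e * len (h j)) - e * len (h j.+1)) =
       e * (2 * (j%:R * L - w - delta) - len (h j) - len (h j.+1)) by ring.
    rewrite -mulrN ler_pM2l //.
    by move: h1 h2; rewrite !ler_norml -natr1 mulrDl mul1r => /andP[_ h1] /andP[_ h2]; lra.
  - by rewrite mulr_ge0 ?expR_ge0 // ltW.
  - by rewrite mulr_ge0 ?expR_ge0 // ltW.
pose F' j := if (j < n)%N then F j else set0.
have mF' j : measurable (F' j) by rewrite /F'; case: ifP.
have tF' : trivIset setT F'.
  have main i j z : (i < j)%N -> F' i z -> F' j z -> False.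
    move=> ij; rewrite /F'; case: ifP => // iN; case: ifP => // jN [zi _] [zj _].
    have := Egp i z.1 (ltnW iN) zi; have := Egp j z.1 (ltnW jN) zj.
    have : (i%:R + 1) * L <= j%:R * L by rewrite ler_pM2r // natr1 ler_nat.
    by rewrite mulrDl mul1r !ler_norml {2}/L => ? /andP[? ?] /andP[? ?]; lra.
  apply/trivIsetP => i j _ _ ij; apply/seteqP; split=> // z [Fi Fj].
  by case: (ltngtP i j) => hij; [apply: (main i j z)|apply: (main j i z)|rewrite hij eqxx in ij].
pose U := \big[setU/set0]_(0 <= j < n) F' j.
have mU : measurable U by apply: bigsetU_measurable.
have Ubig z : U z -> 1 <= `|busemann_diff H g z|.
  rewrite /U -bigcup_seq => -[j /=]; rewrite /F'; case: ifP => // jn _ /(Fbd j z jn)[]; exact.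
apply: (@le_trans _ _ (nu U)).
  rewrite /U big_mkord measure_bigsetU //.
  apply: (@le_trans _ _ (\sum_(j < n) c'%:E)%E).
    by rewrite sumEFin lee_fin sumr_const card_ord mulr_natl.
  by apply: lee_sum => j _; rewrite /F' ltn_ord; exact: nuF.
rewrite -[leLHS]mul1e -integral_cst // /busemann_energy.
have energy0 z : setT z -> (0 <= `|(busemann_diff H g z)%:E| `^ p)%E.
  by move=> _; exact: poweR_ge0.
have sub := ge0_subset_integral nu mU measurableT
  (measurable_energy_density H p g) energy0 (@subsetT _ U).
apply: le_trans sub.
apply: ge0_le_integral => //.
- exact: measurable_funTS (measurable_energy_density H p g).
- move=> z /Ubig h1; rewrite /= lee_fin; apply: (@le_trans _ _ (1 `^ p)); first by rewrite powR1.
  by apply: (ge0_ler_powR (ltW p0)) => //; rewrite ?nnegrE.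
Qed.

End Properness.

(** * Classes of functions with finite $p$-norm *)

Section LpClass.
Context d (T : measurableType d) (R : realType) (nu : {measure set T -> \bar R}).
Variables (p : R) (p1 : (1 <= p%:E)%E) (f : T -> R).
Hypothesis mf : measurable_fun [set: T] f.
Hypothesis fp : (\int[nu]_x (`|(f x)%:E| `^ p) < +oo)%E.

Let measurable_pow (h : T -> R) : measurable_fun [set: T] h ->
  measurable_fun [set: T] (fun x => `|(h x)%:E| `^ p)%E.
Proof.
move=> mh; apply: (@measurableT_comp _ _ _ _ _ _ (fun x : \bar R => (x `^ p)%E)) => //.
  exact: measurable_poweR.
by apply: measurableT_comp => //; exact/measurable_EFinP.
Qed.

(** The coercion of a class to a function selects some representative, which agrees with [f] only
    almost everywhere; the norm is therefore transferred through equality of integrals. *)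
Lemma Lspace_class : exists F : LspaceType nu p1,
  (F : T -> R) = f %[ae nu] /\
  ('N[nu]_p%:E[EFin \o F] `^ p = \int[nu]_x (`|(f x)%:E| `^ p))%E.
Proof.
have p0 : 0 < p by apply: lt_le_trans ltr01 _; rewrite -lee_fin.
pose fm : {mfun T >-> measurableTypeR R} :=
  HB.pack f (isMeasurableFun.Build _ _ T (measurableTypeR R) f mf).
pose q : {mfun_ nu, T >-> measurableTypeR R} := \pi_({mfun_ nu, T >-> measurableTypeR R})%qT fm.
have qf : (q : T -> R) = f %[ae nu].
  have : (q == \pi_({mfun_ nu, T >-> measurableTypeR R})%qT fm) by [].
  rewrite -[q in q == _]reprK.
  by rewrite eqmodE => /asboolP.
have norm_q : ('N[nu]_p%:E[EFin \o q] `^ p = \int[nu]_x (`|(f x)%:E| `^ p))%E.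
  rewrite poweR_Lnorm ?gt_eqF //; apply: ae_eq_integral => //.
  - have mq : measurable_fun [set: T] (q : T -> R) := measurable_funPT (repr q).
    exact: (measurable_pow mq).
  - exact: (measurable_pow mf).
  - by apply: filterS qf => x h Tx; rewrite /= h.
have fin_q : finite_norm nu p%:E q.
  by apply: (lty_poweRy (lt0r_neq0 p0)); rewrite norm_q.
pose F : LspaceType nu p1 := HB.pack q (isFinLebesgue.Build _ _ _ nu p%:E p1 q fin_q).
by exists F.
Qed.

End LpClass.

Theorem theorem1p2 (R : realType) (G : groupType) (S : seq G)
    (H : hat_metric R S) :
  hyperbolic_group R G -> ~ virtually_cyclic G -> generates S ->
  exists2 p0 : R, 1 <= p0 &
    forall (eps p : R) (p1 : (1 <= p%:E)%E), 0 < eps <= 1 -> p0 <= p ->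
      exists c : G -> LspaceType (nu H eps) p1, is_cocycle c /\ is_proper c.
Proof.
move=> _ nvc gen; have e0 := growth_exponent_gt0 H gen nvc.
exists (2 * growth_exponent H + 1); first by rewrite lerDr mulr_ge0 // ltW.
move=> eps p p1 eps01 pe.
have p0 : 0 < p by apply: lt_le_trans ltr01 _; rewrite -lee_fin.
have /choice[c cP] g := Lspace_class p1 (measurable_busemann_diff H g)
  (busemann_energy_fin gen nvc eps01 pe g).
exists c; split.
- move=> g h; have [c_gh _] := cP (g * h)%g; have [c_g _] := cP g; have [c_h _] := cP h.
  (* The exceptional set of the representative of [c h] is pulled back by the action and remains
     null. *)
  have c_h' : (fun z => c h (diag_act g^-1%g z)) =
      (fun z => busemann_diff H h (diag_act g^-1%g z)) %[ae nu H eps].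
    case: c_h => N [mN N0 NP]; exists (diag_act g^-1%g @^-1` N); split.
    + exact: (measurable_diag_act_preimage H gen nvc eps01 g^-1%g mN).
    + exact: (nu_act_null gen nvc eps01 g^-1%g mN N0).
    + by move=> z nz; apply: NP => hz; apply: nz => _; exact: hz.
  apply: filterS2 c_h' (filterI c_gh c_g) => z h1 [h2 h3] _.
  by rewrite /= h2 // h3 // h1 // busemann_diffM.
- move=> M.
  have [L [k [L0 [k0 low]]]] := busemann_energy_lower H gen nvc eps01 p0.
  (* If [len g > K], then [n = trunc (len g / L)] satisfies [n * k > max(M, 0)^p], against the lower
     bound [n * k] on the $p$-th power of the norm. The maximum with 0 covers negative [M], since
     powers are compared on nonnegative numbers. *)
  pose K := (Num.max M 0 `^ p / k + 1) * L.
  have [s sP] := len_ball H gen K.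
  apply: (sub_finite_set _ (finite_seq s)) => g /= gM; apply: sP.
  have [_ normE] := cP g.
  rewrite leNgt; apply/negP => Kg.
  have len0 : 0 <= hat_length H g / L by rewrite divr_ge0 ?len_ge0 // ltW.
  have /andP[t1 t2] := Num.Theory.trunc_itv len0.
  set n := Num.trunc _ in t1 t2.
  have := low n g; rewrite -ler_pdivlMr // => /(_ t1).
  rewrite /busemann_energy -normE => h.
  have gM' : ('N[nu H eps]_p%:E[EFin \o c g] <= (Num.max M 0)%:E)%E.
    by apply: (le_trans gM); rewrite lee_fin le_max lexx.
  have := gt0_ler_poweR (ltW p0) _ _ gM'; rewrite !in_itv /= !leey !andbT Lnorm_ge0.
  rewrite lee_fin le_max lexx orbT => /(_ isT isT) /(le_trans h); rewrite lee_fin.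
  rewrite -ler_pdivlMr // => nK.
  move: t2 Kg; rewrite -natr1 ltr_pdivrMr // /K => t2 Kg.
  have := lt_trans Kg t2; rewrite ltr_pM2r // ltrD2r ltNge nK.
  by [].
Qed.
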